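(* Let $r\ge1$ be an integer and let $\mathbf z=(z_1,\mathbf z')$ denote a point varying in $\Omega^{r+1}$, with $\mathbf z'\in\Omega^r$. For any index $\mathfrak s$, write the $t_{\Lambda_{\mathbf z'}}$-expansion $$E_{r+1}(\mathfrak s;\mathbf z)=\sum_{N\ge0}\beta_{\mathfrak s,N}(\mathbf z')\,t_{\Lambda_{\mathbf z'}}(z_1)^N.$$ Then $\beta_{\mathfrak s,N}(\mathbf z')\in\mathcal{L}^{(r)}_{K,\mathrm{wt}(\mathfrak s)-N}$ for all $N\ge0$.
   Context: Let $q$ be a power of a prime $p$, $A=\mathbb{F}_q[\theta]$, $K=\mathbb{F}_q(\theta)$, $K_\infty=\mathbb{F}_q((1/\theta))$, $\mathbb{C}_\infty$ the completion of an algebraic closure of $K_\infty$, and $A_+\subset A$ the set of monic polynomials. For $r\ge1$, $\Omega^r=\{\mathbf z=(z_1,\ldots,z_r)\in\mathbb{C}_\infty^r : z_1,\ldots,z_r \text{ are } K_\infty\text{-linearly independent and } z_r=1\}$ (so $\Omega^1=\{1\}$), with its rigid analytic structure, and $\mathcal{O}(\Omega^r)$ is its algebra of rigid analytic functions. For $\mathbf f\in A^r$, $\langle \mathbf f,\mathbf z\rangle=f_1z_1+\cdots+f_rz_r$, and $\Lambda_{\mathbf z}=\{\langle\mathbf f,\mathbf z\rangle:\mathbf f\in A^r\}$, an $A$-lattice of rank $r$ in $\mathbb{C}_\infty$. For an $A$-lattice $\Lambda$, $\exp_\Lambda(X)=X\prod_{0\ne\lambda\in\Lambda}(1-X/\lambda)$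 and $t_\Lambda(X)=1/\exp_\Lambda(X)=\sum_{\lambda\in\Lambda}1/(X+\lambda)$. Partial order on $A^r$: for nonzero $\mathbf f\in A^r$ put $\ell(\mathbf f)=\min\{i: f_i\ne0\}$. Write $\mathbf f\succ 0$ if $f_{\ell(\mathbf f)}\in A_+$. For $\mathbf f,\mathbf g\succ0$ write $\mathbf f\succ\mathbf g$ if either $\ell(\mathbf f)<\ell(\mathbf g)$, or $\ell(\mathbf f)=\ell(\mathbf g)$ and $\deg f_{\ell(\mathbf f)}>\deg g_{\ell(\mathbf g)}$. An index is the empty index $\varnothing$ or a tuple $\mathfrak s=(s_1,\ldots,s_m)$ of positive integers; $\mathrm{wt}(\mathfrak s)=s_1+\cdots+s_m$, $\mathrm{wt}(\varnothing)=0$. The multiple Eisenstein series of rank $r$ is the rigid analytic function on $\Omega^r$ $$E_r(\mathfrak s;\mathbf z)=\sum_{\mathbf f_1\succ\cdots\succ\mathbf f_m\succ0,\ \mathbf f_i\in A^r}\frac{1}{\langle\mathbf f_1,\mathbf z\rangle^{s_1}\cdots\langle\mathbf f_m,\mathbf z\rangle^{s_m}},\qquad E_r(\varnothing;\mathbf z)=1.$$ $t$-expansion: write points of $\Omega^{r+1}$ as $\mathbf z=(z_1,\mathbf z')$ with $\mathbf z'=(z_2,\ldots,z_r,1)\in\Omega^r$. It is known that every rigid analytic function $F$ on $\Omega^{r+1}$ invariant under the matrices $\left(\begin{smallmatrix}1&*\\0&I_{r}\end{smallmatrix}\right)\in\mathrm{GL}_{r+1}(A)$ (i.e. under $z_1\mapsto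 z_1+\lambda$, $\lambda\in\Lambda_{\mathbf z'}$) has a unique expansion $F(\mathbf z)=\sum_{N\in\mathbb{Z}}F_N(\mathbf z')\,t_{\Lambda_{\mathbf z'}}(z_1)^N$ with $F_N\in\mathcal{O}(\Omega^r)$, valid in a neighborhood of infinity (for each $\mathbf z'$, when $|t_{\Lambda_{\mathbf z'}}(z_1)|$ is sufficiently small). The functions $E_{r+1}(\mathfrak s;\mathbf z)$ are of this type, with $F_N=0$ for $N<0$. For $r\ge 1$ and $\mathbf z\in\Omega^r$, the functions $g_1,\ldots,g_{r-1},\Delta_r\in\mathcal{O}(\Omega^r)$ are determined by $\exp_{\Lambda_{\mathbf z}}(\theta X)=\theta Y+g_1(\mathbf z)Y^q+\cdots+g_{r-1}(\mathbf z)Y^{q^{r-1}}+\Delta_r(\mathbf z)Y^{q^r}$ with $Y=\exp_{\Lambda_{\mathbf z}}(X)$; $\Delta_r$ is nowhere vanishing. For a subfield $L\subseteq\mathbb{C}_\infty$ containing $K$ and $w\ge0$, $\mathcal{Z}^{(r)}_{L,w}\subset\mathcal{O}(\Omega^r)$ is the $L$-span of all $E_r(\mathfrak s;\mathbf z)$ with $\mathrm{wt}(\mathfrak s)=w$. For $w\in\mathbb{Z}$, $$\mathcal{L}^{(r)}_{L,w}=\left\{F/\Delta_r^M : M\ge0,\ w+M(q^r-1)\ge0,\ F\in\mathcal{Z}^{(r)}_{L,w+M(q^r-1)}\right\}.$$ *)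

(* Defs.v *)
From HB Require Import structures.
From mathcomp Require Import all_boot all_order all_algebra finmap.
From mathcomp Require Import boolp classical_sets reals filter.
From mathcomp Require Import topology sequences summability.
From mathcomp Require mpoly.

Set Implicit Arguments.
Unset Strict Implicit.
Unset Printing Implicit Defensive.

Import Order.TTheory GRing.Theory Num.Theory.
Local Open Scope classical_set_scope.
Local Open Scope ring_scope.

(* A complete, algebraically closed field with a non-archimedean absolute
   value inducing its topology.  The normed structures of the libraries are
   of no use here: they require |x *+ n| = |x| *+ n, which fails in positive
   characteristic. *)
HB.mixin Record hasUltrametricAbs (R : realType) C
    of GRing.Field C & CompletePseudoMetric R C := {
  vabs : C -> R;
  vabs_ge0 : forall x, 0 <= vabs x;
  vabs_eq0 : forall x, (vabs x == 0) = (x == 0);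
  vabsM : forall x y, vabs (x * y) = vabs x * vabs y;
  vabsD_max : forall x y, vabs (x + y) <= Num.max (vabs x) (vabs y);
  vabs_ball : forall (x : C) (e : R),
    ball x e = [set y : C | vabs (x - y) < e]
}.

#[short(type="ultrametricClosedFieldType")]
HB.structure Definition UltrametricClosedField (R : realType) :=
  {C of GRing.ClosedField C & CompletePseudoMetric R C
      & hasUltrametricAbs R C}.

Section Cinfty.
Variables (R : realType) (F : finFieldType) (C : ultrametricClosedFieldType R).
Variable iota : {rmorphism {fraction {poly F}} -> C}.

Definition embA (a : {poly F}) : C := iota (tofrac a).
Definition theta : C := embA 'X.
Definition Kfield : set C := range iota.

(* F_q((1/theta)), as the sums of Laurent series
   \sum_(n >= 0) a_n theta^(d - n) *)
Definition Kinf : set C :=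
  [set x | exists (d : nat) (a : nat -> F),
     series (fun n => embA (a n)%:P * theta ^+ d * theta ^- n) @ \oo --> x].

(* C, with K embedded by iota, is a completion of an algebraic closure of
   K_infty, with the absolute value normalised by |theta| = q. *)
Definition is_Cinfty : Prop :=
  (forall a : {poly F}, a != 0 ->
     vabs (embA a) = #|F|%:R ^+ (size a).-1) /\
  dense [set x : C | exists p : {poly C},
           [/\ p != 0, forall i, Kinf p`_i & root p x]].

(* Unconditional sums and products over a set of indices: limits along the
   finite subsets ordered by inclusion. *)
Definition usum (I : choiceType) (D : set I) (x : I -> C) : C :=
  lim ((\sum_(i <- enum_fset A | i \in D) x i) @[A --> @totally I]).

Definition uprod (I : choiceType) (D : set I) (x : I -> C) : C :=
  lim ((\prod_(i <- enum_fset A | i \in D) x i) @[A --> @totally I]).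

Definition Omega (r : nat) : set 'rV[C]_r :=
  [set z | (forall c : 'rV[C]_r, (forall i, Kinf (c 0 i)) ->
              \sum_i c 0 i * z 0 i = 0 -> c = 0) /\
           (forall i : 'I_r, i.+1 = r -> z 0 i = 1)].

(* The standard admissible covering of Omega^r by affinoids:
   |<c, z>| >= q^-n |c| |z| for all K_infty-rational c, where |.| is the
   maximum norm. *)
Definition Omega_aff (r n : nat) : set 'rV[C]_r :=
  [set z | Omega z /\
     forall c : 'rV[C]_r, (forall i, Kinf (c 0 i)) ->
     forall i j, vabs (c 0 i) * vabs (z 0 j)
                   <= #|F|%:R ^+ n * vabs (\sum_k c 0 k * z 0 k)].

(* Functions on Omega^r are represented by functions on C^r of which only the
   restriction to Omega^r matters.  On each affinoid of the covering, a rigid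
   analytic function is a uniform limit of rational functions without poles. *)
Definition rigid_analytic (r : nat) (f : 'rV[C]_r -> C) : Prop :=
  forall (n : nat) (e : R), 0 < e ->
  exists P Q : mpoly.mpoly r C, forall z, Omega_aff n z ->
    mpoly.meval (fun i => z 0 i) Q != 0 /\
    vabs (f z - mpoly.meval (fun i => z 0 i) P
                / mpoly.meval (fun i => z 0 i) Q) < e.

Definition pairing (r : nat) (f : 'rV[{poly F}]_r) (z : 'rV[C]_r) : C :=
  \sum_i embA (f 0 i) * z 0 i.

Definition Lambda (r : nat) (z : 'rV[C]_r) : set C :=
  [set pairing f z | f in [set: 'rV[{poly F}]_r]].

Definition expL (L : set C) (X : C) : C :=
  X * uprod (L `\ 0) (fun l => 1 - X / l).

Definition tL (L : set C) (X : C) : C := (expL L X)^-1.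

(* i = l(f) *)
Definition is_ell (r : nat) (f : 'rV[{poly F}]_r) (i : 'I_r) : bool :=
  (f 0 i != 0) && [forall j : 'I_r, (j < i)%N ==> (f 0 j == 0)].

Definition succ0 (r : nat) (f : 'rV[{poly F}]_r) : bool :=
  [exists i, is_ell f i && (f 0 i \is monic)].

(* The entries compared are nonzero, so sizes compare as degrees. *)
Definition succv (r : nat) (f g : 'rV[{poly F}]_r) : bool :=
  [&& succ0 f, succ0 g &
   [exists i, exists j, [&& is_ell f i, is_ell g j &
      (i < j)%N || (i == j) && (size (g 0%R j) < size (f 0%R i))%N]]].

Definition is_index (s : seq nat) : bool := all (fun k => 0 < k)%N s.
Definition wt (s : seq nat) : nat := sumn s.

Definition Eis (r : nat) (s : seq nat) (z : 'rV[C]_r) : C :=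
  usum [set f : (size s).-tuple 'rV[{poly F}]_r |
          sorted (@succv r) f && all (@succ0 r) f]
       (fun f => \prod_(i < size s) pairing (tnth f i) z ^- nth 0%N s i).

(* The coefficient Delta_r(z) of Y^(q^r); the g i with 0 < i < r are the
   lower coefficients.  The identity in X determines it since Y takes
   infinitely many values. *)
Definition Delta (r : nat) (z : 'rV[C]_r) : C :=
  xget 0 [set D | exists g : nat -> C, forall X : C,
    let Y := expL (Lambda z) X in
    expL (Lambda z) (theta * X) =
      theta * Y + \sum_(1 <= i < r) g i * Y ^+ (#|F| ^ i)%N
      + D * Y ^+ (#|F| ^ r)%N].

Definition calZ (L : set C) (r w : nat) : set ('rV[C]_r -> C) :=
  [set f | exists (n : nat) (c : 'I_n -> C) (s : 'I_n -> seq nat),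
     [/\ forall k, L (c k),
         forall k, is_index (s k) /\ wt (s k) = w &
         forall z, Omega z -> f z = \sum_k c k * Eis (s k) z]].

Definition calL (L : set C) (r : nat) (w : int) : set ('rV[C]_r -> C) :=
  [set f | exists (M k : nat) (G : 'rV[C]_r -> C),
     [/\ k%:Z = w + (M * (#|F| ^ r - 1))%N%:Z, calZ L k G &
         forall z, Omega z -> f z = G z / Delta z ^+ M]].

(* The point (z_1, z') *)
Definition consz (r : nat) (z1 : C) (z' : 'rV[C]_r) : 'rV[C]_r.+1 :=
  row_mx (const_mx z1 : 'rV_1) z'.

Definition t_expansion (r : nat) (G : 'rV[C]_r.+1 -> C)
    (beta : nat -> 'rV[C]_r -> C) : Prop :=
  (forall N, rigid_analytic (beta N)) /\
  forall z', Omega z' -> exists2 e : R, 0 < e &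
    forall z1, Omega (consz z1 z') ->
      let t := tL (Lambda z') z1 in
      vabs t < e ->
      series (fun N => beta N z' * t ^+ N) @ \oo --> G (consz z1 z').

End Cinfty.

(* Main.v *)
(* The sum over chains f_1 > ... > f_m > 0 splits according to how many f_i involve z_1.
   With S_k(X) the sum of 1/(X + l)^k over the lattice of z', this writes E_{r+1}(s; z) as
   a sum over j and over monic a_1, ..., a_j of decreasing degrees of
   S_{s_1}(a_1 z_1) ... S_{s_j}(a_j z_1) E_r(s_{j+1}, ..., s_m; z').  Here S_k(X) is a
   polynomial in t(X) (Goss), t(aX) is a power series in t(X) whose coefficients involve
   only Delta^-1 and the coefficients of exp(theta X) = theta Y + g_1 Y^q + ... +
   Delta Y^(q^r), and terms with a_1 of large degree are of high order in t.

   The weights work out because the span of the E_r(s) is a ring containing the g_i and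
   Delta.  These facts are proved at finite level, where the lattice is replaced by the
   F-span of finitely many basis elements: the products of multiple sums obey a shuffle
   relation from partial fractions, Newton's identities express the coefficients of the
   exponential by power sums, and the coefficients that occur do not depend on the level.
   Everything then passes to the limit in the level.

   The coefficients beta_N are identified by comparing asymptotic expansions as t -> 0 along
   points z_1 whose absolute value is not that of an element of the K_infty-span of z';
   at such points all absolute values can be computed factor by factor. *)

Require Import Defs.
From HB Require Import structures.
From mathcomp Require Import all_boot all_order all_algebra.
From mathcomp Require Import abelian finfield finmap generic_quotient.
From mathcomp Require Import boolp classical_sets reals.
From mathcomp Require Import topology sequences summability.
From mathcomp Require Import ring lra zify.

Set Implicit Arguments.
Unset Strict Implicit.
Unset Printing Implicit Defensive.

Import Order.TTheory GRing.Theory Num.Theory.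
Local Open Scope classical_set_scope.
Local Open Scope ring_scope.

(** * Spans of finite bases and multiple sums *)

(** Products and coefficients of the infinite sums would need rearrangements; at finite level they
    are identities of finite sums with coefficients in [K] common to all free bases, and only
    term-by-term convergence is left for the limit. Weights are degrees of homogeneity: scaling a
    basis by [a] multiplies a sum of weight [w] by [a^-w]. As [t] has weight 1, the coefficient of
    [t^i] in a series of weight [w] has weight [w - i]. The obstacle at infinity is cancellation:
    for a lattice element [v], [|X + v|] may be far smaller than [|X|], and then neither [exp(X)]
    nor the tail over monic [a] is controlled. At points whose absolute value is not taken on the
    span, [|X + v|] is the maximum of [|X|] and [|v|], so [|exp|] grows with [|X|]. Multiplication
    by nonzero elements of [A] preserves such points, hence they approach [t = 0], and a power
    series in [t] is determined by its values along them. The tail estimate is uniform in the levels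
    of [z_1] and of [z'], which allows freezing the first while the second grows. *)

Lemma in_enum (T : finType) (x : T) : (x \in enum T) = true.
Proof. by rewrite mem_enum. Qed.

Section SpanList.
Variables (F : finFieldType) (V : zmodType) (sc : F -> V -> V).

(* The span is listed with multiplicity: [uniq (span bs)] says that [bs] is free. *)
Fixpoint span (bs : seq V) : seq V :=
  if bs is b :: bs' then [seq sc c b + v | c <- enum F, v <- span bs'] else [:: 0].

(* The basis is listed with the highest level first; the elements of the level of [b] are
   [b + v] with [v] in the span of the remaining basis. *)
Fixpoint chains (bs : seq V) (m : nat) : seq (seq V) :=
  if bs is b :: bs' then
    chains bs' m ++
    (if m is m'.+1 then [seq (b + v) :: c | v <- span bs', c <- chains bs' m']
     else [::])
  else if m is 0 then [:: [::]] else [::].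

Lemma chains0 bs : chains bs 0 = [:: [::]].
Proof. by elim: bs => //= b bs ->; rewrite cats0. Qed.

Lemma span_consP b bs v :
  reflect (exists c w, w \in span bs /\ v = sc c b + w) (v \in span (b :: bs)).
Proof.
apply: (iffP allpairsP) => [[[c w] /= [_ ws ->]]|[c [w [ws ->]]]]; first by exists c, w.
by exists (c, w); rewrite in_enum.
Qed.

Hypothesis sc0 : forall v, sc 0 v = 0.

Lemma span_cons_perm b bs :
  perm_eq (span (b :: bs))
    (span bs ++ [seq sc c b + v | c <- [seq c <- enum F | c != 0], v <- span bs]).
Proof.
have E : perm_eq (enum F) (0 :: [seq c <- enum F | c != 0]).
  apply: uniq_perm; first exact: enum_uniq.
    by rewrite /= mem_filter eqxx /= filter_uniq ?enum_uniq.
  by move=> c; rewrite in_cons [in RHS]mem_filter !in_enum andbT; case: eqP.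
apply: perm_trans (perm_allpairs (fun c v => sc c b + v) E (perm_refl (span bs))) _.
rewrite /= sc0.
by under eq_map do rewrite add0r; rewrite map_id.
Qed.

Lemma span_uniq_behead b bs : uniq (span (b :: bs)) -> uniq (span bs).
Proof. by rewrite (perm_uniq (span_cons_perm b bs)) cat_uniq => /and3P[]. Qed.

Lemma chains_uniq bs m : (forall v, sc 1 v = v) -> uniq (span bs) -> uniq (chains bs m).
Proof.
move=> sc1; elim: bs m => [|b bs IH] [|m] //=.
  by rewrite chains0 cats0.
move=> U; have Ub : uniq (span bs) := span_uniq_behead U; rewrite cat_uniq IH //=; apply/andP;
  split; last first.
  apply: allpairs_uniq => //; first exact: IH.
  by move=> [v c] [v' c'] _ _ /= [/addrI -> ->].
(* The two halves of [chains] are disjoint because a chain over the smaller basis starts in its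
   span, whereas [b + v] lies outside that span. *)
have hd : forall bs' m' x c, x :: c \in chains bs' m' -> uniq (span bs') -> x \in span bs'.
  elim=> [|b' bs' IHb] [|m'] x c //=.
    by rewrite chains0 cats0 mem_seq1.
  rewrite (perm_mem (span_cons_perm b' bs')) => + U'.
  rewrite !mem_cat => /orP[/IHb/(_ (span_uniq_behead U')) -> //|].
  case/allpairsP=> [[v d]] [/= vs _ [-> _]]; apply/orP; right.
  by apply/allpairsP; exists (1, v); rewrite sc1 mem_filter oner_neq0 in_enum.
apply/hasPn => c /allpairsP[[v d]] [/= vs _ ->]; apply/negP => /hd/(_ Ub) bv.
move: U; rewrite (perm_uniq (span_cons_perm b bs)) cat_uniq => /and3P[_ /hasPn/(_ (b + v)) + _].
rewrite bv => /(_ _)/negP; apply=> //.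
by apply/allpairsP; exists (1, v); rewrite sc1 mem_filter oner_neq0 in_enum.
Qed.

End SpanList.

Section SpanMap.
Variables (F : finFieldType) (V W : zmodType) (sc : F -> V -> V) (sd : F -> W -> W).
Variables (h : V -> W) (h0 : h 0 = 0) (hD : {morph h : x y / x + y}).
Hypothesis hs : forall c v, h (sc c v) = sd c (h v).

Lemma span_map bs : span sd (map h bs) = map h (span sc bs).
Proof.
elim: bs => [|b bs IH] /=; first by rewrite h0.
by rewrite IH map_allpairs allpairs_mapr; apply: eq_allpairs => c v; rewrite hD hs.
Qed.

Lemma chains_map bs m : chains sd (map h bs) m = map (map h) (chains sc bs m).
Proof.
elim: bs m => [|b bs IH] [|m] //=; rewrite ?IH ?cats0 //.
rewrite map_cat; congr (_ ++ _).
rewrite map_allpairs span_map allpairs_mapl allpairs_mapr.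
by apply: eq_allpairs => v c /=; rewrite hD.
Qed.

End SpanMap.

(** * Multiple sums at finite level and their products *)

Section FiniteLevel.
Variables (F : finFieldType) (K C : fieldType).
Variables (jK : {rmorphism F -> K}) (io : {rmorphism K -> C}).

(** Scalars pass through [K] so that power sums over [F] are recorded as elements of [K], the
    coefficient field of the theorem. *)
Definition fscale (c : F) (v : C) : C := io (jK c) * v.
Local Notation fspan := (span fscale).

Lemma fscale0 v : fscale 0 v = 0.
Proof. by rewrite /fscale !rmorph0 mul0r. Qed.

Lemma fscale1 v : fscale 1 v = v.
Proof. by rewrite /fscale !rmorph1 mul1r. Qed.

Lemma fscalar_eq0 c : (io (jK c) == 0) = (c == 0).
Proof. by rewrite !fmorph_eq0. Qed.

Lemma fspan_consP b bs v :
  reflect (exists c w, w \in fspan bs /\ v = fscale c b + w) (v \in fspan (b :: bs)).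
Proof. exact: span_consP. Qed.

Lemma fspan0 bs : 0 \in fspan bs.
Proof.
elim: bs => [|b bs IH]; first by rewrite inE.
by apply/fspan_consP; exists 0, 0; rewrite fscale0 addr0.
Qed.

Lemma fspanD bs v w : v \in fspan bs -> w \in fspan bs -> v + w \in fspan bs.
Proof.
elim: bs v w => [|b bs IH] v w; first by rewrite !inE => /eqP -> /eqP ->; rewrite addr0.
move=> /fspan_consP[c [x [xs ->]]] /fspan_consP[d [y [ys ->]]].
apply/fspan_consP; exists (c + d), (x + y); split; first exact: IH.
by rewrite /fscale !rmorphD /=; ring.
Qed.

Lemma fspanZ bs c v : v \in fspan bs -> fscale c v \in fspan bs.
Proof.
elim: bs v => [|b bs IH] v; first by rewrite !inE => /eqP ->; rewrite /fscale mulr0.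
move=> /fspan_consP[d [x [xs ->]]]; apply/fspan_consP; exists (c * d), (fscale c x).
by split; [exact: IH | rewrite /fscale !rmorphM /=; ring].
Qed.

Lemma fspanN bs v : v \in fspan bs -> - v \in fspan bs.
Proof. by move/(fspanZ (-1)); rewrite /fscale !rmorphN1 mulN1r. Qed.

Lemma fspan_perm bs (h : C -> C) : uniq (fspan bs) -> injective h ->
  (forall v, v \in fspan bs -> h v \in fspan bs) -> perm_eq (map h (fspan bs)) (fspan bs).
Proof.
move=> U hI hs; have Um : uniq (map h (fspan bs)) by rewrite map_inj_uniq.
have sub : {subset map h (fspan bs) <= fspan bs} by move=> x /mapP[v vs ->]; apply: hs.
apply: uniq_perm => //.
by have [] := uniq_min_size Um sub; rewrite ?size_map.
Qed.

Lemma fspan_sum_perm (W : nmodType) bs (h : C -> C) (P : pred C) (f : C -> W) :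
  uniq (fspan bs) -> injective h ->
  (forall v, v \in fspan bs -> h v \in fspan bs) ->
  \sum_(v <- fspan bs | P (h v)) f (h v) = \sum_(v <- fspan bs | P v) f v.
Proof. by move=> U hI hs; rewrite -[RHS](perm_big _ (fspan_perm U hI hs)) big_map. Qed.

Lemma fspan_cons_sum (W : nmodType) b bs (P : pred C) (f : C -> W) :
  \sum_(v <- fspan (b :: bs) | P v) f v =
  \sum_(v <- fspan bs | P v) f v +
  \sum_(c : F | c != 0) \sum_(v <- fspan bs | P (fscale c b + v)) f (fscale c b + v).
Proof.
rewrite (perm_big _ (span_cons_perm fscale0 b bs)) big_cat /=; congr (_ + _).
rewrite big_mkcond big_allpairs_dep big_filter big_enum_cond.
by apply: eq_bigr => c _; rewrite -big_mkcond.
Qed.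

Lemma fspan_cons_prod b bs (R : comPzSemiRingType) (P : pred C) (f : C -> R) :
  \prod_(v <- fspan (b :: bs) | P v) f v =
  \prod_(v <- fspan bs | P v) f v *
  \prod_(c : F | c != 0) \prod_(v <- fspan bs | P (fscale c b + v)) f (fscale c b + v).
Proof.
rewrite (perm_big _ (span_cons_perm fscale0 b bs)) big_cat /=; congr (_ * _).
rewrite big_mkcond big_allpairs_dep big_filter big_enum_cond.
by apply: eq_bigr => c _; rewrite -big_mkcond.
Qed.

Lemma fspan_uniq_notin b bs c v :
  uniq (fspan (b :: bs)) -> c != 0 -> v \in fspan bs -> fscale c b + v != 0.
Proof.
rewrite (perm_uniq (span_cons_perm fscale0 b bs)) cat_uniq => /and3P[_ /hasPn + _] c0 vs.
move=> /(_ 0); rewrite fspan0 => H; apply/eqP => E; move: H => /(_ _)/negP; apply=> //.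
by apply/allpairsP; exists (c, v); rewrite mem_filter c0 in_enum.
Qed.

Lemma fspan_uniq_shift b bs v :
  uniq (fspan (b :: bs)) -> v \in fspan bs -> b + v != 0.
Proof. by move=> U vs; rewrite -[b]fscale1 (fspan_uniq_notin U) ?oner_neq0. Qed.

Definition psum b bs s : C := \sum_(v <- fspan bs) (b + v) ^- s.

(** A truncated multiple Eisenstein series: either the whole chain lies below the level of [b], or
    its first element is some [b + v] and the rest lies below. Later inductions on the basis use
    this recursion in place of the chains. *)
Fixpoint MS (bs : seq C) (ss : seq nat) : C :=
  if bs is b :: bs' then
    MS bs' ss + (if ss is s :: ss' then psum b bs' s * MS bs' ss' else 0)
  else if ss is [::] then 1 else 0.

Lemma MS_nil bs : MS bs [::] = 1.
Proof. by elim: bs => //= b bs ->; rewrite addr0. Qed.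

Lemma chains_MS bs ss :
  \sum_(c <- chains fscale bs (size ss))
     \prod_(i < size ss) nth 0 c i ^- nth 0%N ss i = MS bs ss.
Proof.
elim: bs ss => [|b bs IH] [|s ss] //=.
- by rewrite big_seq1 big_ord0.
- by rewrite big_nil.
- by rewrite cats0 chains0 big_seq1 big_ord0 MS_nil addr0.
rewrite big_cat /= (IH (s :: ss)); congr (_ + _).
rewrite big_allpairs_dep /psum mulr_suml; apply: eq_bigr => v _.
rewrite -IH mulr_sumr; apply: eq_bigr => c _.
by rewrite big_ord_recl /=.
Qed.

Definition nzsum bs j : C := \sum_(v <- fspan bs | v != 0) v ^- j.

Definition scalar_powersum j : K := \sum_(c : F | c != 0) jK c ^- j.

(** Every nonzero element of the span is, for a unique nonzero scalar, the multiple of a unique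
    element [b + v] of some level, so the scalars factor out. *)
Lemma nzsumE bs j : uniq (fspan bs) -> nzsum bs j = io (scalar_powersum j) * MS bs [:: j].
Proof.
elim: bs => [|b bs IH] U; first by rewrite /nzsum /= big_cons big_nil eqxx mulr0.
rewrite /nzsum fspan_cons_sum /= [X in X + _]IH ?(span_uniq_behead fscale0 U) //.
rewrite MS_nil mulr1 mulrDr; congr (_ + _).
rewrite /scalar_powersum rmorph_sum mulr_suml; apply: eq_bigr => c c0; rewrite /psum mulr_sumr.
rewrite -(@fspan_sum_perm _ bs (fscale c) (fun v => fscale c b + v != 0)
  (fun v => (fscale c b + v) ^- j)).
- rewrite [LHS]big_mkcond /=; apply: eq_big_seq => v vs.
  have -> : fscale c b + fscale c v = fscale c (b + v) by rewrite /fscale mulrDr.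
  rewrite /fscale mulf_eq0 fscalar_eq0 (negPf c0) /= (fspan_uniq_shift U) //=.
  by rewrite rmorphV ?unitfE ?expf_neq0 ?fmorph_eq0 // rmorphXn exprMn invfM.
- exact: (span_uniq_behead fscale0 U).
- by apply: mulfI; rewrite fscalar_eq0.
- by move=> v; apply: fspanZ.
Qed.

(* The recursion is 1/(ab) = (1/b - 1/a)/(a - b). *)
Lemma partial_fractions s t : (0 < s + t)%N -> exists c c' : nat -> K,
  ((0 < s)%N -> (0 < t)%N -> c 0%N = 0 /\ c' 0%N = 0) /\
  forall a b : C, a != 0 -> b != 0 -> a != b ->
  a ^- s * b ^- t = \sum_(j < s + t) (a - b) ^- j *
     (io (c j) * a ^- (s + t - j) + io (c' j) * b ^- (s + t - j)).
Proof.
move En : (s + t)%N => n; elim: n s t En => // n IH [|s] [|t] // E _.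
- exists (fun _ => 0), (fun j => (j == 0)%:R); split=> // a b _ _ _.
  rewrite add0n in E; rewrite E big_ord_recl big1 => [|i _] /=; last by rewrite !rmorph0; ring.
  by rewrite !expr0 invr1 !mul1r rmorph0 rmorph1 mul0r add0r mul1r addr0.
- exists (fun j => (j == 0)%:R), (fun _ => 0); split=> // a b _ _ _.
  rewrite addn0 in E; rewrite E big_ord_recl big1 => [|i _] /=; last by rewrite !rmorph0; ring.
  by rewrite !expr0 invr1 rmorph0 rmorph1; ring.
case: n IH E => [|n] IH E; first by lia.
have [||c1 [c1' [_ H1]]] := IH s t.+1; [lia | by [] |].
have [||c2 [c2' [_ H2]]] := IH s.+1 t; [lia | by [] |].
(* The factor [(a - b)^-1] shifts [j] by one, so the coefficients at [j = 0] vanish; this later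
   keeps the entry 0 out of the indices. *)
exists (fun j => if j is j'.+1 then c1 j' - c2 j' else 0),
       (fun j => if j is j'.+1 then c1' j' - c2' j' else 0).
split=> // a b a0 b0 ab.
have D0 : a - b != 0 by rewrite subr_eq0.
have -> : a ^- s.+1 * b ^- t.+1 = (a - b)^-1 * (a ^- s * b ^- t.+1 - a ^- s.+1 * b ^- t).
  by rewrite !exprS; field; rewrite a0 b0 D0 !expf_neq0.
rewrite (H1 _ _ a0 b0 ab) (H2 _ _ a0 b0 ab).
rewrite [RHS]big_ord_recl /= !rmorph0 !mul0r addr0 mulr0 add0r -sumrB mulr_sumr.
apply: eq_bigr => j _; rewrite /= !rmorphB /= exprS invfM subSS; ring.
Qed.

Lemma nzsum_subl bs v j : uniq (fspan bs) -> v \in fspan bs ->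
  \sum_(w <- fspan bs | w != v) (v - w) ^- j = nzsum bs j.
Proof.
move=> U vs; rewrite /nzsum -(@fspan_sum_perm _ bs (fun w => v - w) (fun u => u != 0)
  (fun u => u ^- j)) //.
- by apply: eq_bigl => w; rewrite subr_eq0 eq_sym.
- by move=> x y /addrI/oppr_inj.
- by move=> w ws; rewrite fspanD ?fspanN.
Qed.

Lemma nzsum_subr bs v j : uniq (fspan bs) -> v \in fspan bs ->
  \sum_(w <- fspan bs | w != v) (w - v) ^- j = nzsum bs j.
Proof.
move=> U vs; rewrite /nzsum -(@fspan_sum_perm _ bs (fun w => w - v) (fun u => u != 0)
  (fun u => u ^- j)) //.
- by apply: eq_bigl => w; rewrite subr_eq0.
- by move=> x y /addIr.
- by move=> w ws; rewrite fspanD ?fspanN.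
Qed.

(* Two distinct elements of the same level differ by an arbitrary nonzero element of the
   span of the lower basis. *)
Lemma psumM s t : (0 < s)%N -> (0 < t)%N -> exists e : nat -> K, e 0%N = 0 /\
  forall b bs, uniq (fspan (b :: bs)) ->
  psum b bs s * psum b bs t = psum b bs (s + t) +
     \sum_(j < s + t) io (e j) * MS bs [:: j : nat] * psum b bs (s + t - j).
Proof.
move=> s0 t0; have [|c [c' [H0 H]]] := @partial_fractions s t; first by lia.
have [c0 c1] := H0 s0 t0.
(* Both partial fraction terms contribute the same sum over differences, from which [nzsumE]
   extracts [scalar_powersum j]. *)
exists (fun j => (c j + c' j) * scalar_powersum j); split; first by rewrite c0 c1 addr0 mul0r.
move=> b bs U; have Ub : uniq (fspan bs) := span_uniq_behead fscale0 U.
have nz v : v \in fspan bs -> b + v != 0 by apply: fspan_uniq_shift.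
have -> : psum b bs s * psum b bs t =
    \sum_(v <- fspan bs) \sum_(w <- fspan bs) (b + v) ^- s * (b + w) ^- t.
  by rewrite /psum mulr_suml; apply: eq_bigr => v _; rewrite mulr_sumr.
have -> : \sum_(v <- fspan bs) \sum_(w <- fspan bs) (b + v) ^- s * (b + w) ^- t =
  psum b bs (s + t) + \sum_(v <- fspan bs) \sum_(w <- fspan bs | w != v)
    \sum_(j < s + t) (v - w) ^- j *
     (io (c j) * (b + v) ^- (s + t - j) + io (c' j) * (b + w) ^- (s + t - j)).
  rewrite /psum -big_split /=; apply: eq_big_seq => v vs.
  rewrite (bigD1_seq v) //= -invfM -exprD; congr (_ + _).
  rewrite [LHS]big_seq_cond [RHS]big_seq_cond; apply: eq_bigr => w /andP[ws wv].
  rewrite (H _ _ (nz _ vs) (nz _ ws)); last by apply: contraNneq wv => /addrI ->.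
  by apply: eq_bigr => j _; congr (_ ^- _ * _); ring.
congr (_ + _).
under eq_bigr do rewrite exchange_big /=.
rewrite exchange_big /=; apply: eq_bigr => j _.
transitivity (io (c j) * (nzsum bs j * psum b bs (s + t - j)) +
              io (c' j) * (nzsum bs j * psum b bs (s + t - j))); last first.
  by rewrite nzsumE // !rmorphM rmorphD /=; ring.
under eq_bigr do under eq_bigr do rewrite mulrDr.
under eq_bigr do rewrite big_split /=.
rewrite big_split /=; congr (_ + _).
  rewrite [nzsum _ _ * _]mulrC {1}/psum mulr_suml mulr_sumr; apply: eq_big_seq => v vs.
  rewrite -(nzsum_subl j Ub vs) mulr_sumr mulr_sumr; apply: eq_bigr => w _; ring.
rewrite [nzsum _ _ * _]mulrC {1}/psum mulr_suml mulr_sumr.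
rewrite (exchange_big_dep predT) //=; apply: eq_big_seq => v vs.
under eq_bigl do rewrite eq_sym.
rewrite -(nzsum_subr j Ub vs) mulr_sumr mulr_sumr; apply: eq_bigr => w _; ring.
Qed.

Definition comb := seq (K * seq nat).

Definition pos_index (ss : seq nat) : bool := all (fun k => 0 < k)%N ss.

Definition comb_of (w : nat) (P : comb) : bool :=
  all (fun p => pos_index p.2 && (sumn p.2 == w)) P.

Definition MSval (P : comb) bs : C := \sum_(p <- P) io p.1 * MS bs p.2.

Definition comb_scale (a : K) (P : comb) : comb := [seq (a * p.1, p.2) | p <- P].

Definition comb_cons (s : nat) (P : comb) : comb := [seq (p.1, s :: p.2) | p <- P].

Lemma comb_of_cat w P Q : comb_of w (P ++ Q) = comb_of w P && comb_of w Q.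
Proof. exact: all_cat. Qed.

Lemma comb_of_scale w a P : comb_of w (comb_scale a P) = comb_of w P.
Proof. by rewrite /comb_of all_map. Qed.

Lemma comb_of_cons s w P : (0 < s)%N -> comb_of w P -> comb_of (s + w) (comb_cons s P).
Proof.
move=> s0; rewrite /comb_of all_map; apply: sub_all => p /andP[p1 /eqP p2] /=.
by rewrite /= s0 p1 p2 eqxx.
Qed.

Lemma MSval_cat P Q bs : MSval (P ++ Q) bs = MSval P bs + MSval Q bs.
Proof. by rewrite /MSval big_cat. Qed.

Lemma MSval_scale a P bs : MSval (comb_scale a P) bs = io a * MSval P bs.
Proof.
rewrite /MSval big_map mulr_sumr; apply: eq_bigr => p _.
by rewrite /= rmorphM mulrA.
Qed.

Lemma MSval_cons s P b bs :
  MSval (comb_cons s P) (b :: bs) = MSval (comb_cons s P) bs + psum b bs s * MSval P bs.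
Proof.
rewrite /MSval !big_map mulr_sumr -big_split /=; apply: eq_bigr => p _ /=; ring.
Qed.

Lemma MSval_cons_nil s P : MSval (comb_cons s P) [::] = 0.
Proof. by rewrite /MSval big_map big1 // => p _; rewrite /= mulr0. Qed.

(** The combination is fixed before the basis, so one formula serves all levels and survives the
    limit. *)
Definition MS_mulable (s t : seq nat) := exists P, comb_of (sumn s + sumn t) P /\
  forall bs, uniq (fspan bs) -> MS bs s * MS bs t = MSval P bs.

Lemma comb_mulable w (P : comb) t :
  comb_of w P -> (forall s, pos_index s -> sumn s = w -> MS_mulable s t) ->
  exists Q, comb_of (w + sumn t) Q /\
    forall bs, uniq (fspan bs) -> MSval P bs * MS bs t = MSval Q bs.
Proof.
move=> + IH; elim: P => [_|[a s] P IHP] /=.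
  by exists [::]; split=> // bs _; rewrite /MSval !big_nil mul0r.
case/andP=> /andP[ps /eqP ws] /IHP[Q [wQ HQ]].
have [Q1 [wQ1 HQ1]] := IH _ ps ws.
exists (comb_scale a Q1 ++ Q); split; first by rewrite comb_of_cat comb_of_scale wQ -ws wQ1.
move=> bs U; rewrite MSval_cat MSval_scale -HQ // -HQ1 // /MSval big_cons /=; ring.
Qed.

(* The tails that appear have smaller total weight, whence the induction. *)
Lemma MSM s t : pos_index s -> pos_index t -> MS_mulable s t.
Proof.
move: {2}(sumn s + sumn t).+1 (ltnSn (sumn s + sumn t)) => n.
elim: n s t => // n IH [|s ss] t lt ps pt.
  exists [:: (1, t)]; split; first by rewrite /comb_of /= pt eqxx.
  by move=> bs _; rewrite MS_nil /MSval big_seq1 rmorph1.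
case: t lt pt => [|t ts] lt pt.
  exists [:: (1, s :: ss)]; split; first by move: ps; rewrite /comb_of /= addn0 eqxx !andbT.
  by move=> bs _; rewrite MS_nil /MSval big_seq1 rmorph1 mulrC.
move: (ps) (pt) => /= /andP[s0 pss] /andP[t0 pts]; move: lt; rewrite /= => lt.
have [|P1 [w1 H1]] := IH ss (t :: ts) _ pss pt; first by rewrite /=; lia.
have [|P2 [w2 H2]] := IH (s :: ss) ts _ ps pts; first by rewrite /=; lia.
have [|P3 [w3 H3]] := IH ss ts _ pss pts; first by rewrite /=; lia.
have [e [e0 He]] := psumM s0 t0.
(* [Z] collects the correction terms of [psumM] with [j < m]: entry [s + t - j] is put in front of a
   combination for the product of [[:: j]], [ss] and [ts], available by induction since [j < s + t].
   The value 0 at the empty basis starts the final induction. *)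
have Zex m : (m <= s + t)%N -> exists Z, [/\ comb_of (s + t + (sumn ss + sumn ts)) Z,
    MSval Z [::] = 0 & forall b bs, uniq (fspan (b :: bs)) ->
    MSval Z (b :: bs) = MSval Z bs +
      (\sum_(j < m) io (e j) * MS bs [:: j : nat] * psum b bs (s + t - j))
      * (MS bs ss * MS bs ts)].
  elim: m => [_|j IHj jst].
    by exists [::]; split=> // [|b bs _]; rewrite /MSval !big_nil // big_ord0 mul0r addr0.
  have [Z [wZ Z0 HZ]] := IHj (ltnW jst).
  have [j0|j0] := posnP j.
    by exists Z; split=> // b bs U; rewrite HZ // big_ord_recr /= j0 e0 rmorph0 !mul0r addr0.
  have [||P4 [w4 H4]] := IH [:: j] ss _ _ pss; [by rewrite /=; lia| by rewrite /pos_index /= j0 |].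
  have [|Q [wQ HQ]] := @comb_mulable _ P4 ts w4.
    by move=> u pu wu; apply: IH => //; rewrite wu /=; lia.
  exists (comb_scale (e j) (comb_cons (s + t - j) Q) ++ Z); split.
  - rewrite comb_of_cat comb_of_scale wZ andbT.
    rewrite (_ : (_ + _ = s + t - j + (sumn [:: j] + sumn ss + sumn ts))%N).
      by rewrite comb_of_cons // subn_gt0.
    by rewrite /=; lia.
  - by rewrite MSval_cat MSval_scale MSval_cons_nil Z0 mulr0 addr0.
  - move=> b bs U; have Ub : uniq (fspan bs) := span_uniq_behead fscale0 U.
    rewrite !MSval_cat !MSval_scale MSval_cons HZ // big_ord_recr /= -HQ // -H4 //; ring.
have [Z [wZ Z0 HZ]] := Zex _ (leqnn _).
exists (comb_cons s P1 ++ (comb_cons t P2 ++ (comb_cons (s + t) P3 ++ Z))); split.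
  rewrite !comb_of_cat; apply/and4P; split.
  - by rewrite /= -addnA comb_of_cons.
  - rewrite (_ : (_ + _ = t + (sumn (s :: ss) + sumn ts))%N) ?comb_of_cons //=; lia.
  - rewrite (_ : (_ + _ = s + t + (sumn ss + sumn ts))%N) ?comb_of_cons ?addn_gt0 ?s0 //=; lia.
  - rewrite (_ : (_ + _ = s + t + (sumn ss + sumn ts))%N) //=; lia.
(* Both sides vanish on the empty basis and change by the same amount when a level is added. *)
elim=> [_|b bs IHb U]; first by rewrite !MSval_cat !MSval_cons_nil Z0 mul0r !addr0.
have Ub : uniq (fspan bs) := span_uniq_behead fscale0 U.
rewrite !MSval_cat !MSval_cons HZ // -H1 // -H2 // -H3 //.
rewrite !MSval_cat in IHb.
have -> : MS (b :: bs) (s :: ss) = MS bs (s :: ss) + psum b bs s * MS bs ss by [].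
have -> : MS (b :: bs) (t :: ts) = MS bs (t :: ts) + psum b bs t * MS bs ts by [].
have -> : (MS bs (s :: ss) + psum b bs s * MS bs ss) * (MS bs (t :: ts) + psum b bs t * MS bs ts)
  = MS bs (s :: ss) * MS bs (t :: ts) + psum b bs s * (MS bs ss * MS bs (t :: ts)) +
    psum b bs t * (MS bs (s :: ss) * MS bs ts) +
    (psum b bs s * psum b bs t) * (MS bs ss * MS bs ts) by ring.
rewrite IHb // He //; ring.
Qed.
End FiniteLevel.

(** * Exponential polynomials of finite lattices *)

Lemma pchar_card_pnat (F : finFieldType) (R : nzRingType) (j : {rmorphism F -> R}) :
  [pchar R].-nat #|F|.
Proof.
have [p p_pr pF] := finPcharP F.
have pR : p \in [pchar R] by apply: rmorph_pchar pF.
rewrite (eq_pnat _ (pcharf_eq pR)) -cardsT.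
by have /and3P[] := fin_ring_pchar_abelem pF.
Qed.

Lemma exprD_card (F : finFieldType) (R : comNzRingType) (j : {rmorphism F -> R}) i (x y : R) :
  (x + y) ^+ (#|F| ^ i) = x ^+ (#|F| ^ i) + y ^+ (#|F| ^ i).
Proof. by apply: exprDn_pchar; rewrite pnatX (pchar_card_pnat j). Qed.

Lemma expf_card_exp (F : finFieldType) i (x : F) : x ^+ (#|F| ^ i) = x.
Proof. by elim: i => [|i IH]; rewrite ?expr1 // expnS exprM expf_card. Qed.

Lemma card_field_gt1 (F : finFieldType) : (1 < #|F|)%N.
Proof. exact: finNzRing_gt1. Qed.

Lemma prod_nonzero_scalars (F : finFieldType) (A : comNzRingType) (j : {rmorphism F -> A}) (T : A) :
  \prod_(c : F | c != 0) (1 + j c^-1 * T) = 1 - T ^+ #|F|.-1.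
Proof.
have q0 : (#|F| = #|F|.-1.+1)%N by rewrite prednK // (ltn_trans _ (card_field_gt1 F)).
have E1 : \prod_(c : F | c != 0) ('X - c%:P) = 'X^(#|F|.-1) - 1 :> {poly F}.
  apply: (@mulfI _ 'X); first by rewrite polyX_eq0.
  rewrite mulrBr mulr1 -exprS -q0 finField_genPoly.
  by rewrite [RHS](bigD1 0) //= subr0.
have E2 : \prod_(c : F | c != 0) (1 + c^-1 *: 'X) = 1 - 'X^(#|F|.-1) :> {poly F}.
  rewrite (reindex_inj oppr_inj) /=.
  pose m : F := \prod_(c : F | c != 0) (- c)^-1.
  have E3 : \prod_(c : F | - c != 0) (1 + (- c)^-1 *: 'X) = m *: ('X^(#|F|.-1) - 1).
    rewrite -E1 /m -mul_polyC rmorph_prod -big_split /=.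
    rewrite (eq_bigl (fun c => c != 0)) => [|c]; last by rewrite oppr_eq0.
    apply: eq_bigr => c c0; rewrite mul_polyC scalerBr addrC; congr (_ + _).
    by rewrite -mul_polyC -polyCM -polyCN invrN mulNr mulVf // opprK.
  (* Evaluation at 0 gives [m = -1], which is Wilson's theorem for [F]. *)
  rewrite E3; have := congr1 (fun p : {poly F} => p.[0]) E3.
  rewrite horner_prod big1 => [|c _]; last by rewrite !hornerE.
  rewrite !hornerE expr0n -subn1 subn_eq0 leqNgt card_field_gt1 /= sub0r mulrN1 => m1.
  by rewrite -[m]opprK -m1 scaleN1r opprB.
have := congr1 (fun p : {poly F} => (map_poly j p).[T]) E2.
rewrite rmorph_prod horner_prod rmorphB rmorph1 /= map_polyXn !hornerE => <-.
by apply: eq_bigr => c _; rewrite rmorphD rmorph1 /= map_polyZ map_polyX !hornerE.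
Qed.

Section AdditivePolynomials.
Variables (F : finFieldType) (K C : fieldType).
Variables (jK : {rmorphism F -> K}) (io : {rmorphism K -> C}).
Local Notation fscale := (fscale jK io).
Local Notation fspan := (span fscale).
Local Notation q := #|F|.

Definition jC : {rmorphism F -> C} := io \o jK.

Definition jCpoly : {rmorphism F -> {poly C}} := polyC \o jC.

Lemma q_gt0 : (0 < q)%N.
Proof. exact: ltn_trans (card_field_gt1 F). Qed.

Definition qpoly n (a : nat -> C) : {poly C} := \sum_(i < n) a i *: 'X^(q ^ i).

Lemma qpoly_comp n a f : qpoly n a \Po f = \sum_(i < n) a i *: f ^+ (q ^ i).
Proof.
rewrite /qpoly linear_sum /=; apply: eq_bigr => i _.
by rewrite comp_polyZ comp_Xn_poly.
Qed.

Lemma qpoly_compD n a f g : qpoly n a \Po (f + g) = (qpoly n a \Po f) + (qpoly n a \Po g).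
Proof.
rewrite !qpoly_comp -big_split /=; apply: eq_bigr => i _.
by rewrite (exprD_card jCpoly) scalerDr.
Qed.

Lemma hornerq n a x : (qpoly n a).[x] = \sum_(i < n) a i * x ^+ (q ^ i).
Proof. by rewrite horner_sum; apply: eq_bigr => i _; rewrite !hornerE. Qed.

Lemma hornerqD n a x y : (qpoly n a).[x + y] = (qpoly n a).[x] + (qpoly n a).[y].
Proof.
rewrite !hornerq -big_split /=; apply: eq_bigr => i _.
by rewrite (exprD_card jC) mulrDr.
Qed.

Lemma hornerq_scale n a c x : (qpoly n a).[fscale c x] = fscale c (qpoly n a).[x].
Proof.
rewrite !hornerq /fscale mulr_sumr; apply: eq_bigr => i _.
by rewrite exprMn -!rmorphXn expf_card_exp mulrCA.
Qed.

Lemma coef_qpoly n a i : (qpoly n a)`_(q ^ i) = if (i < n)%N then a i else 0.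
Proof.
rewrite /qpoly coef_sum; case: ifP => [lt|/negbT ge].
  rewrite (bigD1 (Ordinal lt)) //= big1 => [|j ji]; first by rewrite addr0 coefZ coefXn eqxx mulr1.
  rewrite coefZ coefXn eqn_exp2l ?card_field_gt1 // eq_sym.
  by move: ji; rewrite -val_eqE /= => /negPf ->; rewrite mulr0.
rewrite big1 // => j _; rewrite coefZ coefXn eqn_exp2l ?card_field_gt1 //.
by case: eqP => [E|]; [move: ge; rewrite E ltn_ord | rewrite mulr0].
Qed.

(** For a free basis this is the [F]-linear polynomial with simple zeros exactly on the span and
    linear coefficient 1, the finite analogue of the exponential. The recursion corrects [e] by
    [e(b)^(1-q) e^q]: since [e(c b + v) = c e(b)] and [c^q = c], the difference also vanishes at
    every [c b + v]. *)
Fixpoint epol (bs : seq C) : {poly C} :=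
  if bs is b :: bs' then epol bs' - ((epol bs').[b] ^- q.-1) *: epol bs' ^+ q else 'X.

Definition ecoef bs i := (epol bs)`_(q ^ i).

Lemma epolE bs : epol bs = qpoly (size bs).+1 (ecoef bs).
Proof.
suff [a E] : exists a, epol bs = qpoly (size bs).+1 a.
  rewrite E; apply: eq_bigr => i _; congr (_ *: _).
  by rewrite /ecoef E coef_qpoly ltn_ord.
elim: bs => [|b bs [a IH]] /=.
  by exists (fun _ => 1); rewrite /qpoly big_ord1 scale1r expr1.
set B := _ ^- _.
exists (fun i => (if (i < (size bs).+1)%N then a i else 0) - (if i is i'.+1 then B * a i' ^+ q else 0)).
rewrite /qpoly; under [RHS]eq_bigr do rewrite scalerBl; rewrite sumrB.
rewrite [X in _ = X - _]big_ord_recr /= ltnn scale0r addr0.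
rewrite [X in _ = _ - X]big_ord_recl /= scale0r add0r IH; congr (_ - _).
  by apply: eq_bigr => i _; rewrite ltn_ord.
rewrite /qpoly; elim/big_rec2: _ => [|i x y _ E].
  by rewrite expr0n gtn_eqF ?q_gt0 // scaler0.
have /= := exprD_card jCpoly 1; rewrite expn1 => ->.
rewrite scalerDr E; congr (_ + _).
by rewrite exprZn -exprM -expnSr scalerA.
Qed.

Lemma epolD bs x y : (epol bs).[x + y] = (epol bs).[x] + (epol bs).[y].
Proof. by rewrite epolE hornerqD. Qed.

Lemma epolZ bs c x : (epol bs).[fscale c x] = fscale c (epol bs).[x].
Proof. by rewrite epolE hornerq_scale. Qed.

Lemma epol0 bs : (epol bs).[0] = 0.
Proof. by apply: (@addrI _ (epol bs).[0]); rewrite -epolD !addr0. Qed.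

Lemma deriv_epol bs : (epol bs)^`() = 1.
Proof.
elim: bs => [|b bs IH] /=; first exact: derivX.
rewrite derivB derivZ deriv_exp IH mul1r.
have : (q%:R == 0 :> {poly C}).
  have [p _ pF] := finPcharP F.
  have pR : p \in [pchar {poly C}] by apply: rmorph_pchar jCpoly _ pF.
  have := pchar_card_pnat jCpoly; rewrite (eq_pnat _ (pcharf_eq pR)).
  case/p_natP => -[|k] E; first by move: (card_field_gt1 F); rewrite E.
  by rewrite E expnS natrM (pcharf0 pR) mul0r.
by move/eqP => q0; rewrite -mulr_natr q0 mulr0 scaler0 subr0.
Qed.

Definition epol_factored bs :=
  epol bs = 'X * \prod_(w <- fspan bs | w != 0) (1 + w^-1 *: 'X).

Definition nzprod bs : C := \prod_(w <- fspan bs | w != 0) w^-1.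

Lemma nzprod_neq0 bs : nzprod bs != 0.
Proof. by rewrite prodf_seq_neq0; apply/allP => w _; apply/implyP; rewrite invr_eq0. Qed.

Lemma epol_factored_monic bs : uniq (fspan bs) -> epol_factored bs ->
  epol bs = nzprod bs *: \prod_(v <- fspan bs) ('X + v%:P).
Proof.
move=> U ->; rewrite (bigD1_seq 0) ?fspan0 //= polyC0 addr0 scalerAr; congr (_ * _).
rewrite /nzprod -mul_polyC rmorph_prod -big_split /=; apply: eq_bigr => w w0.
by rewrite mulrDr mul_polyC -polyCM mulVf // addrC.
Qed.

Lemma epol_factored_horner bs x : uniq (fspan bs) -> epol_factored bs ->
  (epol bs).[x] = nzprod bs * \prod_(v <- fspan bs) (x + v).
Proof.
move=> U /(epol_factored_monic U) ->; rewrite hornerZ horner_prod; congr (_ * _).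
by apply: eq_bigr => v _; rewrite !hornerE.
Qed.

(** Additivity gives [e(X + x) = e(X) + e(x)]; factoring the left side and dividing by [e(x)] yields
    the claim. The factorisation is a hypothesis because the lemma serves inside the induction that
    proves it. *)
Lemma epol_factored_shift bs x : uniq (fspan bs) -> epol_factored bs ->
  (forall v, v \in fspan bs -> x + v != 0) ->
  \prod_(v <- fspan bs) (1 + (x + v)^-1 *: 'X) = 1 + (epol bs).[x]^-1 *: epol bs.
Proof.
move=> U ef nz; set e := epol bs; have k0 := nzprod_neq0 bs.
have eshift : e \Po ('X + x%:P) = e + e.[x]%:P.
  by rewrite /e epolE qpoly_compD comp_polyXr comp_polyCr.
have ex : e.[x] = nzprod bs * \prod_(v <- fspan bs) (x + v) by apply: epol_factored_horner.
have ex0 : e.[x] != 0.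
  by rewrite ex mulf_neq0 // prodf_seq_neq0; apply/allP => v vs; apply: nz.
have E2 : (nzprod bs)^-1 *: (e + e.[x]%:P) = \prod_(v <- fspan bs) ('X + (x + v)%:P).
  rewrite -eshift /e (epol_factored_monic U ef) comp_polyZ scalerA mulVf // scale1r.
  rewrite rmorph_prod /=.
  by apply: eq_bigr => v _; rewrite rmorphD /= comp_polyX comp_polyC -addrA polyCD.
rewrite (eq_big_seq (fun v => (x + v)^-1 *: ('X + (x + v)%:P))); last first.
  by move=> v vs; rewrite scalerDr addrC -[X in _ = _ + X]mul_polyC -polyCM mulVf ?nz.
have -> : \prod_(v <- fspan bs) ((x + v)^-1 *: ('X + (x + v)%:P)) =
    (\prod_(v <- fspan bs) (x + v))^-1 *: \prod_(v <- fspan bs) ('X + (x + v)%:P).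
  rewrite -prodfV -mul_polyC rmorph_prod -big_split /=.
  by apply: eq_bigr => v _; rewrite mul_polyC.
rewrite -E2 scalerA -invfM [_ * nzprod _]mulrC -ex scalerDr addrC -[X in X + _]mul_polyC.
by rewrite -polyCM mulVf.
Qed.

(** Each coset [c b + span bs] contributes [1 + e(X) / (c e(b))], and the product of these over
    nonzero [c] is [1 - (e(X) / e(b))^(q-1)], the factor in the recursion of [epol]. *)
Lemma epol_prod bs : uniq (fspan bs) -> epol_factored bs.
Proof.
rewrite /epol_factored; elim: bs => [|b bs IH] U; first by rewrite big_cons big_nil eqxx /= mulr1.
have Ub : uniq (fspan bs) := span_uniq_behead (fscale0 jK io) U.
rewrite fspan_cons_prod mulrA -IH // [LHS]/=; set e := epol bs; set B := e.[b].
have step c : c != 0 -> \prod_(v <- fspan bs | fscale c b + v != 0)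
     (1 + (fscale c b + v)^-1 *: 'X) = 1 + jCpoly c^-1 * (B^-1 *: e).
  move=> c0; have nz v : v \in fspan bs -> fscale c b + v != 0 by apply: fspan_uniq_notin.
  rewrite big_seq_cond (eq_bigl (fun v => v \in fspan bs)) => [|v]; last first.
    by case: (boolP (v \in _)) => // /nz ->.
  rewrite -big_seq epol_factored_shift //; last exact: IH.
  rewrite epolZ -/e -/B -mul_polyC -[in RHS]mul_polyC mulrA -polyCM.
  by rewrite /fscale invfM -!fmorphV.
rewrite (eq_bigr _ step) prod_nonzero_scalars mulrBr mulr1; congr (_ - _).
by rewrite exprZn -scalerAr -exprS prednK ?q_gt0 // exprVn.
Qed.

(** Evaluation of [epol vs] realises the quotient by the span of [vs]. This composition is the
    source of the functional equation of the exponential. *)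
Lemma epol_cat us vs :
  epol (us ++ vs) = epol [seq (epol vs).[u] | u <- us] \Po epol vs.
Proof.
elim: us => [|b us IH] /=; first by rewrite comp_polyX.
by rewrite IH horner_comp comp_polyB comp_polyZ rmorphXn.
Qed.

Lemma epol_scale a bs : a != 0 -> epol [seq a * b | b <- bs] \Po (a *: 'X) = a *: epol bs.
Proof.
move=> a0; elim: bs => [|b bs IH] /=; first by rewrite comp_polyX.
rewrite comp_polyB comp_polyZ rmorphXn /= IH scalerBr; congr (_ - _).
have -> : (epol [seq a * b0 | b0 <- bs]).[a * b] = a * (epol bs).[b].
  by rewrite -hornerZ -IH horner_comp !hornerE.
rewrite exprZn !scalerA; congr (_ *: _).
have -> : a ^+ q = a * a ^+ q.-1 by rewrite -exprS prednK ?q_gt0.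
rewrite exprMn invfM; set U := a ^+ _.
by rewrite mulrC -mulrA mulVKf ?expf_neq0.
Qed.

Lemma epol_perm bs bs' : uniq (fspan bs) -> perm_eq (fspan bs) (fspan bs') ->
  epol bs = epol bs'.
Proof.
move=> U p; rewrite (epol_prod U) (@epol_prod bs') -?(perm_uniq p) //.
by congr (_ * _); apply: perm_big.
Qed.

Lemma epol_neq0 bs x : uniq (fspan bs) -> ((epol bs).[x] == 0) = (x \in fspan bs).
Proof.
move=> U; rewrite (epol_factored_horner _ U (epol_prod U)) mulf_eq0 (negPf (nzprod_neq0 _)) /=.
rewrite prodf_seq_eq0; apply/hasP/idP => [[v vs /=]|xs].
  by rewrite addr_eq0 => /eqP ->; apply: fspanN.
by exists (- x); rewrite ?fspanN //= subrr.
Qed.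

Lemma size_fspan bs : size (fspan bs) = (q ^ size bs)%N.
Proof. by elim: bs => //= b bs IH; rewrite size_allpairs IH -cardE expnS. Qed.

Lemma ecoef_lead bs : uniq (fspan bs) -> ecoef bs (size bs) = nzprod bs.
Proof.
move=> U; rewrite /ecoef (epol_factored_monic U (epol_prod U)) coefZ.
have -> : \prod_(v <- fspan bs) ('X + v%:P) = \prod_(v <- map -%R (fspan bs)) ('X - v%:P).
  by rewrite big_map; apply: eq_bigr => v _; rewrite polyCN opprK.
set P := \prod_(_ <- _) _; have := monicP (monic_prod_XsubC (map -%R (fspan bs)) predT id).
by rewrite /lead_coef -/P size_prod_XsubC size_map size_fspan /= => ->; rewrite mulr1.
Qed.

Lemma fspan_catl us vs x : x \in fspan us -> x \in fspan (us ++ vs).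
Proof.
elim: us x => [|b us IH] x /=; first by rewrite inE => /eqP ->; apply: fspan0.
by move=> /fspan_consP[c [w [/IH ws ->]]]; apply/fspan_consP; exists c, w.
Qed.

Lemma fspan_catr us vs x : x \in fspan vs -> x \in fspan (us ++ vs).
Proof.
move=> xs; elim: us => //= b us IH; apply/fspan_consP; exists 0, x.
by rewrite fscale0 add0r.
Qed.

Lemma fspan_cat_disjoint us vs x : uniq (fspan (us ++ vs)) ->
  x \in fspan us -> x \in fspan vs -> x = 0.
Proof.
elim: us x => [|b us IH] x /= U; first by rewrite inE => /eqP.
have Ub : uniq (fspan (us ++ vs)) := span_uniq_behead (fscale0 jK io) U.
move=> /fspan_consP[c [w [ws E]]] xs; have [c0|c0] := eqVneq c 0.
  by move: E; rewrite c0 fscale0 add0r => E; apply: IH => //; rewrite E.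
have : fscale c b + (w - x) != 0.
  by apply: (fspan_uniq_notin U c0); rewrite fspanD ?fspanN ?(fspan_catl _ ws) ?(fspan_catr _ xs).
by rewrite addrA -E subrr eqxx.
Qed.

Lemma fspan_cons_uniq b bs : uniq (fspan bs) -> b \notin fspan bs -> uniq (fspan (b :: bs)).
Proof.
move=> U bn; apply: allpairs_uniq => //; first exact: enum_uniq.
move=> [c v] [d w] /allpairsP[[c1 v1] /= [_ vs [-> ->]]] /allpairsP[[d1 w1] /= [_ ws [-> ->]]] E.
have [cd|cd] := eqVneq c1 d1; first by move: E; rewrite cd => /addrI ->.
case/negP: bn; have cd0 : c1 - d1 != 0 by rewrite subr_eq0.
have : fscale (c1 - d1) b \in fspan bs.
  have -> : fscale (c1 - d1) b = w1 - v1.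
    by rewrite /(fscale _ _) !rmorphB /= mulrBl; apply/eqP;
      rewrite subr_eq addrAC eq_sym subr_eq addrC E addrC.
  by rewrite fspanD ?fspanN.
move/(fspanZ (c1 - d1)^-1); rewrite /(fscale _ _) mulrA -!rmorphM mulVf //.
by rewrite !rmorph1 mul1r.
Qed.

Lemma fspan_cat_uniql us vs : uniq (fspan (us ++ vs)) -> uniq (fspan us).
Proof.
elim: us => //= b us IH U.
have Ub : uniq (fspan (us ++ vs)) := span_uniq_behead (fscale0 jK io) U.
apply: fspan_cons_uniq; first exact: IH.
apply/negP => bs; have := @fspan_uniq_notin _ _ _ _ _ _ _ 1 (- b) U (oner_neq0 _).
by rewrite fspanN ?(fspan_catl _ bs) // fscale1 subrr eqxx => /(_ isT).
Qed.

Lemma fspan_cat_uniqr us vs : uniq (fspan (us ++ vs)) -> uniq (fspan vs).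
Proof. by elim: us => //= b us IH /(span_uniq_behead (fscale0 jK io))/IH. Qed.

Lemma fspan_map_epol us vs :
  fspan [seq (epol vs).[u] | u <- us] = [seq (epol vs).[u] | u <- fspan us].
Proof.
by apply: span_map; [exact: epol0 | exact: epolD | exact: epolZ].
Qed.

Lemma fspan_map_epol_uniq us vs : uniq (fspan (us ++ vs)) ->
  uniq (fspan [seq (epol vs).[u] | u <- us]).
Proof.
move=> U; rewrite fspan_map_epol map_inj_in_uniq ?(fspan_cat_uniql U) //.
move=> x y xs ys E; apply/eqP; rewrite -subr_eq0; apply/eqP.
apply: (fspan_cat_disjoint U); first by rewrite fspanD ?fspanN.
rewrite -epol_neq0 ?(fspan_cat_uniqr U) // epolD E -epolD subrr epol0 //.
Qed.

End AdditivePolynomials.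

(** * Newton's identities *)

Section Newton.
Variable C : fieldType.

(** The logarithmic derivative of [P] is the sum of the [x^-1 / (1 + x^-1 X)], whose geometric
    expansions add up to signed power sums. [D] is that series truncated below [X^(n+1)], and [R]
    absorbs the rest. *)
Lemma newton (xs : seq C) n : all (fun x => x != 0) xs ->
  let P : {poly C} := \prod_(x <- xs) (1 + x^-1 *: 'X) in
  P`_n.+1 *+ n.+1 = \sum_(k < n.+1) (-1) ^+ k * (\sum_(x <- xs) x ^- k.+1) * P`_(n - k).
Proof.
move=> nz P.
pose D (ys : seq C) : {poly C} := \poly_(k < n.+1) ((-1) ^+ k * \sum_(x <- ys) x ^- k.+1).
have [R E] : exists R : {poly C}, deriv P = P * D xs + R * 'X^(n.+1).
  rewrite {}/P; elim: xs nz => [_|x xs IH /= /andP[x0 /IH[R E]]].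
    exists 0; rewrite big_nil derivC mul1r mul0r addr0; apply/polyP => i.
    by rewrite coef0 coef_poly big_nil mulr0 if_same.
  rewrite big_cons; set P := \prod_(_ <- _) _ in E *.
  pose Dx : {poly C} := \poly_(k < n.+1) ((-1) ^+ k * x ^- k.+1).
  have -> : D (x :: xs) = Dx + D xs.
    by apply/polyP => i; rewrite coefD !coef_poly big_cons mulrDr; case: ifP; rewrite ?addr0.
  have dE : (1 + x^-1 *: 'X)^`() = (x^-1)%:P :> {poly C}.
    by rewrite derivD derivZ derivX derivC add0r -alg_polyC.
  have [S ES] : exists S : {poly C}, (x^-1)%:P = (1 + x^-1 *: 'X) * Dx + S * 'X^(n.+1) :> {poly C}.
    exists (- ((-1) ^+ n * x ^- n.+2))%:P.
    apply/polyP => i; rewrite coefC mulrDl mul1r !coefD -scalerAl coefZ coefXM coefCM coefXn !coef_poly.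
    case: i => [|i] /=; first by rewrite expr0 mul1r expr1 mulr0 addr0 mulr0 addr0.
    rewrite !ltnS eqSS; case: (ltngtP i n) => [lt|gt|->]; rewrite ?mulr0 ?addr0 ?mulr1.
    - by rewrite exprS [in x ^- i.+2]exprS invfM; ring.
    - by [].
    - by rewrite add0r [in x ^- n.+2]exprS invfM; ring.
  exists (S * P + (1 + x^-1 *: 'X) * R).
  by rewrite derivM dE -/P E ES; ring.
have := congr1 (fun p : {poly C} => p`_n) E.
rewrite coef_deriv coefD coefMXn ltnSn addr0 coefMr => ->.
apply: eq_bigr => k _; rewrite coef_poly ltn_ord mulrC //.
Qed.

End Newton.

(** * Coefficients of exponential polynomials, Goss recursion, functional equation *)

Section Combinations.
Variables (F : finFieldType) (K C : fieldType).
Variables (jK : {rmorphism F -> K}) (io : {rmorphism K -> C}).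
Local Notation fscale := (fscale jK io).
Local Notation fspan := (span fscale).
Local Notation q := #|F|.
Local Notation MS := (MS jK io).
Local Notation MSval := (MSval jK io).
Local Notation epol := (@epol F C).
Local Notation ecoef := (@ecoef F C).

Definition MScomb w (f : seq C -> C) := exists P : comb K, comb_of w P /\
  forall bs, uniq (fspan bs) -> f bs = MSval P bs.

Lemma MScomb_ext w f g : (forall bs, uniq (fspan bs) -> f bs = g bs) ->
  MScomb w f -> MScomb w g.
Proof. by move=> fg [P [wP H]]; exists P; split=> // bs U; rewrite -fg ?H. Qed.

Lemma MScomb0 w : MScomb w (fun _ => 0).
Proof. by exists [::]; split=> // bs _; rewrite /(MSval _ _) big_nil. Qed.

Lemma MScomb1 : MScomb 0 (fun _ => 1).
Proof.
by exists [:: (1, [::])]; split=> // bs _; rewrite /(MSval _ _) big_seq1 rmorph1 MS_nil mulr1.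
Qed.

Lemma MScombD w f g : MScomb w f -> MScomb w g -> MScomb w (fun bs => f bs + g bs).
Proof.
move=> [P [wP HP]] [Q [wQ HQ]]; exists (P ++ Q); split; first by rewrite comb_of_cat wP.
by move=> bs U; rewrite MSval_cat HP ?HQ.
Qed.

Lemma MScombZ w a f : MScomb w f -> MScomb w (fun bs => io a * f bs).
Proof.
move=> [P [wP HP]]; exists (comb_scale a P); split; first by rewrite comb_of_scale.
by move=> bs U; rewrite MSval_scale HP.
Qed.

Lemma MScomb_MS s : pos_index s -> MScomb (sumn s) (MS^~ s).
Proof.
move=> ps; exists [:: (1, s)]; split; first by rewrite /comb_of /= ps eqxx.
by move=> bs _; rewrite /(MSval _ _) big_seq1 rmorph1 mul1r.
Qed.

Lemma MScombM w v f g : MScomb w f -> MScomb v g -> MScomb (w + v) (fun bs => f bs * g bs).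
Proof.
move=> [P [wP HP]] [Q [wQ HQ]].
apply: (@MScomb_ext _ (fun bs => MSval P bs * MSval Q bs)).
  by move=> bs U; rewrite HP ?HQ.
elim: Q wQ {HQ} => [_|[a t] Q IH] /=.
  apply: MScomb_ext (MScomb0 _) => bs _; by rewrite [X in _ * X]/(MSval _ _) big_nil mulr0.
case/andP=> /andP[pt /eqP vt] /IH HQ.
have [|Q1 [wQ1 HQ1]] := @comb_mulable _ _ _ jK io _ _ t wP.
  by move=> s ps _; apply: MSM.
apply: (@MScomb_ext _ (fun bs => io a * (MSval P bs * MS bs t) + MSval P bs * MSval Q bs)).
  by move=> bs U; rewrite /(MSval (_ :: _) _) big_cons -/(MSval Q bs) /=; ring.
apply: MScombD HQ; apply: MScombZ; rewrite -vt.
by exists Q1.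
Qed.

Lemma MScomb_sum w n (f : nat -> seq C -> C) : (forall i, (i < n)%N -> MScomb w (f i)) ->
  MScomb w (fun bs => \sum_(i < n) f i bs).
Proof.
elim: n => [|n IH] H.
  by apply: MScomb_ext (MScomb0 w) => bs _; rewrite big_ord0.
apply: (@MScomb_ext _ (fun bs => (\sum_(i < n) f i bs) + f n bs)).
  by move=> bs _; rewrite big_ord_recr.
by apply: MScombD; [apply: IH => i lt; apply: H; apply: ltnW | apply: H].
Qed.

Lemma MScomb_nzsum j : (0 < j)%N -> MScomb j (fun bs => nzsum jK io bs j).
Proof.
move=> j0; apply: (@MScomb_ext _ (fun bs => io (scalar_powersum jK j) * MS bs [:: j])).
  by move=> bs U; rewrite nzsumE.
by apply: MScombZ; have := @MScomb_MS [:: j]; rewrite /= addn0; apply; rewrite /pos_index /= j0.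
Qed.

Lemma coef0_epol bs : uniq (fspan bs) -> (epol bs)`_0 = 0.
Proof. by move=> U; rewrite -horner_coef0 (epol0 jK io). Qed.

Lemma coef1_epol bs : (epol bs)`_1 = 1.
Proof.
have := congr1 (fun p : {poly C} => p`_0) (deriv_epol jK io bs).
by rewrite coef_deriv coef1.
Qed.

(* Since the derivative of [epol bs] is 1, Newton's identities never divide by the index. *)
Lemma coefS_epol bs n : uniq (fspan bs) -> (epol bs)`_n.+2 =
  \sum_(k < n.+1) (-1) ^+ k.+1 * nzsum jK io bs k.+1 * (epol bs)`_(n - k).+1.
Proof.
move=> U; pose Q := \prod_(x <- [seq w <- fspan bs | w != 0]) (1 + x^-1 *: 'X).
have E : epol bs = 'X * Q by rewrite (epol_prod U) /Q big_filter.
have cE i : (epol bs)`_i.+1 = Q`_i by rewrite E coefXM.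
have nz : all (fun x => x != 0) [seq w <- fspan bs | w != 0] by apply: filter_all.
have := newton n nz; rewrite /= -/Q => N.
have := congr1 (fun p : {poly C} => p`_n.+1) (deriv_epol jK io bs).
rewrite coef_deriv coef1 /= cE mulrS => /eqP; rewrite addr_eq0 => /eqP ->.
rewrite N -sumrN; apply: eq_bigr => k _.
by rewrite /nzsum big_filter cE exprS; ring.
Qed.

(** The weight is [n] and not [n + 1] because the linear coefficient is normalised to 1: scaling the
    basis by [a] multiplies this coefficient by [a^-n]. *)
Lemma MScomb_coef_epol n : MScomb n (fun bs => (epol bs)`_n.+1).
Proof.
elim/ltn_ind: n => -[|n] IH.
  by apply: MScomb_ext MScomb1 => bs _; rewrite coef1_epol.
apply: (@MScomb_ext _ (fun bs => \sum_(k < n.+1)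
  (io ((-1) ^+ k.+1) * (nzsum jK io bs k.+1 * (epol bs)`_(n - k).+1)))).
  move=> bs U; rewrite coefS_epol //; apply: eq_bigr => k _.
  by rewrite rmorphXn rmorphN1 mulrA.
apply: (@MScomb_sum _ _ (fun k bs => io ((-1) ^+ k.+1) * (nzsum jK io bs k.+1 * (epol bs)`_(n - k).+1))).
move=> k lt; apply: MScombZ.
rewrite (_ : n.+1 = k.+1 + (n - k))%N; last by lia.
by apply: MScombM; [apply: MScomb_nzsum | apply: IH; lia].
Qed.

Lemma MScomb_ecoef i : MScomb (q ^ i - 1)%N (fun bs => ecoef bs i).
Proof.
have := MScomb_coef_epol (q ^ i - 1)%N; rewrite subn1 prednK // expn_gt0 q_gt0 //.
Qed.

Definition shiftsum bs s (x : C) : C := \sum_(v <- fspan bs) (x + v) ^- s.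

(** Newton's identities for the elements [x + v]: their product polynomial is [1 + e(x)^-1 e(X)] by
    [epol_factored_shift], with constant derivative [e(x)^-1]. *)
Lemma shiftsum_newton bs x n : uniq (fspan bs) -> x \notin fspan bs ->
  (n == 0%N)%:R * (epol bs).[x]^-1 =
  \sum_(k < n.+1) (-1) ^+ k * shiftsum bs k.+1 x *
     (((n - k)%N == 0%N)%:R + (epol bs).[x]^-1 * (epol bs)`_(n - k)).
Proof.
move=> U xn.
have nz v : v \in fspan bs -> x + v != 0.
  by move=> vs; apply: contraNneq xn => /eqP; rewrite addr_eq0 => /eqP ->; apply: fspanN.
have := @newton _ [seq x + v | v <- fspan bs] n; rewrite all_map big_map /=.
have -> : all (fun v => x + v != 0) (fspan bs) by apply/allP => v /nz.
rewrite (epol_factored_shift U (epol_prod U) nz) => /(_ isT) N.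
transitivity ((1 + (epol bs).[x]^-1 *: epol bs)`_n.+1 *+ n.+1).
  rewrite -coef_deriv derivD derivC derivZ (deriv_epol jK io) add0r coefZ coef1.
  by rewrite mulrC.
rewrite N; apply: eq_bigr => k _; rewrite big_map coefD coef1 coefZ //.
Qed.

Lemma shiftsum1 bs x : uniq (fspan bs) -> x \notin fspan bs ->
  shiftsum bs 1 x = (epol bs).[x]^-1.
Proof.
move=> U xn; have := shiftsum_newton 0 U xn.
by rewrite big_ord1 /= coef0_epol // mulr0 addr0 mulr1 !mul1r => ->.
Qed.

(** Newton's identity solved for the highest power sum. Iterated, it writes the sum as a polynomial
    in [1 / e(x)] with coefficients built from those of [e]. *)
Lemma shiftsum_rec bs x n : uniq (fspan bs) -> x \notin fspan bs ->
  shiftsum bs n.+2 x = (epol bs).[x]^-1 *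
    \sum_(k < n.+1) (-1) ^+ (n + k) * shiftsum bs k.+1 x * (epol bs)`_(n.+1 - k).
Proof.
move=> U xn; have := shiftsum_newton n.+1 U xn.
rewrite big_ord_recr /= subnn mul0r coef0_epol // mulr0 addr0 mulr1.
move/(congr1 (fun z => (-1) ^+ n * z)); rewrite mulr0 mulrDr.
have -> : (-1) ^+ n * ((-1) ^+ n.+1 * shiftsum bs n.+2 x) = - shiftsum bs n.+2 x.
  by rewrite mulrA -exprD addnS exprS -signr_odd oddD addbb mulr1 mulN1r.
move/eqP; rewrite eq_sym subr_eq0 => /eqP <-.
rewrite !mulr_sumr; apply: eq_bigr => k _; rewrite subn_eq0 leqNgt ltn_ord /= add0r exprD; ring.
Qed.

(* The lattice at the next level is spanned by [zs] and [a] times the lattice [bs]. *)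
Lemma epol_functional a zs bs bs' : a != 0 -> uniq (fspan bs') ->
  perm_eq (fspan bs') (fspan (zs ++ [seq a * b | b <- bs])) ->
  epol bs' \Po (a *: 'X) =
  epol [seq (epol [seq a * b | b <- bs]).[z] | z <- zs] \Po (a *: epol bs).
Proof.
move=> a0 U p; rewrite (epol_perm U p) (epol_cat F) -comp_polyA (epol_scale F _ a0) //.
Qed.

Lemma coef_epol_exp bs i n :
  (epol bs ^+ (q ^ i))`_(q ^ n) = if (i <= n)%N then ecoef bs (n - i) ^+ (q ^ i) else 0.
Proof.
have -> : epol bs ^+ (q ^ i) =
    \sum_(j < (size bs).+1) ecoef bs j ^+ (q ^ i) *: 'X^(q ^ (i + j)).
  rewrite {1}(epolE jK io bs) /qpoly; elim/big_rec2: _ => [|j x y _ E].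
    by rewrite expr0n gtn_eqF // expn_gt0 q_gt0.
  by rewrite (exprD_card (jCpoly jK io)) E exprZn -exprM -expnD addnC.
rewrite coef_sum; case: leqP => [le|lt]; last first.
  rewrite big1 // => j _; rewrite coefZ coefXn eqn_exp2l ?card_field_gt1 //.
  by rewrite ltn_eqF ?mulr0 // ltn_addr.
have [lt|ge] := ltnP (n - i) (size bs).+1.
  rewrite (bigD1 (Ordinal lt)) //= big1 => [|j ji].
    by rewrite addr0 coefZ coefXn subnKC // eqxx mulr1.
  rewrite coefZ coefXn eqn_exp2l ?card_field_gt1 //; case: eqP => [E|]; last by rewrite mulr0.
  by case/eqP: ji; apply: val_inj; rewrite /= E addKn.
have -> : ecoef bs (n - i) = 0.
  have := coef_qpoly F (size bs).+1 (ecoef bs) (n - i); rewrite -(epolE jK io) ltnNge ge /=.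
  by [].
rewrite expr0n gtn_eqF ?expn_gt0 ?q_gt0 // big1 // => j _.
rewrite coefZ coefXn eqn_exp2l ?card_field_gt1 //; case: eqP => [E|]; last by rewrite mulr0.
by move: (ltn_ord j) ge; rewrite E addKn => lt; rewrite leqNgt lt.
Qed.

Lemma ecoef0 bs : ecoef bs 0 = 1.
Proof. by rewrite /(ecoef _ _) coef1_epol. Qed.

(** Comparison of the coefficients of [X^(q^n)]. As [epol bs] has linear coefficient 1, the term
    [i = n] isolates [ecoef W n], kept together with [a^(q^n)] because this product is the
    coefficient in the functional equation. *)
Lemma epol_functional_coef a W bs bs' n : a != 0 -> (n <= size W)%N ->
  epol bs' \Po (a *: 'X) = epol W \Po (a *: epol bs) ->
  ecoef W n * a ^+ (q ^ n) = a ^+ (q ^ n) * ecoef bs' n -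
     \sum_(i < n) ecoef W i * a ^+ (q ^ i) * ecoef bs (n - i) ^+ (q ^ i).
Proof.
move=> a0 nW /(congr1 (fun p : {poly C} => p`_(q ^ n))).
rewrite {1}(epolE jK io bs') {1}(epolE jK io W) !qpoly_comp !coef_sum.
have E1 : \sum_(i < (size bs').+1) (ecoef bs' i *: (a *: 'X) ^+ (q ^ i))`_(q ^ n) =
    a ^+ (q ^ n) * ecoef bs' n.
  transitivity ((qpoly F (size bs').+1 (fun i => ecoef bs' i * a ^+ (q ^ i)))`_(q ^ n)).
    rewrite /qpoly coef_sum; apply: eq_bigr => i _.
    by rewrite exprZn scalerA.
  rewrite coef_qpoly mulrC; case: ifP => // /negbT ge.
  have := coef_qpoly F (size bs').+1 (ecoef bs') n; rewrite -(epolE jK io) (negPf ge).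
  by rewrite /(ecoef _ _) => ->; rewrite mulr0.
rewrite E1 => ->.
have E2 : \sum_(i < (size W).+1) (ecoef W i *: (a *: epol bs) ^+ (q ^ i))`_(q ^ n) =
   \sum_(i < n.+1) ecoef W i * a ^+ (q ^ i) * ecoef bs (n - i) ^+ (q ^ i).
  rewrite [RHS](big_ord_widen (size W).+1 (fun i => ecoef W i * a ^+ (q ^ i) * ecoef bs (n - i) ^+ (q ^ i))) //.
  rewrite [RHS]big_mkcond; apply: eq_bigr => i _.
  rewrite exprZn scalerA coefZ coef_epol_exp ltnS; case: ifP => _ //.
  by rewrite mulr0.
by rewrite E2 big_ord_recr /= subnn ecoef0 expr1n mulr1 addrAC subrr add0r.
Qed.

End Combinations.

(** * Ultrametric limits *)

Section Ultrametric.
Variables (R : realType) (C : ultrametricClosedFieldType R).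
Implicit Types (x y : C) (e B : R).
Local Notation vabs := (@vabs R C).

Lemma vabs0 : vabs 0 = 0.
Proof. by apply/eqP; rewrite vabs_eq0. Qed.

Lemma vabs_gt0 x : (0 < vabs x) = (x != 0).
Proof. by rewrite lt_def vabs_eq0 vabs_ge0 andbT. Qed.

Lemma vabs1 : vabs 1 = 1.
Proof.
have n0 : vabs 1 != 0 by rewrite vabs_eq0 oner_neq0.
by apply: (mulfI n0); rewrite -vabsM !mulr1.
Qed.

Lemma vabsN1 : vabs (-1) = 1.
Proof.
have : vabs (-1) ^+ 2 = 1 by rewrite expr2 -vabsM mulrNN mulr1 vabs1.
by move/eqP; rewrite sqrf_eq1 => /orP[/eqP //|/eqP E]; have := vabs_ge0 (-1 : C); rewrite E; lra.
Qed.

Lemma vabsN x : vabs (- x) = vabs x.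
Proof. by rewrite -mulN1r vabsM vabsN1 mul1r. Qed.

Lemma vabsB x y : vabs (x - y) = vabs (y - x).
Proof. by rewrite -vabsN opprB. Qed.

Lemma vabsX x n : vabs (x ^+ n) = vabs x ^+ n.
Proof. by elim: n => [|n IH]; rewrite ?expr0 ?vabs1 // !exprS vabsM IH. Qed.

Lemma vabsV x : vabs x^-1 = (vabs x)^-1.
Proof.
have [->|x0] := eqVneq x 0; first by rewrite invr0 vabs0 invr0.
have v0 : vabs x != 0 by rewrite vabs_eq0.
by apply: (mulfI v0); rewrite -vabsM !mulfV // vabs1.
Qed.

Lemma vabs_prod (I : Type) (r : seq I) (P : pred I) (f : I -> C) :
  vabs (\prod_(i <- r | P i) f i) = \prod_(i <- r | P i) vabs (f i).
Proof. by elim/big_rec2: _ => [|i x y _ <-]; rewrite ?vabs1 ?vabsM. Qed.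

Lemma vabsD_le B x y : vabs x <= B -> vabs y <= B -> vabs (x + y) <= B.
Proof. by move=> xB yB; apply: le_trans (vabsD_max _ _) _; rewrite ge_max xB. Qed.

Lemma vabsD_lt B x y : vabs x < B -> vabs y < B -> vabs (x + y) < B.
Proof. by move=> xB yB; apply: le_lt_trans (vabsD_max _ _) _; rewrite gt_max xB. Qed.

Lemma vabs_sub_lt B x y z : vabs (x - y) < B -> vabs (y - z) < B -> vabs (x - z) < B.
Proof. by move=> xy yz; rewrite -(subrKA y) vabsD_lt. Qed.

Lemma vabs_sum_le (I : eqType) (r : seq I) (P : pred I) (f : I -> C) B : 0 <= B ->
  (forall i, i \in r -> P i -> vabs (f i) <= B) -> vabs (\sum_(i <- r | P i) f i) <= B.
Proof.
move=> B0 H; rewrite big_seq_cond; elim/big_rec: _ => [|i x /andP[ir Pi] xB];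
  first by rewrite vabs0.
by apply: vabsD_le => //; apply: H.
Qed.

Lemma vabs_sum_lt (I : eqType) (r : seq I) (P : pred I) (f : I -> C) B : 0 < B ->
  (forall i, i \in r -> P i -> vabs (f i) < B) -> vabs (\sum_(i <- r | P i) f i) < B.
Proof.
move=> B0 H; rewrite big_seq_cond; elim/big_rec: _ => [|i x /andP[ir Pi] xB];
  first by rewrite vabs0.
by apply: vabsD_lt => //; apply: H.
Qed.

Lemma vabsD_eq x y : vabs x < vabs y -> vabs (x + y) = vabs y.
Proof.
move=> xy; apply/eqP; rewrite eq_le vabsD_le ?(ltW xy) //=.
have := vabsD_max (x + y) (- x); rewrite addrAC subrr add0r vabsN.
by rewrite le_max => /orP[//|]; rewrite leNgt xy.
Qed.

Lemma vabs_near x y : vabs (x - y) < vabs y -> vabs x = vabs y.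
Proof. by move=> H; rewrite -(vabsD_eq H) subrK. Qed.

Lemma vabs_near1 x : vabs (x - 1) < 1 -> vabs x = 1.
Proof. by move=> H; rewrite (@vabs_near x 1) vabs1. Qed.

Lemma vabs_neqD x y : vabs x != vabs y -> vabs (x + y) = Num.max (vabs x) (vabs y).
Proof.
case: ltgtP => // [xy|yx] _; first by rewrite vabsD_eq // max_r ?ltW.
by rewrite addrC vabsD_eq // max_l ?ltW.
Qed.

Lemma prod_near1 (I : eqType) (r : seq I) (f : I -> C) e : 0 < e -> e <= 1 ->
  (forall i, i \in r -> vabs (f i - 1) < e) -> vabs (\prod_(i <- r) f i - 1) < e.
Proof.
move=> e0 e1 H; rewrite big_seq; elim/big_rec: _ => [|i x ir xe]; first by rewrite subrr vabs0.
have -> : f i * x - 1 = f i * (x - 1) + (f i - 1) by ring.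
have fe := H _ ir; apply: vabsD_lt => //.
by rewrite vabsM (vabs_near1 (lt_le_trans fe e1)) mul1r.
Qed.

Definition vcvg (u : nat -> C) (l : C) :=
  forall e, 0 < e -> exists N, forall n, (N <= n)%N -> vabs (u n - l) < e.

Lemma vcvg_unique u l l' : vcvg u l -> vcvg u l' -> l = l'.
Proof.
move=> ul ul'; apply/eqP; rewrite -subr_eq0; apply: contraT => d0.
have e0 : 0 < vabs (l - l') by rewrite vabs_gt0.
have [N HN] := ul _ e0; have [N' HN'] := ul' _ e0.
have := HN _ (leq_maxl N N'); have := HN' _ (leq_maxr N N').
set n := maxn N N'; rewrite [X in _ -> X < _ -> _]vabsB => H1 H2.
by have := vabs_sub_lt H2 H1; rewrite ltxx.
Qed.

Lemma vcvg_ext u v l : (exists N, forall n, (N <= n)%N -> u n = v n) -> vcvg u l -> vcvg v l.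
Proof.
move=> [M uv] ul e /ul[N HN]; exists (maxn M N) => n; rewrite geq_max => /andP[Mn Nn].
by rewrite -uv // HN.
Qed.

Lemma vcvg_eq u v l : u =1 v -> vcvg u l -> vcvg v l.
Proof. by move=> uv; apply: vcvg_ext; exists 0%N => n _. Qed.

Lemma vcvg_cst l : vcvg (fun _ => l) l.
Proof. by move=> e e0; exists 0%N => n _; rewrite subrr vabs0. Qed.

Lemma vcvgD u v l m : vcvg u l -> vcvg v m -> vcvg (fun n => u n + v n) (l + m).
Proof.
move=> ul vm e e0; have [N HN] := ul _ e0; have [M HM] := vm _ e0.
exists (maxn N M) => n; rewrite geq_max => /andP[Nn Mn].
by rewrite opprD addrACA vabsD_lt ?HN ?HM.
Qed.

Lemma vcvg_bounded u l :
  vcvg u l -> exists2 B, 0 < B & exists N, forall n, (N <= n)%N -> vabs (u n) <= B.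
Proof.
move=> /(_ _ ltr01)[N HN]; exists (Num.max 1 (vabs l)); first by rewrite lt_max ltr01.
exists N => n /HN lt; rewrite -[u n](subrK l); apply: vabsD_le; last by rewrite le_max lexx orbT.
by rewrite le_max (ltW lt).
Qed.

Lemma vcvg_bounded_all u l : vcvg u l -> exists2 B, 0 < B & forall n, vabs (u n) <= B.
Proof.
move=> /vcvg_bounded[B B0 [N HN]].
have [B' B'0 HB'] : exists2 B', 0 < B' & forall n, (n < N)%N -> vabs (u n) <= B'.
  elim: N {HN} => [|N [B' B'0 IH]]; first by exists 1.
  exists (Num.max B' (vabs (u N))); first by rewrite lt_max B'0.
  move=> n; rewrite ltnS leq_eqVlt le_max => /orP[/eqP ->|/IH ->//]; by rewrite lexx orbT.
exists (Num.max B B'); first by rewrite lt_max B0.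
by move=> n; rewrite le_max; case: (leqP N n) => [/HN ->|/HB' ->]; rewrite ?orbT.
Qed.

Lemma vcvgM u v l m : vcvg u l -> vcvg v m -> vcvg (fun n => u n * v n) (l * m).
Proof.
move=> ul vm e e0; have [B B0 [N0 HB]] := vcvg_bounded ul.
have m0 : 0 < Num.max 1 (vabs m) by rewrite lt_max ltr01.
have [N HN] := ul (e / Num.max 1 (vabs m)) (divr_gt0 e0 m0).
have [M HM] := vm (e / B) (divr_gt0 e0 B0).
exists (maxn N0 (maxn N M)) => n; rewrite !geq_max => /and3P[N0n Nn Mn].
have -> : u n * v n - l * m = u n * (v n - m) + (u n - l) * m by ring.
apply: vabsD_lt; rewrite vabsM.
  have := HM _ Mn; rewrite ltr_pdivlMr // mulrC => lt; apply: le_lt_trans lt.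
  by rewrite ler_wpM2r ?vabs_ge0 ?HB.
have := HN _ Nn; rewrite ltr_pdivlMr // => lt; apply: le_lt_trans lt.
by rewrite ler_wpM2l ?vabs_ge0 // le_max lexx orbT.
Qed.

Lemma vcvgZ a u l : vcvg u l -> vcvg (fun n => a * u n) (a * l).
Proof. by apply: vcvgM; apply: vcvg_cst. Qed.

Lemma vcvgN u l : vcvg u l -> vcvg (fun n => - u n) (- l).
Proof.
move=> ul; rewrite -mulN1r; apply: vcvg_eq (vcvgZ (-1) ul) => n; exact: mulN1r.
Qed.

Lemma vcvgB u v l m : vcvg u l -> vcvg v m -> vcvg (fun n => u n - v n) (l - m).
Proof. by move=> ul vm; apply: vcvgD => //; apply: vcvgN. Qed.

Lemma vcvgX u l k : vcvg u l -> vcvg (fun n => u n ^+ k) (l ^+ k).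
Proof.
move=> ul; elim: k => [|k IH]; first exact: vcvg_cst.
by rewrite exprS; apply: vcvg_eq (vcvgM ul IH) => n; rewrite exprS.
Qed.

Lemma vcvg_sum (I : eqType) (r : seq I) (u : I -> nat -> C) (l : I -> C) :
  (forall i, i \in r -> vcvg (u i) (l i)) ->
  vcvg (fun n => \sum_(i <- r) u i n) (\sum_(i <- r) l i).
Proof.
elim: r => [|i r IH] H.
  by rewrite big_nil; apply: vcvg_eq (vcvg_cst 0) => n; rewrite big_nil.
rewrite big_cons; apply: (@vcvg_eq (fun n => u i n + \sum_(j <- r) u j n)).
  by move=> n; rewrite big_cons.
apply: vcvgD; first by apply: H; rewrite mem_head.
by apply: IH => j jr; apply: H; rewrite inE jr orbT.
Qed.

Lemma vcvg_sum_ord k (u : 'I_k -> nat -> C) (l : 'I_k -> C) :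
  (forall i, vcvg (u i) (l i)) -> vcvg (fun n => \sum_(i < k) u i n) (\sum_(i < k) l i).
Proof. by move=> H; apply: vcvg_sum. Qed.

Lemma vcvg_vabs u l : vcvg u l -> l != 0 ->
  exists N, forall n, (N <= n)%N -> vabs (u n) = vabs l.
Proof.
move=> ul l0; have [|N HN] := ul (vabs l); first by rewrite vabs_gt0.
by exists N => n /HN /vabs_near.
Qed.

Lemma vcvgV u l : vcvg u l -> l != 0 -> vcvg (fun n => (u n)^-1) l^-1.
Proof.
move=> ul l0 e e0; have [N HN] := vcvg_vabs ul l0.
have v0 : 0 < vabs l by rewrite vabs_gt0.
have [|M HM] := ul (e * (vabs l * vabs l)); first by rewrite !mulr_gt0.
exists (maxn N M) => n; rewrite geq_max => /andP[/HN Nn /HM Mn].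
have u0 : u n != 0 by rewrite -vabs_gt0 Nn.
have -> : (u n)^-1 - l^-1 = - ((u n - l) / (u n * l)) by field; rewrite u0 l0.
by rewrite vabsN vabsM vabsV vabsM Nn ltr_pdivrMr ?mulr_gt0.
Qed.

Lemma vcvg_le u l B : vcvg u l -> (exists N, forall n, (N <= n)%N -> vabs (u n) <= B) ->
  vabs l <= B.
Proof.
move=> ul [N HN]; have B0 : 0 <= B by apply: le_trans (vabs_ge0 _) (HN N (leqnn N)).
have [->|l0] := eqVneq l 0; first by rewrite vabs0.
have [M HM] := vcvg_vabs ul l0; rewrite -(HM (maxn N M)) ?leq_maxr //.
by rewrite HN ?leq_maxl.
Qed.

Lemma vcvg_shift u l : vcvg u l -> vcvg (fun n => u n.+1) l.
Proof. by move=> ul e /ul[N HN]; exists N => n Nn; apply: HN; apply: leqW. Qed.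

Lemma vcvgP (u : nat -> C) l : u @ \oo --> l <-> vcvg u l.
Proof.
split=> [/cvg_ballP H e e0|H].
  have [N _ HN] := H _ e0; exists N => n Nn; have := HN n Nn.
  by rewrite /= vabs_ball /= vabsB.
apply/cvg_ballP => e e0; have [N HN] := H _ e0; exists N => // n Nn.
by rewrite /= vabs_ball /= vabsB; apply: HN.
Qed.

Lemma vcauchy_cvg (u : nat -> C) :
  (forall e, 0 < e -> exists N, forall n, (N <= n)%N -> vabs (u n - u N) < e) ->
  exists l, vcvg u l.
Proof.
move=> H; suff : cvg (u @ \oo) by exists (lim (u @ \oo)); apply/vcvgP.
apply/cauchy_cvgP/cauchy_exP => e e0; have [N HN] := H _ e0; exists (u N).
by exists N => // n Nn; rewrite /= vabs_ball /= vabsB; apply: HN.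
Qed.

(** * Unconditional sums and products as limits along an exhausting sequence *)

Section Nets.
Variables (I : choiceType) (D : set I) (L : nat -> seq I).
Hypotheses (Luniq : forall n, uniq (L n)) (LD : forall n i, i \in L n -> D i).
Hypotheses (Lmono : forall n m, (n <= m)%N -> {subset L n <= L m}).
Hypothesis Lcover : forall i, D i -> exists n, i \in L n.

(** Treats sums and products alike: [psi] is the value on a duplicate-free list, and [phi] sees only
    the part of a finite set lying in [D]. The second hypothesis makes the net Cauchy. *)
Lemma net_cvg (phi : {fset I} -> C) (psi : seq I -> C) :
  (forall (A : {fset I}) (s : seq I), uniq s ->
     (forall i, i \in s = (i \in A) && (i \in D)) -> phi A = psi s) ->
  (forall e, 0 < e -> exists n, forall s : seq I, uniq s -> {subset L n <= s} ->
     (forall i, i \in s -> D i) -> vabs (psi s - psi (L n)) < e) ->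
  vcvg (psi \o L) (lim (phi A @[A --> @totally I])).
Proof.
move=> phiE H.
have phiE' (A : {fset I}) : phi A = psi [seq i <- enum_fset A | i \in D].
  by apply: phiE => [|i]; rewrite ?filter_uniq ?fset_uniq // mem_filter andbC.
have PF : ProperFilter (@totally I) := totally_filter.
have : cvg (phi A @[A --> @totally I]).
  apply/cauchy_cvgP/cauchy_exP => e e0; have [n Hn] := H _ e0.
  exists (psi (L n)); exists [fset i in L n]%fset => // A /= LA.
  rewrite vabs_ball /= vabsB phiE'; apply: Hn; rewrite ?filter_uniq ?fset_uniq //.
    move=> i iL; rewrite mem_filter (mem_set (LD iL)) /=.
    by apply: (fsubsetP LA); rewrite inE.
  by move=> i; rewrite mem_filter => /andP[/set_mem].
move=> /cvg_ballP cv e e0; have [B _ HB] := cv _ e0.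
have [N HN] : exists N, forall i, i \in enum_fset B -> D i -> i \in L N.
  elim: (enum_fset B) => [|i s [N HN]]; first by exists 0%N.
  have [[n Hn]|nD] := pselect (exists n, i \in L n).
    exists (maxn n N) => j; rewrite inE => /orP[/eqP -> _|js Dj].
      by apply: Lmono Hn; rewrite leq_maxl.
    by apply: Lmono (HN _ js Dj); rewrite leq_maxr.
  exists N => j; rewrite inE => /orP[/eqP -> /Lcover//|]; exact: HN.
(* The set [B] united with [L n] is beyond [B] in the net and, for [n >= N], meets [D] exactly in
   [L n]. *)
exists N => n Nn; have := HB (B `|` [fset i in L n])%fset (fsubsetUl _ _).
rewrite /= vabs_ball /= vabsB (@phiE _ (L n)) // => i; rewrite !inE.
apply/idP/andP => [iL|[/orP[iB /set_mem/(HN _ iB)/(Lmono Nn)//|//]]].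
by rewrite iL orbT (mem_set (LD iL)).
Qed.

Lemma usum_vcvg (x : I -> C) :
  (forall e, 0 < e -> exists n, forall i, D i -> i \notin L n -> vabs (x i) < e) ->
  vcvg (fun n => \sum_(i <- L n) x i) (usum D x).
Proof.
move=> H; apply: (@net_cvg _ (fun s => \sum_(i <- s) x i)).
  move=> A s us sE; rewrite -big_filter; apply: perm_big; apply: uniq_perm => //.
    by rewrite filter_uniq ?fset_uniq.
  by move=> i; rewrite mem_filter sE andbC.
move=> e e0; have [n Hn] := H _ e0; exists n => s us Ls sD.
have p : perm_eq s (L n ++ [seq i <- s | i \notin L n]).
  apply: uniq_perm => //.
    rewrite cat_uniq Luniq filter_uniq // andbT /=.
    by apply/hasPn => i; rewrite mem_filter => /andP[].
  by move=> i; rewrite mem_cat mem_filter; case: (boolP (i \in L n)) => // /Ls ->.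
rewrite (perm_big _ p) big_cat /= addrAC subrr add0r big_filter.
by apply: vabs_sum_lt => // i /sD Di iL; apply: Hn.
Qed.

Lemma uprod_vcvg (f : I -> C) :
  (forall e, 0 < e -> exists n, forall i, D i -> i \notin L n -> vabs (f i - 1) < e) ->
  vcvg (fun n => \prod_(i <- L n) f i) (uprod D f).
Proof.
move=> H; apply: (@net_cvg _ (fun s => \prod_(i <- s) f i)).
  move=> A s us sE; rewrite -big_filter; apply: perm_big; apply: uniq_perm => //.
    by rewrite filter_uniq ?fset_uniq.
  by move=> i; rewrite mem_filter sE andbC.
have p n s : uniq s -> {subset L n <= s} -> perm_eq s (L n ++ [seq i <- s | i \notin L n]).
  move=> us Ls; apply: uniq_perm => //.
    rewrite cat_uniq Luniq filter_uniq // andbT /=.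
    by apply/hasPn => i; rewrite mem_filter => /andP[].
  by move=> i; rewrite mem_cat mem_filter; case: (boolP (i \in L n)) => // /Ls ->.
move=> e e0; have [n0 Hn0] := H _ ltr01.
(* Factors outside [L n0] have absolute value 1, so [M] bounds all later partial products; further
   factors are then required to be within [e / M] of 1. *)
pose M := Num.max 1 (vabs (\prod_(i <- L n0) f i)).
have M0 : 0 < M by rewrite lt_max ltr01.
have e'0 : 0 < Num.min 1 (e / M) by rewrite lt_min ltr01 divr_gt0.
have [n1 Hn1] := H _ e'0; exists (maxn n0 n1) => s us Ls sD; set n := maxn _ _ in Ls *.
rewrite (perm_big _ (p _ _ us Ls)) big_cat /= -{2}[\prod_(i <- L n) _]mulr1 -mulrBr vabsM.
have -> : vabs (\prod_(i <- L n) f i) = vabs (\prod_(i <- L n0) f i).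
  have sub : {subset L n0 <= L n} by apply: Lmono; rewrite leq_maxl.
  rewrite (perm_big _ (p _ _ (Luniq n) sub)) big_cat /= vabsM [X in _ * X = _]vabs_near1 ?mulr1 //.
  apply: prod_near1 => // i; rewrite mem_filter => /andP[iL /LD Di]; exact: Hn0.
apply: (@le_lt_trans _ _ (M * vabs (\prod_(i <- [seq i <- s | i \notin L n]) f i - 1))).
  by rewrite ler_wpM2r ?vabs_ge0 // le_max lexx orbT.
rewrite mulrC -ltr_pdivlMr //; apply: (@lt_le_trans _ _ (Num.min 1 (e / M))); last first.
  by rewrite ge_min lexx orbT.
apply: prod_near1 => //; first by rewrite ge_min lexx.
move=> i; rewrite mem_filter => /andP[iL /sD Di]; apply: Hn1 => //.
by apply: contra iL; apply: Lmono; rewrite leq_maxr.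
Qed.

End Nets.
End Ultrametric.

(** * Lattices *)

Lemma exists_ord_recl n (P : pred 'I_n.+1) :
  [exists i, P i] = P ord0 || [exists i, P (lift ord0 i)].
Proof.
apply/existsP/orP => [[i Pi]|[P0|/existsP[i Pi]]]; [|by exists ord0|by exists (lift ord0 i)].
by case: (unliftP ord0 i) Pi => [j ->|->] Pi; [right; apply/existsP; exists j|left].
Qed.

Lemma forall_ord_recl n (P : pred 'I_n.+1) :
  [forall i, P i] = P ord0 && [forall i, P (lift ord0 i)].
Proof.
apply/forallP/andP => [H|[P0 /forallP H] i]; first by split; [|apply/forallP => i].
by case: (unliftP ord0 i) => [j ->|->].
Qed.

Section HeadCons.
Variable T : Type.

(** Same shape as [consz], so that [consz z1 z'] is convertible to [hcons z1 z']. *)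
Definition hcons r (a : T) (f : 'rV[T]_r) : 'rV[T]_r.+1 := row_mx (const_mx a : 'rV_1) f.

Definition htail r (v : 'rV[T]_r.+1) : 'rV[T]_r := \row_j v 0 (lift ord0 j).

Lemma hcons0 r (a : T) (f : 'rV[T]_r) : hcons a f 0 ord0 = a.
Proof.
rewrite /hcons mxE; case: (splitP (ord0 : 'I_(1 + r))) => [j _|k]; first by rewrite mxE.
by [].
Qed.

Lemma hconsS r (a : T) (f : 'rV[T]_r) j : hcons a f 0 (lift ord0 j) = f 0 j.
Proof.
rewrite /hcons mxE; case: (splitP (lift ord0 j : 'I_(1 + r))) => [i|k].
  by rewrite [i]ord1.
by rewrite /= /bump /= !add1n => -[E]; congr (f _ _); apply: val_inj.
Qed.

Lemma hcons_htail r (v : 'rV[T]_r.+1) : hcons (v 0 ord0) (htail v) = v.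
Proof.
apply/rowP => i; case: (unliftP ord0 i) => [j ->|->]; last by rewrite hcons0.
by rewrite hconsS mxE.
Qed.

Lemma htail_hcons r (a : T) (f : 'rV[T]_r) : htail (hcons a f) = f.
Proof. by apply/rowP => j; rewrite mxE hconsS. Qed.

End HeadCons.

(** * Boxes of polynomial vectors and the order on them *)

Section PolyBasis.
Variable F : finFieldType.
Local Notation A := {poly F}.
Local Notation is_ell := (@is_ell F _).
Local Notation succ0 := (@succ0 F _).
Local Notation succv := (@succv F _).

Definition pscale r (c : F) (v : 'rV[A]_r) : 'rV[A]_r := c%:P *: v.

Lemma pscale0 r (v : 'rV[A]_r) : pscale 0 v = 0.
Proof. by rewrite /pscale polyC0 scale0r. Qed.

Lemma pscale1 r (v : 'rV[A]_r) : pscale 1 v = v.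
Proof. by rewrite /pscale polyC1 scale1r. Qed.

Fixpoint xbasis k : seq A := if k is k'.+1 then 'X^k' :: xbasis k' else [::].

(* The vectors X^k e_i with [k < d], from the highest to the lowest in the order of the
   problem. *)
Fixpoint lbasis r d : seq 'rV[A]_r :=
  if r is r'.+1 then
    map (fun a => hcons a 0) (xbasis d) ++ map (hcons 0) (lbasis r' d)
  else [::].

(** The size bound [k] of the first coordinate is separated from the bound [d] of the others so that
    one can add a single level at a time by induction on [k]. *)
Definition pbasis r d k : seq 'rV[A]_r.+1 :=
  map (fun a => hcons a 0) (xbasis k) ++ map (hcons 0) (lbasis r d).

Definition inbox r d (v : 'rV[A]_r) : bool := [forall i, (size (v 0%R i) <= d)%N].

Definition inpbox r d k (v : 'rV[A]_r.+1) : bool :=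
  (size (v 0%R ord0) <= k)%N && inbox d (htail v).

Lemma inbox_pbox r d (v : 'rV[A]_r.+1) : inbox d v = inpbox d d v.
Proof.
rewrite /inbox forall_ord_recl /inpbox; congr (_ && _).
by apply: eq_forallb => j; rewrite mxE.
Qed.

Lemma hconsD r (a b : A) (f g : 'rV[A]_r) : hcons (a + b) (f + g) = hcons a f + hcons b g.
Proof.
by apply/rowP => i; case: (unliftP ord0 i) => [j ->|->]; rewrite [in RHS]mxE ?hcons0 ?hconsS ?mxE.
Qed.

Lemma pscale_hcons r c (a : A) (f : 'rV[A]_r) :
  pscale c (hcons a f) = hcons (c%:P * a) (pscale c f).
Proof.
by apply/rowP => i; case: (unliftP ord0 i) => [j ->|->]; rewrite [in LHS]mxE ?hcons0 ?hconsS ?mxE.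
Qed.

Lemma hcons00 r : hcons 0 0 = 0 :> 'rV[A]_r.+1.
Proof.
by apply/rowP => i; case: (unliftP ord0 i) => [j ->|->]; rewrite ?hcons0 ?hconsS [RHS]mxE ?mxE.
Qed.

Lemma hcons0_span r (bs : seq 'rV[A]_r) :
  span (@pscale r.+1) (map (hcons 0) bs) = map (hcons 0) (span (@pscale r) bs).
Proof.
apply: span_map; first exact: hcons00.
  by move=> x y; rewrite -hconsD addr0.
by move=> c v; rewrite pscale_hcons mulr0.
Qed.

Lemma hcons0_chains r (bs : seq 'rV[A]_r) m :
  chains (@pscale r.+1) (map (hcons 0) bs) m = map (map (hcons 0)) (chains (@pscale r) bs m).
Proof.
apply: chains_map; first exact: hcons00.
  by move=> x y; rewrite -hconsD addr0.
by move=> c v; rewrite pscale_hcons mulr0.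
Qed.

Lemma hcons_inj r (a : A) : injective (@hcons A r a).
Proof. by move=> f g /(congr1 (@htail _ _)); rewrite !htail_hcons. Qed.

Lemma size_subX (a : A) k : (size a <= k.+1)%N -> (size (a - a`_k *: 'X^k)%R <= k)%N.
Proof.
move=> sa; apply/leq_sizeP => j; rewrite leq_eqVlt coefB coefZ coefXn => /orP[/eqP <-|lt].
  by rewrite eqxx mulr1 subrr.
by rewrite (gtn_eqF lt) mulr0 subr0 nth_default // (leq_trans sa).
Qed.

Lemma size_addX (a : A) (c : F) k : (size a <= k)%N -> (size (c%:P * 'X^k + a)%R <= k.+1)%N.
Proof.
move=> sa; apply: leq_trans (size_polyD _ _) _; rewrite geq_max (leqW sa) andbT mul_polyC.
by apply: leq_trans (size_scale_leq _ _) _; rewrite size_polyXn.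
Qed.

Lemma span_pbasis r d k :
  (forall v, (v \in span (@pscale r) (lbasis r d)) = inbox d v) ->
  uniq (span (@pscale r) (lbasis r d)) ->
  uniq (span (@pscale r.+1) (pbasis r d k)) /\
  forall v, (v \in span (@pscale r.+1) (pbasis r d k)) = inpbox d k v.
Proof.
move=> IHm IHu; elim: k => [|k [IHku IHkm]].
  rewrite /pbasis /= hcons0_span map_inj_uniq //; last exact: hcons_inj.
  split=> // v; rewrite /inpbox leqn0 size_poly_eq0.
  apply/mapP/andP => [[w]|[/eqP v0 vb]].
    by rewrite IHm => wb ->; rewrite hcons0 htail_hcons.
  by exists (htail v); rewrite ?IHm // -v0 hcons_htail.
have mem v : (v \in span (@pscale r.+1) (pbasis r d k.+1)) = inpbox d k.+1 v.
  apply/span_consP/andP => [[c [w []]]|[sv vb]].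
    rewrite -/(xbasis k) -/(pbasis r d k) IHkm => /andP[sw wb] ->.
    rewrite pscale_hcons -[w]hcons_htail -hconsD.
    by rewrite hcons0 htail_hcons /pscale scaler0 add0r size_addX.
  exists (v 0 ord0)`_k, (hcons (v 0 ord0 - (v 0 ord0)`_k *: 'X^k) (htail v)).
  rewrite -/(xbasis k) -/(pbasis r d k) IHkm /inpbox hcons0 htail_hcons size_subX //.
  by rewrite pscale_hcons -hconsD /pscale scaler0 add0r mul_polyC addrC subrK hcons_htail.
split=> //; apply: allpairs_uniq; [exact: enum_uniq|exact: IHku|].
move=> [c v] [c' w] /allpairsP[[c1 v1] /= [_ vs [-> ->]]] /allpairsP[[d1 w1] /= [_ ws [-> ->]]].
change (is_true (v1 \in span (@pscale r.+1) (pbasis r d k))) in vs.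
change (is_true (w1 \in span (@pscale r.+1) (pbasis r d k))) in ws.
move: vs ws; rewrite !IHkm => /andP[sv _] /andP[sw _] E.
have := E; rewrite /= !pscale_hcons -{1}[v1]hcons_htail -{1}[w1]hcons_htail -!hconsD.
move/(congr1 (fun u : 'rV[A]_r.+1 => (u 0 ord0)`_k)).
rewrite !hcons0 !coefD !coefCM coefXn eqxx !mulr1.
rewrite (nth_default _ sv) (nth_default _ sw) !addr0 => cd.
by move: E; rewrite cd => /addrI ->.
Qed.

Lemma span_lbasis r d : uniq (span (@pscale r) (lbasis r d)) /\
  forall v, (v \in span (@pscale r) (lbasis r d)) = inbox d v.
Proof.
elim: r => [|r [IHu IHm]].
  split=> // v; rewrite /inbox [v]thinmx0 inE eqxx; apply/esym/forallP; by case.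
have [U M] := span_pbasis d IHm IHu.
by split=> // v; rewrite inbox_pbox -M.
Qed.

Lemma is_ell_hcons0 r (a : A) (f : 'rV[A]_r) : is_ell (hcons a f) ord0 = (a != 0).
Proof.
rewrite /Defs.is_ell hcons0; case: eqP => //= _; by apply/forallP.
Qed.

Lemma is_ell_hconsS r (a : A) (f : 'rV[A]_r) i :
  is_ell (hcons a f) (lift ord0 i) = (a == 0) && is_ell f i.
Proof.
rewrite /Defs.is_ell hconsS forall_ord_recl hcons0 /= andbCA; congr (_ && (_ && _)).
by apply: eq_forallb => j; rewrite hconsS.
Qed.

Lemma succ0_hcons r (a : A) (f : 'rV[A]_r) :
  succ0 (hcons a f) = if a == 0 then succ0 f else a \is monic.
Proof.
rewrite /Defs.succ0 exists_ord_recl is_ell_hcons0 hcons0.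
under eq_existsb do rewrite is_ell_hconsS hconsS.
case: eqP => //= _; rewrite orbC; case: existsP => // -[]; by [].
Qed.

Lemma succv_hcons r (a b : A) (f g : 'rV[A]_r) :
  succv (hcons a f) (hcons b g) =
  [&& succ0 (hcons a f), succ0 (hcons b g) &
   if a == 0 then (b == 0) && succv f g else (b == 0) || (size b < size a)%N].
Proof.
rewrite /Defs.succv; case: (boolP (succ0 (hcons a f))) => //= sf.
case: (boolP (succ0 (hcons b g))) => //= sg.
have liftlt i j : (lift (@ord0 r) i < lift (@ord0 r) j)%N = (i < j)%N by [].
have lifteq i j : (lift (@ord0 r) i == lift ord0 j) = (i == j) by rewrite (inj_eq lift_inj).
case: eqVneq => [a0|a0].
  apply/existsP/andP => [[i /existsP[j]]|[b0]].
    case: (unliftP ord0 i) => [i' ->|->]; last by rewrite is_ell_hcons0 a0 eqxx.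
    case: (unliftP ord0 j) => [j' ->|->]; last by rewrite ltn0 /= andbF andbF.
    rewrite !is_ell_hconsS !hconsS liftlt lifteq => /and3P[/andP[_ H1] /andP[b0 H2] H3].
    split=> //; apply/and3P; split.
    - by move: sf; rewrite succ0_hcons a0 eqxx.
    - by move: sg; rewrite succ0_hcons b0.
    - by apply/existsP; exists i'; apply/existsP; exists j'; rewrite H1 H2.
  case/and3P=> _ _ /existsP[i /existsP[j /and3P[H1 H2 H3]]].
  exists (lift ord0 i); apply/existsP; exists (lift ord0 j).
  by rewrite !is_ell_hconsS !hconsS liftlt lifteq a0 b0 eqxx H1 H2.
apply/existsP/idP => [[i /existsP[j]]|H].
  case: (unliftP ord0 i) => [i' ->|->]; first by rewrite is_ell_hconsS (negPf a0).
  case: (unliftP ord0 j) => [j' ->|->].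
    by rewrite is_ell_hconsS => /and3P[_ /andP[-> _] _].
  by rewrite !hcons0 => /and3P[_ _ /= ->]; rewrite orbT.
exists ord0; have [b0|b0] := eqVneq b 0.
  move: sg; rewrite succ0_hcons b0 eqxx => /existsP[j /andP[Hj _]].
  apply/existsP; exists (lift ord0 j).
  by rewrite is_ell_hcons0 is_ell_hconsS a0 eqxx Hj.
move: H; rewrite (negPf b0) /= => H; apply/existsP; exists ord0.
by rewrite !is_ell_hcons0 !hcons0 a0 b0 H eqxx.
Qed.

Definition chainlike r (c : seq 'rV[A]_r) : bool := sorted succv c && all succ0 c.

Lemma chainlike_cons r v (c : seq 'rV[A]_r) :
  chainlike (v :: c) = [&& succ0 v, (if c is w :: _ then succv v w else true) & chainlike c].
Proof.
rewrite /chainlike /=; case: c => [|w c] /=; first by rewrite !andbT.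
case: (succ0 v) => /=; last by rewrite andbF.
by rewrite -!andbA.
Qed.

Lemma succv_size r (v w : 'rV[A]_r.+1) : succv v w ->
  (size (w 0%R ord0) <= size (v 0%R ord0))%N /\
  (v 0 ord0 != 0 -> (size (w 0%R ord0) < size (v 0%R ord0))%N).
Proof.
rewrite -{1}[v]hcons_htail -{1}[w]hcons_htail succv_hcons => /and3P[_ _].
case: eqVneq => [v0 /andP[/eqP -> _]|v0]; first by rewrite size_poly0.
case/orP=> [/eqP ->|lt]; last by split; [exact: ltnW|].
by rewrite size_poly0 lt0n size_poly_eq0.
Qed.

Lemma chainlike_size r v (c : seq 'rV[A]_r.+1) k : chainlike (v :: c) ->
  (size (v 0%R ord0) <= k)%N -> all (fun w : 'rV[A]_r.+1 => size (w 0%R ord0) <= k)%N c.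
Proof.
elim: c v => //= w c IH v; rewrite chainlike_cons => /and3P[_ /succv_size[le _] cw] vk.
have wk := leq_trans le vk.
by rewrite wk /=; apply: IH wk.
Qed.

(** The level of the basis vector with first coordinate [X^k] consists of the vectors whose first
    coordinate is monic of degree [k]. Such a vector exceeds exactly the positive vectors with first
    coordinate of smaller degree or zero, which are those below that level. *)
Lemma chains_pbasis r d k :
  (forall m c, (c \in chains (@pscale r) (lbasis r d) m) =
     [&& size c == m, chainlike c & all (inbox d) c]) ->
  forall m c, (c \in chains (@pscale r.+1) (pbasis r d k) m) =
     [&& size c == m, chainlike c & all (inpbox d k) c].
Proof.
move=> IHr; have [U M] := span_lbasis r d.
elim: k => [|k IH] m c.
  rewrite /pbasis /= hcons0_chains; apply/mapP/and3P => [[c0]|[sc cc bc]].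
    rewrite IHr => /and3P[sc cc bc] ->; rewrite size_map; split=> //.
      move: cc; rewrite /chainlike => /andP[c1 c2]; rewrite all_map; apply/andP; split.
        rewrite sorted_map; apply: sub_sorted c1 => x y /= xy.
        rewrite succv_hcons !succ0_hcons !eqxx /= xy andbT.
        by move: xy; rewrite /Defs.succv => /and3P[-> ->].
      by apply: sub_all c2 => x /=; rewrite succ0_hcons eqxx.
    rewrite all_map; apply: sub_all bc => x /= xb.
    by rewrite /inpbox hcons0 htail_hcons size_poly0 xb.
  have E : c = map (hcons 0) (map (@htail _ _) c).
    rewrite -map_comp -[LHS]map_id; apply/eq_in_map => x xc.
    move/allP: bc => /(_ _ xc); rewrite /inpbox leqn0 size_poly_eq0 => /andP[/eqP x0 _].
    by rewrite /= -x0 hcons_htail.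
  exists (map (@htail _ _) c) => //; rewrite IHr size_map sc /=.
  move: bc cc; rewrite {1 2}E /chainlike; set c' := map (@htail _ _) c => bc /andP[c1 c2].
  rewrite all_map in bc; rewrite all_map in c2; apply/andP; split; last first.
    by apply: sub_all bc => x /=; rewrite /inpbox htail_hcons => /andP[].
  apply/andP; split; last by apply: sub_all c2 => x /=; rewrite succ0_hcons eqxx.
  move: c1; rewrite sorted_map; apply: sub_sorted => x y /=.
  by rewrite succv_hcons eqxx => /and3P[_ _ /andP[]].
have Hspan v : (v \in span (@pscale r.+1) (pbasis r d k)) = inpbox d k v.
  by have [] := span_pbasis k M U.
rewrite /pbasis /= -/(pbasis r d k) mem_cat IH; case: m => [|m] /=.
  by rewrite orbF; case: c.
case: c => [|v c].
  rewrite /= ; apply/allpairsP => -[[w c']] [] //.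
rewrite /= eqSS.
have sizes (lt : (size (v 0%R ord0) <= k)%N) :
  [&& size c == m, chainlike (v :: c), inpbox d k.+1 v & all (inpbox d k.+1) c] ->
  [&& size c == m, chainlike (v :: c), inpbox d k v & all (inpbox d k) c].
  case/and4P=> -> cc /andP[_ vb] cb; rewrite cc /= {1}/inpbox lt vb /=.
  apply/allP => w wc; have /andP[_ wb] := allP cb _ wc.
  by rewrite /inpbox wb (allP (chainlike_size cc lt)).
have weaken u : inpbox d k u -> inpbox d k.+1 u.
  by rewrite /inpbox => /andP[le ->]; rewrite (leqW le).
apply/orP/idP => [[|]|H].
- case/and4P=> -> -> /weaken -> /allP cb; apply/allP => w /cb; exact: weaken.
- case/allpairsP=> -[w c'] /= [ws]; rewrite IH => /and3P[sc cc cb] [-> ->].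
  rewrite sc chainlike_cons cc /= andbT; move: ws; rewrite Hspan => /andP[sw wb].
  have v0 : (hcons 'X^k 0 + w) 0 ord0 = 'X^k + w 0 ord0 by rewrite mxE hcons0.
  have sv : size ('X^k + w 0 ord0) = k.+1 by rewrite size_polyDl size_polyXn.
  have nz : 'X^k + w 0 ord0 != 0 by rewrite -size_poly_eq0 sv.
  have mon : 'X^k + w 0 ord0 \is monic.
    by rewrite monicE lead_coefDl ?size_polyXn // lead_coefXn.
  have s0 : succ0 (hcons 'X^k 0 + w).
    by rewrite -[w]hcons_htail -hconsD succ0_hcons (negPf nz).
  rewrite s0 /=; apply/and3P; split.
  + case: c' cc cb {sc} => // u c' cc /= /andP[/andP[su _] _].
    have su0 : succ0 u by move: cc; rewrite chainlike_cons => /and3P[].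
    rewrite -[w]hcons_htail -[u]hcons_htail -hconsD succv_hcons hconsD !hcons_htail s0 su0 /=.
    by rewrite (negPf nz) sv ltnS su orbT.
  + rewrite /inpbox v0 sv leqnn; move: wb; rewrite -{2}[w]hcons_htail -hconsD htail_hcons.
    by rewrite add0r.
  + by apply/allP => u /(allP cb); apply: weaken.
- have [lt|gt] := leqP (size (v 0%R ord0)) k; first by left; apply: sizes.
  right; case/and4P: H => sc; rewrite chainlike_cons => /and3P[sv vc cc] /andP[le vb] cb.
  have vk : size (v 0 ord0) = k.+1 by apply/eqP; rewrite eqn_leq le gt.
  have nz : v 0 ord0 != 0 by rewrite -size_poly_eq0 vk.
  have mon : (v 0 ord0)`_k = 1.
    move: sv; rewrite -[v]hcons_htail succ0_hcons (negPf nz) hcons0 monicE /lead_coef vk.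
    by move/eqP.
  apply/allpairsP; exists (hcons (v 0 ord0 - 'X^k) (htail v), c); split => /=.
  + rewrite Hspan /inpbox hcons0 htail_hcons vb andbT.
    by have := size_subX le; rewrite mon scale1r.
  + rewrite IH sc cc /=; apply/allP => w wc.
    have /andP[_ wb] := allP cb _ wc; rewrite /inpbox wb andbT.
    case: c vc cc {sc cb sizes} wc => // u c /succv_size[_ /(_ nz)]; rewrite vk ltnS => uk cc.
    rewrite inE => /orP[/eqP -> //|]; exact: (allP (chainlike_size cc uk)).
  + by rewrite -hconsD addrC subrK add0r hcons_htail.
Qed.

Lemma chains_lbasis r d m c : (c \in chains (@pscale r) (lbasis r d) m) =
     [&& size c == m, chainlike c & all (inbox d) c].
Proof.
elim: r m c => [|r IH] m c.
  case: m c => [|m] [|v c] //=.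
  rewrite chainlike_cons; case: (boolP (succ0 v)) => [/existsP[[]]//|_]; by rewrite !andbF.
rewrite (chains_pbasis d IH); congr [&& _, _ & _]; apply: eq_all => v.
by rewrite inbox_pbox.
Qed.

End PolyBasis.

(** * Lower bounds for lattice elements *)

Section Lattice.
Variables (R : realType) (F : finFieldType) (C : ultrametricClosedFieldType R).
Variable iota : {rmorphism {fraction {poly F}} -> C}.
Hypothesis hC : is_Cinfty iota.
Local Notation vabs := (@vabs R C).
Local Notation K := {fraction {poly F}}.
Local Notation A := {poly F}.
Local Notation q := #|F|.
Local Notation embA := (embA iota).
Local Notation theta := (theta iota).
Local Notation Kinf := (Kinf iota).
Local Notation pairing := (pairing iota).
Local Notation Omega := (Omega iota).

Definition jK : {rmorphism F -> K} := @tofrac A \o polyC.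

Local Notation fscale := (fscale jK iota).

Definition iF (c : F) : C := embA c%:P.

Lemma fscaleE c x : fscale c x = iF c * x.
Proof. by []. Qed.

Lemma embA0 : embA 0 = 0. Proof. by rewrite /Defs.embA !rmorph0. Qed.
Lemma embA1 : embA 1 = 1. Proof. by rewrite /Defs.embA !rmorph1. Qed.
Lemma embAD a b : embA (a + b) = embA a + embA b. Proof. by rewrite /Defs.embA !rmorphD. Qed.
Lemma embAM a b : embA (a * b) = embA a * embA b. Proof. by rewrite /Defs.embA !rmorphM. Qed.
Lemma embA_eq0 a : (embA a == 0) = (a == 0).
Proof. by rewrite /Defs.embA fmorph_eq0 tofrac_eq0. Qed.

Lemma embAX k : embA 'X^k = theta ^+ k.
Proof. by rewrite /Defs.theta /Defs.embA -!rmorphXn. Qed.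

Lemma embA_sum (p : A) D : (size p <= D)%N -> embA p = \sum_(k < D) iF p`_k * theta ^+ k.
Proof.
move=> sp; rewrite -[p in LHS](coefK p).
have -> : \poly_(i < size p) p`_i = \sum_(k < D) p`_k *: 'X^k.
  rewrite -poly_def; apply/polyP => i; rewrite !coef_poly.
  case: (ltnP i (size p)) => [lt|le]; first by rewrite (leq_trans lt sp).
  by rewrite nth_default // if_same.
rewrite (big_morph embA embAD embA0); apply: eq_bigr => k _.
by rewrite -mul_polyC embAM embAX.
Qed.

Lemma qR_gt1 : 1 < q%:R :> R.
Proof. by rewrite ltr1n card_field_gt1. Qed.

Lemma qR_gt0 : 0 < q%:R :> R.
Proof. exact: lt_trans ltr01 qR_gt1. Qed.

Lemma vabs_embA a : a != 0 -> vabs (embA a) = q%:R ^+ (size a).-1.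
Proof. by case: hC => H _; apply: H. Qed.

Lemma vabs_embA_ge1 a : a != 0 -> 1 <= vabs (embA a).
Proof. by move=> a0; rewrite vabs_embA // exprn_ege1 // ltW // qR_gt1. Qed.

Lemma vabs_iF c : c != 0 -> vabs (iF c) = 1.
Proof. by move=> c0; rewrite /iF vabs_embA ?polyC_eq0 // size_polyC c0 expr0. Qed.

Lemma vabs_iF_le c : vabs (iF c) <= 1.
Proof.
by have [->|/vabs_iF ->//] := eqVneq c 0; rewrite /iF polyC0 embA0 vabs0 ler01.
Qed.

Lemma vabs_theta : vabs theta = q%:R.
Proof. by rewrite /Defs.theta vabs_embA ?polyX_eq0 // size_polyX expr1. Qed.

Lemma theta_neq0 : theta != 0.
Proof. by rewrite -vabs_gt0 vabs_theta qR_gt0. Qed.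

Lemma theta_expN_small (e : R) :
  0 < e -> exists N, forall n, (N <= n)%N -> (q%:R ^+ n)^-1 < e.
Proof.
move=> e0; exists (Num.bound e^-1) => n Nn.
rewrite invf_plt ?posrE ?exprn_gt0 ?qR_gt0 //.
apply: lt_le_trans (archi_boundP _) _; first by rewrite invr_ge0 ltW.
apply: le_trans (_ : n%:R <= _); first by rewrite ler_nat.
by rewrite -natrX ler_nat ltnW // ltn_expl // card_field_gt1.
Qed.

Lemma Kinf_series (a : nat -> F) : exists2 x, Kinf x &
  vcvg (fun n => \sum_(k < n) iF (a k) * theta ^- k) x.
Proof.
have [|x Hx] := @vcauchy_cvg R C (fun n => \sum_(k < n) iF (a k) * theta ^- k).
  move=> e /theta_expN_small[N HN]; exists N => n Nn.
  rewrite -!(big_mkord predT (fun k => iF (a k) * theta ^- k)).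
  rewrite (big_cat_nat (leq0n N) Nn) /= addrAC subrr add0r.
  apply: le_lt_trans (HN N (leqnn N)).
  apply: vabs_sum_le; first by rewrite invr_ge0 exprn_ge0 // ltW // qR_gt0.
  move=> k; rewrite mem_index_iota => /andP[Nk _] _.
  rewrite vabsM vabsV vabsX vabs_theta -[leRHS]mul1r ler_pM ?vabs_ge0 ?vabs_iF_le //.
    by rewrite invr_ge0 exprn_ge0 // ltW // qR_gt0.
  by rewrite lef_pV2 ?posrE ?exprn_gt0 ?qR_gt0 // ler_weXn2l // ltW // qR_gt1.
exists x => //; exists 0%N, a; apply/vcvgP; apply: vcvg_eq Hx => n.
by rewrite /series /= big_mkord; apply: eq_bigr => k _; rewrite expr0 mulr1.
Qed.

Lemma pairingE r (f : 'rV[A]_r) z : pairing f z = \sum_i embA (f 0 i) * z 0 i.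
Proof. by []. Qed.

Lemma pairing0 r z : pairing (0 : 'rV[A]_r) z = 0.
Proof. by rewrite pairingE big1 // => i _; rewrite mxE embA0 mul0r. Qed.

Lemma pairingD r z : {morph (fun f : 'rV[A]_r => pairing f z) : f g / f + g}.
Proof.
move=> f g; rewrite !pairingE -big_split; apply: eq_bigr => i _.
by rewrite mxE embAD mulrDl.
Qed.

Lemma pairingZ r (a : A) (f : 'rV[A]_r) z : pairing (a *: f) z = embA a * pairing f z.
Proof.
by rewrite !pairingE mulr_sumr; apply: eq_bigr => i _; rewrite mxE embAM mulrA.
Qed.

Lemma pairingN r (f : 'rV[A]_r) z : pairing (- f) z = - pairing f z.
Proof. by apply: (@addrI _ (pairing f z)); rewrite -pairingD !subrr pairing0. Qed.

Lemma pairing_hcons r (a : A) (f : 'rV[A]_r) z1 z' :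
  pairing (hcons a f) (consz z1 z') = embA a * z1 + pairing f z'.
Proof.
rewrite !pairingE big_ord_recl; congr (_ + _).
  by rewrite hcons0 -[consz _ _]/(hcons z1 z') hcons0.
by apply: eq_bigr => i _; rewrite hconsS -[consz _ _]/(hcons z1 z') hconsS.
Qed.

(* If <f, z> were not bounded below by a multiple of the norm of f, a Koenig argument on the
   leading coefficients would produce a K_infty-linear relation between the z_i. *)
Section Koenig.
Variables (r : nat) (z : 'rV[C]_r).
Hypothesis hz : Omega z.

Let dot (v : 'rV[F]_r) : C := \sum_i iF (v 0 i) * z 0 i.

(** The [v k] are coefficient vectors of some [f] in order of decreasing degree, so the sum is
    [<f, z>] divided by the top power of [theta]. A good [p] is a string of leading digits
    compatible with arbitrarily small values. *)
Let Good (p : seq 'rV[F]_r) := forall d : R, 0 < d -> exists v : nat -> 'rV[F]_r, exists D,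
  [/\ v 0%N != 0, forall k, (D <= k)%N -> v k = 0,
      forall k, (k < size p)%N -> v k = nth 0 p k
    & vabs (\sum_(k < D) theta ^- k * dot (v k)) < d].

(** There are finitely many possible next digits; if each failed at some threshold, the least
    threshold would contradict [Good p]. *)
Let Good_extend p : Good p -> exists x, Good (rcons p x).
Proof.
move=> Gp; apply: contrapT => /forallNP H.
have /choice[d Hd] : forall x : 'rV[F]_r, exists d : R, 0 < d /\
    ~ exists v : nat -> 'rV[F]_r, exists D,
    [/\ v 0%N != 0, forall k, (D <= k)%N -> v k = 0,
      forall k, (k < size (rcons p x))%N -> v k = nth 0 (rcons p x) k
    & vabs (\sum_(k < D) theta ^- k * dot (v k)) < d].
  by move=> x; have /existsNP[d /not_implyP[d0 Hd]] := H x; exists d.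
have [e e0 He] : exists2 e : R, 0 < e & forall x, e <= d x.
  suff [e e0 He] : exists2 e : R, 0 < e & forall x, x \in enum 'rV[F]_r -> e <= d x.
    by exists e => // x; apply: He; rewrite mem_enum.
  elim: (enum _) => [|x s [e e0 He]]; first by exists 1.
  exists (Num.min e (d x)); first by rewrite lt_min e0; case: (Hd x).
  move=> y; rewrite inE ge_min => /orP[/eqP ->|/He -> //]; by rewrite lexx orbT.
have [v [D [v0 vD vp vs]]] := Gp _ e0.
have [_] := Hd (v (size p)); apply; exists v, D; split=> //; last exact: lt_le_trans (He _).
move=> k; rewrite size_rcons nth_rcons ltnS leq_eqVlt; case: ltnP => [lt _|_]; first exact: vp.
by rewrite orbF => /eqP ->; rewrite eqxx.
Qed.

Let dot_bound : exists2 B : R, 0 < B & forall v, vabs (dot v) <= B.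
Proof.
have [B B0 HB] : exists2 B : R, 0 < B & forall i, vabs (z 0 i) <= B.
  suff [e e0 He] : exists2 e : R, 0 < e & forall i, i \in enum 'I_r -> vabs (z 0 i) <= e.
    by exists e => // x; apply: He; rewrite mem_enum.
  elim: (enum _) => [|x s [e e0 He]]; first by exists 1.
  exists (Num.max e (vabs (z 0 x))); first by rewrite lt_max e0.
  move=> y; rewrite inE le_max => /orP[/eqP ->|/He -> //]; by rewrite lexx orbT.
exists B => // v; apply: vabs_sum_le; rewrite ?ltW // => i _ _.
by rewrite vabsM -[B]mul1r ler_pM ?vabs_ge0 ?vabs_iF_le.
Qed.

(** Repeated extension gives an infinite digit sequence [u]. The series with these digits define
    [c i] in [K_infty] with [\sum_i c i * z 0 i = 0], against independence. *)
Let not_Good_nil : ~ Good [::].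
Proof.
move=> G0.
have /choice[nx Hnx] : forall p, exists x, Good p -> Good (rcons p x).
  move=> p; have [/Good_extend[x Gx]|nG] := pselect (Good p); first by exists x.
  by exists 0.
pose pre n := iter n (fun p => rcons p (nx p)) [::].
pose u n := nx (pre n).
have Gpre n : Good (pre n) by elim: n => //= n; apply: Hnx.
have spre n : size (pre n) = n by elim: n => //= n IH; rewrite size_rcons IH.
have npre m k : (k < m)%N -> nth 0 (pre m) k = u k.
  elim: m => // m IH; rewrite ltnS leq_eqVlt /= nth_rcons spre => /orP[/eqP ->|lt].
    by rewrite ltnn eqxx.
  by rewrite lt IH.
have /choice[c Hc] : forall i, exists x, Kinf x /\
    vcvg (fun n => \sum_(k < n) iF (u k 0 i) * theta ^- k) x.
  by move=> i; have [x] := Kinf_series (fun k => u k 0 i); exists x.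
have [B B0 HB] := dot_bound.
have lim0 : vcvg (fun n => \sum_(k < n) theta ^- k * dot (u k)) 0.
  move=> e e0; have e'0 : 0 < e / B by rewrite divr_gt0.
  have [N1 HN1] := theta_expN_small e0; have [N2 HN2] := theta_expN_small e'0.
  exists (maxn N1 N2) => n; rewrite geq_max => /andP[n1 n2]; rewrite subr0.
  have [|v [D [v0 vD vp vs]]] := Gpre n (q%:R ^+ n)^-1.
    by rewrite invr_gt0 exprn_gt0 // qR_gt0.
  have vu k : (k < n)%N -> v k = u k by move=> lt; rewrite vp ?spre // npre.
  pose g k := theta ^- k * dot (v k).
  have E : \sum_(k < D) g k = \sum_(k < maxn n D) g k.
    rewrite (big_ord_widen (maxn n D) g) ?leq_maxr // big_mkcond; apply: eq_bigr => k _.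
    case: ltnP => // /vD vk0; rewrite /g vk0 /dot big1 ?mulr0 // => i _.
    by rewrite mxE /iF polyC0 embA0 mul0r.
  have -> : \sum_(k < n) theta ^- k * dot (u k) =
     \sum_(k < D) g k - \sum_(n <= k < maxn n D) g k.
    rewrite E -[X in _ = X - _](big_mkord predT) (big_cat_nat (leq0n n) (leq_maxl n D)) /= addrK.
    by rewrite big_mkord; apply: eq_bigr => k _; rewrite /g vu.
  apply: vabsD_lt; first by apply: lt_trans vs (HN1 _ n1).
  rewrite vabsN; apply: le_lt_trans (_ : (q%:R ^+ n)^-1 * B < e); last first.
    by rewrite -ltr_pdivlMr // HN2.
  have qn0 m : 0 < (q%:R ^+ m)^-1 :> R by rewrite invr_gt0 exprn_gt0 // qR_gt0.
  apply: vabs_sum_le; first by rewrite mulr_ge0 // ltW.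
  move=> k; rewrite mem_index_iota => /andP[nk _] _.
  rewrite /g vabsM vabsV vabsX vabs_theta ler_pM ?HB ?vabs_ge0 ?(ltW (qn0 _)) //.
  by rewrite lef_pV2 ?posrE ?exprn_gt0 ?qR_gt0 // ler_weXn2l // ltW // qR_gt1.
have lim1 : vcvg (fun n => \sum_(k < n) theta ^- k * dot (u k)) (\sum_i c i * z 0 i).
  apply: (@vcvg_eq _ _ (fun n => \sum_i (\sum_(k < n) iF (u k 0 i) * theta ^- k) * z 0 i)).
    move=> n; under eq_bigr do rewrite mulr_suml.
    rewrite exchange_big /=; apply: eq_bigr => k _; rewrite /dot mulr_sumr.
    by apply: eq_bigr => i _; rewrite mulrAC mulrC.
  by apply: vcvg_sum_ord => i; apply: vcvgM; [case: (Hc i)|exact: vcvg_cst].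
have [hind _] := hz.
have c0 : \row_i c i = 0.
  apply: hind; first by move=> i; rewrite mxE; case: (Hc i).
  transitivity (\sum_i c i * z 0 i); last exact: vcvg_unique lim1 lim0.
  by apply: eq_bigr => i _; rewrite mxE.
(* The relation is nontrivial: the leading digit vector [u 0] is nonzero, and in each coordinate the
   remaining digits contribute at most [1 / q]. *)
have [|v [D [v0 _ vp _]]] := Gpre 1%N 1; first exact: ltr01.
have u0 : u 0%N != 0 by rewrite -(npre 1%N) // -vp.
have [i ui0] : exists i, u 0%N 0 i != 0.
  apply: contrapT => /forallNP H; case/negP: u0; apply/eqP/rowP => i.
  by rewrite mxE; apply/eqP/negP => /negP/H.
have ci0 : c i = 0 by have := congr1 (fun w : 'rV[C]_r => w 0 i) c0; rewrite !mxE.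
have : vabs (c i - iF (u 0%N 0 i)) < 1.
  have [_ Hci] := Hc i; have [N HN] := theta_expN_small ltr01.
  have q1 : (q%:R ^+ 1)^-1 < 1 :> R by rewrite invf_lt1 ?expr1 ?qR_gt0 ?qR_gt1.
  apply: le_lt_trans q1;
    apply: (@vcvg_le _ _ (fun n => \sum_(k < n) iF (u k 0 i) * theta ^- k - iF (u 0%N 0 i))).
    by apply: vcvgB Hci (vcvg_cst _).
  exists 1%N => -[//|n] _; rewrite big_ord_recl /= expr0 invr1 mulr1 addrAC subrr add0r.
  apply: vabs_sum_le; first by rewrite invr_ge0 exprn_ge0 // ltW // qR_gt0.
  move=> k _ _; rewrite vabsM vabsV vabsX vabs_theta -[leRHS]mul1r ler_pM ?vabs_ge0 ?vabs_iF_le //.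
    by rewrite invr_ge0 exprn_ge0 // ltW // qR_gt0.
  by rewrite lef_pV2 ?posrE ?exprn_gt0 ?qR_gt0 // ler_weXn2l // ltW // qR_gt1.
by rewrite ci0 sub0r vabsN vabs_iF // ltxx.
Qed.

Lemma lattice_bound : exists2 d : R, 0 < d &
  forall (f : 'rV[A]_r) i, f 0 i != 0 ->
    d * q%:R ^+ (size (f 0%R i)).-1 <= vabs (pairing f z).
Proof.
apply: contrapT => H; apply: not_Good_nil => d d0.
have [f [i [fi0 Hf]]] : exists f : 'rV[A]_r, exists i, f 0 i != 0 /\
    vabs (pairing f z) < d * q%:R ^+ (size (f 0%R i)).-1.
  apply: contrapT => H'; apply: H; exists d => // f i fi0.
  by rewrite leNgt; apply/negP => lt; apply: H'; exists f, i.
(* Digits are read from the largest size [D] downwards; a coordinate attaining [D] makes [v 0]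
   nonzero, and passing from the size of coordinate [i] to [D] only weakens the bound. *)
pose D := \max_j size (f 0%R j).
have sD j : (size (f 0%R j) <= D)%N by apply: leq_bigmax.
have D0 : (0 < D)%N by apply: leq_trans (sD i); rewrite lt0n size_poly_eq0.
pose v k : 'rV[F]_r := \row_j (if (k < D)%N then (f 0 j)`_(D.-1 - k) else 0).
have E : pairing f z = theta ^+ D.-1 * \sum_(k < D) theta ^- k * dot (v k).
  rewrite pairingE; under eq_bigr do rewrite (embA_sum (sD _)) mulr_suml.
  rewrite exchange_big /= (reindex_inj rev_ord_inj) /= mulr_sumr.
  apply: eq_bigr => k _; rewrite mulrA /dot mulr_sumr; apply: eq_bigr => j _.
  have -> : (D - k.+1 = D.-1 - k)%N by rewrite -subn1 subnAC subn1 -subnS.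
  rewrite mxE ltn_ord mulrA [iF _ * _]mulrC; congr (_ * _ * _).
  have kD : (k <= D.-1)%N by rewrite -ltnS prednK.
  by rewrite -{2}(subnK kD) exprD mulfK // expf_neq0 // theta_neq0.
exists v, D; split=> //.
- have [j Dj] : exists j, size (f 0%R j) = D.
    have r0 : (0 < #|{: 'I_r}|)%N by apply/card_gt0P; exists i.
    by have [j Dj] := @bigop.eq_bigmax _ (fun j : 'I_r => size (f 0%R j)) r0; exists j.
  apply/eqP => /rowP/(_ j); rewrite !mxE D0 subn0 -Dj => /eqP.
  by rewrite -/(lead_coef _) lead_coef_eq0 -size_poly_eq0 Dj; case: (D) D0.
- by move=> k Dk; apply/rowP => j; rewrite !mxE ltnNge Dk.
- have qD : 0 < q%:R ^+ D.-1 :> R by rewrite exprn_gt0 // qR_gt0.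
  rewrite -(ltr_pM2l qD) -vabs_theta -vabsX -vabsM -E mulrC vabsX vabs_theta.
  apply: lt_le_trans Hf _; rewrite ler_pM2l // ler_weXn2l ?(ltW qR_gt1) //.
  by rewrite -!subn1 leq_sub2r.
Qed.

End Koenig.
End Lattice.

(** * Eisenstein series and the exponential as limits of finite levels *)

Section LatticeLimits.
Variables (R : realType) (F : finFieldType) (C : ultrametricClosedFieldType R).
Variable iota : {rmorphism {fraction {poly F}} -> C}.
Hypothesis hC : is_Cinfty iota.
Local Notation vabs := (@vabs R C).
Local Notation A := {poly F}.
Local Notation q := #|F|.
Local Notation embA := (embA iota).
Local Notation theta := (theta iota).
Local Notation pairing := (pairing iota).
Local Notation Omega := (Omega iota).
Local Notation fscale := (fscale (jK F) iota).
Local Notation fspan := (span fscale).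
Local Notation iF := (iF iota).
Local Notation MS := (MS (jK F) iota).
Local Notation epol := (@epol F C).

Definition lat r (z : 'rV[C]_r) d : seq C := [seq pairing f z | f <- lbasis F r d].

Variables (r : nat) (z : 'rV[C]_r).
Hypothesis hz : Omega z.

Lemma pairing_eq0 (f : 'rV[A]_r) : (pairing f z == 0) = (f == 0).
Proof.
apply/eqP/eqP => [f0|->]; last exact: pairing0.
have [d d0 Hd] := lattice_bound hC hz.
apply/rowP => i; rewrite mxE; apply/eqP; apply: contraT => fi0.
by have := Hd _ _ fi0; rewrite f0 vabs0 leNgt mulr_gt0 ?exprn_gt0 ?qR_gt0.
Qed.

Lemma pairing_inj : injective (fun f : 'rV[A]_r => pairing f z).
Proof.
move=> f g E; apply/eqP; rewrite -subr_eq0 -pairing_eq0 pairingD pairingN E subrr //.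
Qed.

Lemma fspan_lat d : fspan (lat z d) = [seq pairing f z | f <- span (@pscale F r) (lbasis F r d)].
Proof.
apply: span_map; [exact: pairing0|exact: pairingD|].
by move=> c v; rewrite /pscale pairingZ.
Qed.

Lemma fspan_lat_uniq d : uniq (fspan (lat z d)).
Proof. by rewrite fspan_lat map_inj_uniq; [case: (span_lbasis F r d)|exact: pairing_inj]. Qed.

Lemma mem_fspan_lat d x :
  reflect (exists2 f : 'rV[A]_r, inbox d f & x = pairing f z) (x \in fspan (lat z d)).
Proof.
have [_ M] := span_lbasis F r d; rewrite fspan_lat.
by apply: (iffP mapP) => -[f fb ->]; exists f; rewrite // -?M // M.
Qed.

Lemma inbox_leq d d' (f : 'rV[A]_r) : (d <= d')%N -> inbox d f -> inbox d' f.
Proof. by move=> dd' /forallP H; apply/forallP => i; apply: leq_trans dd'. Qed.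

Lemma inbox_ex (f : 'rV[A]_r) : exists d, inbox d f.
Proof.
exists (\max_j size (f 0%R j)); apply/forallP => j.
exact: (leq_bigmax j).
Qed.

(** The estimate behind both limits: inverses of nonzero lattice elements are bounded, and those
    from outside box [d] decay like [q^-d]. *)
Lemma outbox_bound : exists2 m : R, 1 <= m & forall f : 'rV[A]_r,
  (f != 0 -> (vabs (pairing f z))^-1 <= m) /\
  (forall d, ~~ inbox d f -> (vabs (pairing f z))^-1 <= m * (q%:R ^+ d)^-1).
Proof.
have [d d0 Hd] := lattice_bound hC hz.
have q0 k : 0 < q%:R ^+ k :> R by rewrite exprn_gt0 // qR_gt0.
exists (Num.max 1 d^-1); first by rewrite le_max lexx.
move=> f; split=> [f0|k].
  have [i fi] : exists i, f 0 i != 0.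
    apply: contrapT => /forallNP H; case/negP: f0; apply/eqP/rowP => i.
    by rewrite mxE; apply/eqP/negP => /negP/H.
  rewrite le_max; apply/orP; right; rewrite lef_pV2 ?posrE //.
    apply: le_trans (Hd _ _ fi); rewrite -[leLHS]mulr1 ler_pM2l // exprn_ege1 //.
    by rewrite ltW // qR_gt1.
  by apply: lt_le_trans (Hd _ _ fi); rewrite mulr_gt0.
rewrite negb_forall => /existsP[i]; rewrite -ltnNge => ki.
have fi : f 0 i != 0 by rewrite -size_poly_eq0 -lt0n (leq_trans _ ki).
apply: (@le_trans _ _ (d^-1 * (q%:R ^+ k)^-1)); last first.
  by rewrite ler_pM2r ?invr_gt0 // le_max lexx orbT.
rewrite -invfM lef_pV2 ?posrE ?mulr_gt0 //.
  rewrite mulrC; apply: le_trans (Hd _ _ fi);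
    rewrite mulrC ler_pM2l // ler_weXn2l ?(ltW (qR_gt1 _ _)) //.
  by rewrite -ltnS (leq_trans ki) // leqSpred.
by apply: lt_le_trans (Hd _ _ fi); rewrite mulr_gt0.
Qed.

Lemma succ0_neq0 (f : 'rV[A]_r) : succ0 f -> f != 0.
Proof.
case/existsP=> i /andP[/andP[fi _] _]; apply: contraNneq fi => ->.
by rewrite mxE.
Qed.

(** The boxes exhaust the chains. A chain leaving box [N] has an entry outside it, which supplies a
    factor [q^-N] because its exponent is positive; all other factors are bounded by powers of
    [m]. *)
Lemma Eis_vcvg s : is_index s -> vcvg (fun d => MS (lat z d) s) (Eis iota s z).
Proof.
move=> ps; pose V := 'rV[A]_r; pose T := (size s).-tuple V.
pose cs d : seq (seq V) := chains (@pscale F r) (lbasis F r d) (size s).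
pose L d : seq T := pmap insub (cs d).
have csP d c : (c \in cs d) = [&& size c == size s, chainlike c & all (inbox d) c].
  exact: chains_lbasis.
have LP d (t : T) : (t \in L d) = chainlike t && all (inbox d) t.
  by rewrite mem_pmap_sub csP size_tuple eqxx.
pose G (c : seq V) : C := \prod_(i < size s) pairing (nth 0 c i) z ^- nth 0%N s i.
have -> : Eis iota s z = usum [set f : T | sorted (@succv F r) f && all (@succ0 F r) f]
    (fun t => G (val t)).
  rewrite /Eis /G; congr usum; apply/funext => t; apply: eq_bigr => i _.
  by rewrite (tnth_nth 0).
have [U _] := span_lbasis F r 0.
apply: (@vcvg_eq _ _ (fun d => \sum_(t <- L d) G (val t))).
  move=> d; rewrite -chains_MS -(big_map val predT G).
  have -> : map val (L d) = cs d.
    rewrite /L pmap_filter; last exact: insubK.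
    apply/all_filterP/allP => c; rewrite csP => /and3P[sc _ _] /=.
    by rewrite insubT.
  rewrite /lat (@chains_map _ _ _ (@pscale F r) fscale (fun f => pairing f z)).
  - rewrite big_map; apply: eq_big_seq => c; rewrite csP => /and3P[/eqP sc _ _].
    by apply: eq_bigr => i _; rewrite (nth_map 0) // sc.
  - exact: pairing0.
  - exact: pairingD.
  - by move=> c v; rewrite /pscale pairingZ.
apply: usum_vcvg.
- move=> d; apply: pmap_sub_uniq; apply: chains_uniq; [exact: pscale0|exact: pscale1|].
  by case: (span_lbasis F r d).
- by move=> d t; rewrite LP => /andP[].
- move=> d d' dd' t; rewrite !LP => /andP[-> /= tb]; apply: sub_all tb => v.
  exact: inbox_leq.
- move=> t Dt.
  suff [d Hd] : exists d, all (inbox d) t by exists d; rewrite LP Hd andbT; exact: Dt.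
  elim: (tval t) => [|v c [d Hd]]; first by exists 0%N.
  have [d' Hd'] := inbox_ex v; exists (maxn d d') => /=.
  rewrite (inbox_leq (leq_maxr _ _) Hd') /=; apply: sub_all Hd => w.
  by apply: inbox_leq; rewrite leq_maxl.
- move=> e e0; have [m m1 Hm] := outbox_bound.
  have m0 : 0 < m by apply: lt_le_trans m1.
  have e'0 : 0 < e / m ^+ sumn s by rewrite divr_gt0 // exprn_gt0.
  have [N HN] := theta_expN_small F e'0; exists N => t Dt tL.
  have {tL} : ~~ all (inbox N) t by move: tL; rewrite LP (Dt : chainlike t).
  rewrite -has_predC => /hasP[v vt vb].
  have [i0 vi0] : exists i0, v = tnth t i0 by apply/tnthP.
  rewrite {}vi0 (tnth_nth 0) in vb.
  have nz (i : 'I_(size s)) : nth 0 t i != 0.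
    move/andP: Dt => [_ /allP H]; apply: succ0_neq0; apply: H.
    by rewrite mem_nth // size_tuple.
  rewrite /G vabs_prod; apply: (@le_lt_trans _ _ (m ^+ sumn s * (q%:R ^+ N)^-1)); last first.
    by rewrite mulrC -ltr_pdivlMr ?exprn_gt0 // HN.
  have -> : m ^+ sumn s = \prod_(i < size s) m ^+ nth 0%N s i.
    rewrite -(big_mkord predT (fun i => m ^+ nth 0%N s i)) -(big_nth 0%N predT (fun k => m ^+ k)).
    by elim: (s) => [|k s' IH] /=; rewrite ?big_nil // big_cons exprD IH.
  rewrite (bigD1 i0) //= [X in _ <= X * _](bigD1 i0) //= mulrAC.
  have qN : (q%:R ^+ N)^-1 <= 1 :> R.
    by rewrite invf_le1 ?exprn_gt0 ?qR_gt0 // exprn_ege1 // ltW // qR_gt1.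
  have qN0 : 0 <= (q%:R ^+ N)^-1 :> R by rewrite invr_ge0 exprn_ge0 // ltW // qR_gt0.
  apply: ler_pM; rewrite ?vabs_ge0 //.
  + by apply: prodr_ge0 => i _; rewrite vabs_ge0.
  + rewrite vabsV vabsX -[(vabs _ ^+ _)^-1]exprVn.
    have /= si0 := allP ps _ (mem_nth 0%N (ltn_ord i0)).
    apply: (@le_trans _ _ ((m * (q%:R ^+ N)^-1) ^+ nth 0%N s i0)).
      apply: lerXn2r; rewrite ?nnegrE; first by rewrite invr_ge0 vabs_ge0.
        by rewrite mulr_ge0 // ltW.
      by have [_] := Hm (nth 0 t i0); apply.
    rewrite exprMn ler_pM2l ?exprn_gt0 //.
    by rewrite -[leRHS]expr1; apply: ler_wiXn2l.
  + apply: ler_prod => i _; rewrite vabsV vabsX -[(vabs _ ^+ _)^-1]exprVn /=.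
    rewrite exprn_ge0 ?invr_ge0 ?vabs_ge0 //=; apply: lerXn2r;
      rewrite ?nnegrE ?invr_ge0 ?vabs_ge0 ?(ltW m0) //.
    by have [/(_ (nz i))] := Hm (nth 0 t i).
Qed.

Lemma epol_hornerE bs x : uniq (fspan bs) ->
  (epol bs).[x] = x * \prod_(w <- fspan bs | w != 0) (1 + x / w).
Proof.
move=> U; rewrite (epol_prod U) hornerM hornerX horner_prod; congr (_ * _).
by apply: eq_bigr => w _; rewrite !hornerE mulrC.
Qed.

Lemma expL_vcvg X : vcvg (fun d => (epol (lat z d)).[X]) (expL (Lambda iota z) X).
Proof.
pose L d := [seq w <- fspan (lat z d) | w != 0].
apply: (@vcvg_eq _ _ (fun d => X * \prod_(w <- L d) (1 - X / w))).
  move=> d; have U := fspan_lat_uniq d; rewrite epol_hornerE //; congr (_ * _).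
  (* [expL] has factors [1 - X / l] and [epol] has [1 + X / w]; the span is stable under
     negation. *)
  have p := fspan_perm U oppr_inj (fun v => @fspanN _ _ _ _ _ _ v).
  rewrite -(perm_big _ p) big_map big_filter /=.
  by apply: eq_big => [w|w _]; rewrite ?oppr_eq0 // invrN mulrN.
apply: vcvgZ; apply: uprod_vcvg.
- by move=> d; rewrite filter_uniq // fspan_lat_uniq.
- move=> d w; rewrite mem_filter => /andP[w0 /mem_fspan_lat[f _ E]].
  by split; [exists f|apply/eqP].
- move=> d d' dd' w; rewrite !mem_filter => /andP[-> /mem_fspan_lat[f fb ->]] /=.
  by apply/mem_fspan_lat; exists f => //; apply: inbox_leq fb.
- move=> w [[f _ <-] /eqP w0]; have [d fb] := inbox_ex f; exists d.
  by rewrite mem_filter w0; apply/mem_fspan_lat; exists f.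
- move=> e e0; have [m m1 Hm] := outbox_bound.
  have m0 : 0 < m by apply: lt_le_trans m1.
  pose b := Num.max 1 (vabs X); have b0 : 0 < b by rewrite lt_max ltr01.
  have e'0 : 0 < e / (b * m) by rewrite divr_gt0 // mulr_gt0.
  have [N HN] := theta_expN_small F e'0; exists N => w [[f _ <-] /eqP w0].
  rewrite mem_filter w0 /= => wL.
  have fb : ~~ inbox N f by apply: contra wL => fb; apply/mem_fspan_lat; exists f.
  rewrite addrAC subrr add0r vabsN vabsM vabsV.
  apply: (@le_lt_trans _ _ (b * (m * (q%:R ^+ N)^-1))); last first.
    by rewrite mulrA mulrC -ltr_pdivlMr ?mulr_gt0 // HN.
  apply: ler_pM; rewrite ?vabs_ge0 ?invr_ge0 ?vabs_ge0 //.
    by rewrite le_max lexx orbT.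
  by have [_] := Hm f; apply.
Qed.

Definition zseq : seq C := [seq z 0 i | i <- enum 'I_r].

Lemma size_zseq : size zseq = r.
Proof. by rewrite size_map; apply: size_enum_ord. Qed.

(** A vector [f] of size at most [d + 1] splits as its constant terms plus [X] times a vector of
    size at most [d]. This gives the inclusion, and counting gives equality. *)
Lemma lat_succ_perm d :
  perm_eq (fspan (lat z d.+1)) (fspan (zseq ++ [seq theta * b | b <- lat z d])).
Proof.
have sub : {subset fspan (lat z d.+1) <= fspan (zseq ++ [seq theta * b | b <- lat z d])}.
  move=> x /mem_fspan_lat[f /forallP fb ->].
  pose g : 'rV[A]_r := \row_i \poly_(k < d) (f 0 i)`_k.+1.
  have -> : pairing f z = \sum_(i <- enum 'I_r) fscale (f 0 i)`_0 (z 0 i) + theta * pairing g z.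
    rewrite !pairingE mulr_sumr big_enum -big_split /=; apply: eq_bigr => i _.
    rewrite fscaleE mulrA -mulrDl; congr (_ * _).
    rewrite /Defs.theta -embAM /(iF _) -embAD; congr embA.
    rewrite mxE; apply/polyP => k; rewrite coefD coefC coefXM coef_poly.
    case: k => [|k] /=; first by rewrite addr0.
    rewrite add0r; case: ltnP => // dk; rewrite nth_default //.
    exact: leq_trans (fb i) _.
  apply: fspanD.
    apply: fspan_catl; rewrite /zseq; elim: (enum _) => [|i s IH];
      first by rewrite big_nil mem_seq1.
    by rewrite big_cons; apply/fspan_consP;
      exists (f 0 i)`_0, (\sum_(j <- s) fscale (f 0 j)`_0 (z 0 j)).
  apply: fspan_catr.
  rewrite (@span_map _ _ _ fscale fscale (fun x => theta * x)).
  - apply: map_f; apply/mem_fspan_lat; exists g => //.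
    by apply/forallP => i; rewrite mxE size_poly.
  - by rewrite mulr0.
  - by move=> u v; rewrite mulrDr.
  - by move=> c v; rewrite !fscaleE mulrCA.
have sz : (size (fspan (zseq ++ [seq (theta * b)%R | b <- lat z d])) <= size (fspan (lat z d.+1)))%N.
  have szl n : size (lbasis F n d.+1) = (n + size (lbasis F n d))%N.
    have szx k : size (xbasis F k) = k by elim: k => //= k ->.
    by elim: n => //= n IH; rewrite !size_cat !size_map IH /= !szx; lia.
  by rewrite !size_fspan size_cat size_zseq !size_map szl.
have U := fspan_lat_uniq d.+1.
have [_ E] := uniq_min_size U sub sz.
by apply: uniq_perm E => //; apply: leq_size_uniq sub sz.
Qed.

(* A basis of the theta-torsion, at finite level and multiplied by theta. *)
Definition tors d : seq C := [seq (epol [seq theta * b | b <- lat z d]).[x] | x <- zseq].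

Lemma size_tors d : size (tors d) = r.
Proof. by rewrite size_map size_zseq. Qed.

Lemma tors_uniq d : uniq (fspan (tors d)).
Proof.
apply: fspan_map_epol_uniq; rewrite -(perm_uniq (lat_succ_perm d)).
exact: fspan_lat_uniq.
Qed.

Lemma lat_functional d :
  epol (lat z d.+1) \Po (theta *: 'X) = epol (tors d) \Po (theta *: epol (lat z d)).
Proof.
apply: (@epol_functional _ _ _ (jK F) iota).
- exact: theta_neq0.
- exact: fspan_lat_uniq.
- exact: lat_succ_perm.
Qed.

End LatticeLimits.

(** * Isolated points *)

Lemma fraction_numden (D : idomainType) (x : {fraction D}) :
  exists n d : D, d != 0 /\ tofrac d * x = tofrac n.
Proof.
elim/quotW: x => f; exists (frac f).1, (frac f).2; split; first exact: denom_ratioP.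
rewrite /GRing.mul /= !piE; apply/eqmodP; rewrite /= /FracField.equivf /= /FracField.mulf.
by rewrite !numden_Ratio ?(oner_eq0, mulf_neq0, denom_ratioP) // mulr1 mul1r.
Qed.

Lemma common_denominator (D : idomainType) n (x : 'I_n -> {fraction D}) :
  exists d : D, d != 0 /\ forall i, exists c : D, tofrac d * x i = tofrac c.
Proof.
elim: n x => [|n IH] x; first by exists 1; split; [exact: oner_neq0|case].
have [d [d0 Hd]] := IH (fun i => x (lift ord0 i)).
have [a [b [b0 Hb]]] := fraction_numden (x ord0).
exists (b * d); split=> [|i]; first exact: mulf_neq0.
case: (unliftP ord0 i) => [j ->|->].
  by have [c Hc] := Hd j; exists (b * c); rewrite !tofracM -mulrA Hc.
by exists (d * a); rewrite !tofracM mulrAC Hb mulrC.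
Qed.

Lemma fraction_rows_dependent (D : idomainType) n (f : 'I_n.+1 -> 'rV[D]_n) :
  exists c : 'I_n.+1 -> D, (exists i, c i != 0) /\ \sum_i c i *: f i = 0.
Proof.
pose M : 'M[{fraction D}]_(n.+1, n) := \matrix_(i, j) tofrac (f i 0 j).
have kM : kermx M != 0.
  rewrite kermx_eq0 /row_free; apply/negP => /eqP rk.
  by have := rank_leq_col M; rewrite rk ltnn.
have [i ki] : exists i, row i (kermx M) != 0.
  by apply/existsP; rewrite -negb_forall; apply: contra kM => /forallP H;
    apply/eqP/row_matrixP => i; rewrite row0; apply/eqP.
set y := row i (kermx M) in ki.
have yM : y *m M = 0 by apply/sub_kermxP; rewrite row_sub.
have [d [d0 Hd]] := common_denominator (fun j => y 0 j).
have /choice[c Hc] := Hd; exists c; split.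
  have [j yj] : exists j, y 0 j != 0.
    apply: contrapT => /forallNP H; case/negP: ki; apply/eqP/rowP => j.
    by rewrite [RHS]mxE; apply/eqP/negP => /negP/H.
  by exists j; rewrite -tofrac_eq0 -Hc mulf_neq0 // tofrac_eq0.
apply/rowP => k; apply/eqP; rewrite summxE mxE -tofrac_eq0 rmorph_sum /=.
have E : tofrac d * \sum_j y 0 j * M j k = 0.
  have := congr1 (fun v : 'rV_n => v 0 k) yM; rewrite mxE [RHS]mxE => ->; exact: mulr0.
rewrite -[X in _ == X]E mulr_sumr; apply/eqP; apply: eq_bigr => j _.
have -> : (c j *: f j) 0 k = c j * f j 0 k by rewrite mxE.
by rewrite [M j k]mxE tofracM -Hc mulrA.
Qed.

Section IsolatedPoints.
Variables (R : realType) (F : finFieldType) (C : ultrametricClosedFieldType R).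
Variable iota : {rmorphism {fraction {poly F}} -> C}.
Hypothesis hC : is_Cinfty iota.
Local Notation vabs := (@vabs R C).
Local Notation A := {poly F}.
Local Notation q := #|F|.
Local Notation embA := (embA iota).
Local Notation theta := (theta iota).
Local Notation pairing := (pairing iota).
Local Notation Omega := (Omega iota).
Local Notation fspan := (span (fscale (jK F) iota)).
Local Notation epol := (@epol F C).
Local Notation lat := (lat iota).

(** Equivalently, [|X|] is not the absolute value of any [K]-combination of the [z_i]; writing [a]
    on the left clears denominators and makes stability under scaling evident. *)
Definition iso r (z : 'rV[C]_r) (X : C) : Prop :=
  forall (a : A) (f : 'rV[A]_r), a != 0 -> vabs (embA a * X) != vabs (pairing f z).

Lemma iso_scale r (z : 'rV[C]_r) X a : a != 0 -> iso z X -> iso z (embA a * X).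
Proof.
by move=> a0 isoX b f b0; rewrite mulrA -embAM; apply: isoX; rewrite mulf_neq0.
Qed.

Lemma iso_neq r (z : 'rV[C]_r) X f : iso z X -> vabs X != vabs (pairing f z).
Proof. by move=> /(_ 1 f (oner_neq0 _)); rewrite embA1 mul1r. Qed.

Lemma iso_neq0 r (z : 'rV[C]_r) X : iso z X -> X != 0.
Proof. by move=> /(iso_neq 0); rewrite pairing0 vabs0 vabs_eq0. Qed.

Lemma sum_distinct_vabs n (v : 'I_n -> C) :
  (forall i j, v i != 0 -> vabs (v i) = vabs (v j) -> i = j) ->
  \sum_i v i = 0 -> forall i, v i = 0.
Proof.
move=> dist s0 i; apply/eqP; apply: contraT => vi0.
have [j _ Hj] := @arg_maxP _ _ _ i predT (fun k => vabs (v k)) isT.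
have {}Hj k : vabs (v k) <= vabs (v j) := Hj k isT.
have vj0 : v j != 0 by rewrite -vabs_gt0 (lt_le_trans _ (Hj i)) // vabs_gt0.
move: s0; rewrite (bigD1 j) //= addrC => s0.
have : vabs (\sum_(k | k != j) v k) < vabs (v j).
  apply: vabs_sum_lt; rewrite ?vabs_gt0 // => k _ kj.
  rewrite lt_neqAle Hj // andbT; apply: contra_neq kj => E.
  by apply/esym/(dist j k).
by move/vabsD_eq; rewrite s0 vabs0 => /esym/eqP; rewrite vabs_eq0 (negPf vj0).
Qed.

(* Otherwise the powers x^j, j <= r, of an (r + 1)-st root x of theta would give r + 1
   lattice elements with absolute values in distinct classes modulo that of K, which is
   impossible since r + 1 elements of A^r are linearly dependent. *)
Lemma iso_exists r (z : 'rV[C]_r) : exists X, iso z X.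
Proof.
have [x] : exists x, root ('X^(r.+1) - theta%:P) x.
  by apply/closed_rootP; rewrite size_XnsubC.
rewrite /root !hornerE subr_eq0 => /eqP xr.
have q0 : 0 < q%:R :> R := qR_gt0 _ _.
have vx : vabs x ^+ r.+1 = q%:R by rewrite -vabsX xr vabs_theta.
apply: contrapT => /forallNP H.
have /choice[a Ha] : forall j : 'I_r.+1, exists a : A, exists f : 'rV[A]_r, a != 0 /\
    vabs (embA a * x ^+ j) = vabs (pairing f z).
  move=> j; apply: contrapT => nH; apply: (H (x ^+ j)) => a f a0.
  by apply/negP => /eqP E; apply: nH; exists a, f.
have /choice[f Hf] := Ha.
have [c [[i ci0] cf]] := fraction_rows_dependent f.
have a0 j : a j != 0 by have [] := Hf j.
have E j : vabs (pairing (c j *: f j) z) = vabs (embA (c j * a j)) * vabs x ^+ j.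
  have [_ Ej] := Hf j.
  by rewrite pairingZ vabsM -Ej embAM !vabsM vabsX mulrA.
have x0 : 0 < vabs x.
  rewrite vabs_gt0; apply/eqP => x0; move: xr; rewrite x0 expr0n => /esym/eqP.
  by rewrite (negPf (theta_neq0 hC)).
have s0 : \sum_j pairing (c j *: f j) z = 0.
  by rewrite -(big_morph (fun f => pairing f z) (pairingD iota z) (pairing0 iota z)) cf pairing0.
have := sum_distinct_vabs _ s0 => /(_ _ i) H0.
have : vabs (pairing (c i *: f i) z) != 0.
  rewrite E mulf_neq0 ?expf_neq0 ?gt_eqF // vabs_gt0 embA_eq0 mulf_neq0 //.
rewrite H0 ?vabs0 ?eqxx // => j k vj Ejk.
have cj0 : c j != 0 by apply: contraNneq vj => ->; rewrite scale0r pairing0.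
have ck0 : c k != 0.
  apply: contraNneq vj => ck; move: Ejk; rewrite ck scale0r pairing0 vabs0 => /eqP.
  by rewrite vabs_eq0.
move: Ejk; rewrite !E !(vabs_embA hC) ?mulf_neq0 //.
set m := (size _).-1; set m' := (size _).-1.
(* The [(r + 1)]-st power of [|c_j a_j x^j|] is [q] to the exponent [m (r + 1) + j], and [j] is the
   residue of this exponent modulo [r + 1]. *)
have pw n (l : nat) : (q%:R ^+ n * vabs x ^+ l) ^+ r.+1 = (q ^ (n * r.+1 + l))%:R.
  by rewrite exprMn -!exprM [(l * _)%N]mulnC [vabs x ^+ _]exprM vx -exprD natrX.
move/(congr1 (fun y => y ^+ r.+1)); rewrite !pw => /eqP.
rewrite eqr_nat eqn_exp2l ?card_field_gt1 // => /eqP/(congr1 (modn^~ r.+1)).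
by rewrite !modnMDl !modn_small // => /val_inj.
Qed.

Lemma Kinf_approx x : Kinf iota x -> forall e : R, 0 < e -> exists y, vabs (x - iota y) < e.
Proof.
case=> D [a /vcvgP Hx] e e0; have [N HN] := Hx _ e0.
exists (\sum_(k < N) tofrac (a k)%:P * tofrac 'X ^+ D * tofrac 'X ^- k).
have := HN N (leqnn N); rewrite vabsB; congr (vabs (x - _) < e).
rewrite /series /= big_mkord rmorph_sum; apply: eq_bigr => k _.
by rewrite !rmorphM fmorphV !rmorphXn.
Qed.

(* The absolute values of [Kinf]-combinations of [z] are those of [A]-combinations up to
   the norm of a common denominator, so the defining property of [iso] extends to [Kinf]. *)
Lemma Omega_consz r (z : 'rV[C]_r) X : (0 < r)%N -> Omega z -> iso z X -> Omega (consz X z).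
Proof.
move=> r0 [zind z1] isoX; split; last first.
  move=> i; case: (unliftP ord0 i) => [j ->|->] /=.
    by rewrite -[consz _ _]/(hcons X z) hconsS /bump /= add1n => -[/z1].
  by case => E; rewrite -E in r0.
move=> c cK; rewrite big_ord_recl -[consz _ _]/(hcons X z) hcons0.
under eq_bigr do rewrite hconsS.
have [c00|c00] := eqVneq (c 0 ord0) 0.
  rewrite c00 mul0r add0r => s0.
  have tc : htail c = 0.
    apply: zind; first by move=> k; rewrite mxE.
    by rewrite -[RHS]s0; apply: eq_bigr => k _; rewrite mxE.
  apply/rowP => i; rewrite [RHS]mxE; case: (unliftP ord0 i) => [j ->|-> //].
  by have := congr1 (fun v : 'rV[C]_r => v 0 j) tc; rewrite !mxE.
move=> s0; pose S := c 0 ord0 * X.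
have S0 : S != 0 by rewrite mulf_neq0 // (iso_neq0 isoX).
have SE : \sum_i c 0 (lift ord0 i) * z 0 i = - S.
  by apply/eqP; rewrite -subr_eq0 opprK addrC s0.
(* The approximations in [K] are close enough to preserve both [|c_0|] and the absolute value of the
   combination of the [z_i]; a common denominator then contradicts [iso]. *)
have /choice[y Hy] : forall i : 'I_r.+1, exists y, vabs (c 0 i - iota y) < vabs (c 0 ord0) /\
    (forall j, i = lift ord0 j -> vabs ((c 0 i - iota y) * z 0 j) < vabs S).
  move=> i; have c0 : 0 < vabs (c 0 ord0) by rewrite vabs_gt0.
  case: (unliftP ord0 i) => [j ->|->].
    have m0 : 0 < Num.max 1 (vabs (z 0 j)) by rewrite lt_max ltr01.
    have e0 : 0 < Num.min (vabs (c 0 ord0)) (vabs S / Num.max 1 (vabs (z 0 j))).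
      by rewrite lt_min c0 divr_gt0 // vabs_gt0.
    have [y] := Kinf_approx (cK (lift ord0 j)) e0; rewrite lt_min => /andP[y1 y2].
    exists y; split=> // k /lift_inj <-; rewrite vabsM.
    move: y2; rewrite ltr_pdivlMr // => y2; apply: le_lt_trans y2.
    by rewrite ler_wpM2l ?vabs_ge0 // le_max lexx orbT.
  have [y y1] := Kinf_approx (cK ord0) c0; by exists y; split.
have [d [d0 Hd]] := common_denominator y; have /choice[b Hb] := Hd.
have [y00 _] := Hy ord0.
have vy0 : vabs (iota (y ord0)) = vabs (c 0 ord0).
  by apply: vabs_near; rewrite vabsB.
have vy : vabs (\sum_i iota (y (lift ord0 i)) * z 0 i) = vabs S.
  rewrite -[RHS]vabsN -SE; apply: vabs_near; rewrite vabsB -sumrB SE vabsN.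
  apply: vabs_sum_lt; first by rewrite vabs_gt0.
  by move=> i _ _; rewrite -mulrBl; have [_ /(_ i erefl)] := Hy (lift ord0 i).
have bE i : embA (b i) = embA d * iota (y i) by rewrite /Defs.embA -Hb rmorphM.
have b0 : b ord0 != 0.
  rewrite -(embA_eq0 iota) bE mulf_neq0 ?embA_eq0 //.
  by rewrite -vabs_gt0 vy0 vabs_gt0.
have := isoX (b ord0) (\row_i b (lift ord0 i)) b0; rewrite bE.
have -> : pairing (\row_i b (lift ord0 i)) z = embA d * \sum_i iota (y (lift ord0 i)) * z 0 i.
  rewrite pairingE mulr_sumr; apply: eq_bigr => i _.
  by rewrite mxE bE mulrA.
by rewrite !vabsM vy vy0 /S vabsM mulrA eqxx.
Qed.

Section EpolIso.
Variables (r : nat) (z : 'rV[C]_r).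
Hypothesis hz : Omega z.

Lemma iso_notin X d : iso z X -> X \notin fspan (lat z d).
Proof.
by move=> isoX; apply/negP => /mem_fspan_lat[f _ E]; have := iso_neq f isoX; rewrite E eqxx.
Qed.

Lemma vabs_iso_add X d v : iso z X -> v \in fspan (lat z d) ->
  vabs (X + v) = Num.max (vabs X) (vabs v).
Proof.
move=> isoX /mem_fspan_lat[f _ ->]; apply: vabs_neqD; exact: iso_neq.
Qed.

Lemma vabs_epol_iso X d : iso z X ->
  vabs (epol (lat z d)).[X] =
  vabs X * \prod_(w <- fspan (lat z d) | w != 0) Num.max 1 (vabs X / vabs w).
Proof.
move=> isoX; rewrite (@epol_hornerE R F C iota) ?fspan_lat_uniq // vabsM vabs_prod; congr (_ * _).
rewrite big_seq_cond [RHS]big_seq_cond; apply: eq_bigr => w /andP[ws w0].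
rewrite vabs_neqD; first by rewrite vabs1 vabsM vabsV.
have vw : vabs w != 0 by rewrite vabs_eq0.
have /mem_fspan_lat[f _ wE] := ws.
rewrite vabs1 vabsM vabsV eq_sym; apply: contra (iso_neq f isoX) => /eqP E.
by rewrite -wE -[X in X == _](divfK vw) E mul1r.
Qed.

Lemma vabs_epol_ge X d : iso z X -> vabs X <= vabs (epol (lat z d)).[X].
Proof.
move=> isoX; rewrite vabs_epol_iso // -[leLHS]mulr1 ler_wpM2l ?vabs_ge0 //.
elim/big_rec: _ => // w x _ x1; rewrite -[leLHS]mulr1 ler_pM ?le_max ?lexx //.
Qed.

(** Serves in the tail estimate, where all [e(aX)] with [deg a >= D] are compared with
    [e(theta^D X)]. *)
Lemma vabs_epol_mono X Y d : iso z X -> iso z Y -> vabs X <= vabs Y ->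
  vabs (epol (lat z d)).[X] <= vabs (epol (lat z d)).[Y].
Proof.
move=> isoX isoY XY; rewrite !vabs_epol_iso //; apply: ler_pM; rewrite ?vabs_ge0 //.
  by apply: prodr_ge0 => w _; rewrite le_max ler01.
apply: ler_prod => w _; rewrite le_max ler01 /= ge_max le_max lexx /= le_max.
by apply/orP; right; rewrite ler_wpM2r // invr_ge0 vabs_ge0.
Qed.

(** Yields both the nonvanishing of the exponential at isolated points and [t -> 0] as [|X|] grows
    along them. *)
Lemma vabs_expL_ge X : iso z X -> vabs X <= vabs (expL (Lambda iota z) X).
Proof.
move=> isoX; have cv := expL_vcvg hC hz X.
have [E|n0] := eqVneq (expL (Lambda iota z) X) 0.
  have X0 : 0 < vabs X by rewrite vabs_gt0 (iso_neq0 isoX).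
  have [N HN] := cv _ X0; have := HN N (leqnn N); rewrite E subr0.
  by rewrite ltNge vabs_epol_ge.
have [N HN] := vcvg_vabs cv n0.
by rewrite -(HN N (leqnn N)) vabs_epol_ge.
Qed.

Lemma expL_iso_neq0 X : iso z X -> expL (Lambda iota z) X != 0.
Proof.
move=> isoX; rewrite -vabs_gt0 (lt_le_trans _ (vabs_expL_ge isoX)) //.
by rewrite vabs_gt0 (iso_neq0 isoX).
Qed.

Lemma vabs_shiftsum_iso X d s : iso z X ->
  vabs (shiftsum (jK F) iota (lat z d) s X) <= (vabs X ^+ s)^-1.
Proof.
move=> isoX; have X0 : 0 < vabs X by rewrite vabs_gt0 (iso_neq0 isoX).
apply: vabs_sum_le => [|v vs _]; first by rewrite invr_ge0 exprn_ge0 // ltW.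
have le : vabs X <= vabs (X + v) by rewrite (vabs_iso_add isoX vs) le_max lexx.
rewrite vabsV vabsX lef_pV2 ?posrE ?exprn_gt0 //; last exact: lt_le_trans le.
by apply: lerXn2r => //; rewrite nnegrE vabs_ge0.
Qed.

End EpolIso.

End IsolatedPoints.

(** * The graded algebra of multiple Eisenstein series *)

Section GradedLimits.
Variables (R : realType) (F : finFieldType) (C : ultrametricClosedFieldType R).
Variable iota : {rmorphism {fraction {poly F}} -> C}.
Hypothesis hC : is_Cinfty iota.
Variable r : nat.
Hypothesis hr : (0 < r)%N.
Local Notation vabs := (@vabs R C).
Local Notation K := {fraction {poly F}}.
Local Notation q := #|F|.
Local Notation embA := (embA iota).
Local Notation theta := (theta iota).
Local Notation Omega := (Omega iota).
Local Notation fspan := (span (fscale (jK F) iota)).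
Local Notation epol := (@epol F C).
Local Notation ecoef := (@ecoef F C).
Local Notation lat := (lat iota).
Local Notation tors := (tors iota).
Local Notation Eis := (Eis iota).
Local Notation MSval := (MSval (jK F) iota).
Local Notation MScomb := (MScomb (jK F) iota).
Implicit Types z : 'rV[C]_r.

Definition Eval (P : comb K) z : C := \sum_(p <- P) iota p.1 * Eis p.2 z.

(* [Zc w] is the space Z_{K, w} of the statement, with coefficients given in [K]. *)
Definition Zc (w : nat) (f : 'rV[C]_r -> C) : Prop :=
  exists P : comb K, comb_of w P /\ forall z, Omega z -> f z = Eval P z.

Lemma MSval_vcvg w P z : comb_of w P -> Omega z ->
  vcvg (fun d => MSval P (lat z d)) (Eval P z).
Proof.
move=> wP hz; apply: vcvg_sum => p pP; apply: vcvgZ; apply: Eis_vcvg => //.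
by move/allP: wP => /(_ _ pP)/andP[].
Qed.

Lemma Zc_calZ w f : Zc w f -> calZ iota (Kfield iota) w f.
Proof.
move=> [P [wP fE]]; exists (size P), (fun k => iota (nth (0, [::]) P k).1),
  (fun k => (nth (0, [::]) P k).2); split.
- by move=> k; exists (nth (0, [::]) P k).1.
- by move=> k; have /andP[p1 /eqP p2] := allP wP _ (mem_nth (0, [::]) (ltn_ord k)).
- by move=> z hz; rewrite fE // /Eval (big_nth (0, [::])) big_mkord.
Qed.

(* Level-dependent functions whose limit lies in Z_{K, w}. *)
Definition ZL (w : nat) (phi : 'rV[C]_r -> nat -> C) : Prop :=
  exists f, Zc w f /\ forall z, Omega z -> vcvg (phi z) (f z).

Lemma MScomb_ZL w phi : MScomb w phi -> ZL w (fun z d => phi (lat z d)).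
Proof.
move=> [P [wP HP]]; exists (Eval P); split; first by exists P.
move=> z hz; apply: vcvg_eq (MSval_vcvg wP hz) => d.
by rewrite HP //; apply: fspan_lat_uniq.
Qed.

Lemma Zc_ZL w f : Zc w f -> ZL w (fun z _ => f z).
Proof. by move=> Zf; exists f; split=> // z _; apply: vcvg_cst. Qed.

Lemma ZL_Zc w f phi : ZL w phi -> (forall z, Omega z -> vcvg (phi z) (f z)) -> Zc w f.
Proof.
move=> [g [[P [wP gP]] cg]] cf; exists P; split=> // z hz; rewrite -gP //.
exact: vcvg_unique (cf _ hz) (cg _ hz).
Qed.

Lemma Zc_ext w f g : (forall z, Omega z -> f z = g z) -> Zc w f -> Zc w g.
Proof. by move=> fg [P [wP H]]; exists P; split=> // z hz; rewrite -fg // H. Qed.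

Lemma Zc0 w : Zc w (fun _ => 0).
Proof. by exists [::]; split=> // z _; rewrite /Eval big_nil. Qed.

Lemma Zc_MScomb w phi f : MScomb w phi ->
  (forall z, Omega z -> vcvg (fun d => phi (lat z d)) (f z)) -> Zc w f.
Proof. by move/MScomb_ZL => H /(ZL_Zc H). Qed.

Lemma Zc1 : Zc 0 (fun _ => 1).
Proof. by apply: (Zc_MScomb (MScomb1 _ _)) => z _; apply: vcvg_cst. Qed.

Lemma ZcD w f g : Zc w f -> Zc w g -> Zc w (fun z => f z + g z).
Proof.
move=> [P [wP HP]] [Q [wQ HQ]]; exists (P ++ Q); split; first by rewrite comb_of_cat wP.
by move=> z hz; rewrite HP ?HQ // /Eval big_cat.
Qed.

Lemma ZcZ w a f : Zc w f -> Zc w (fun z => iota a * f z).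
Proof.
move=> [P [wP HP]]; exists (comb_scale a P); split; first by rewrite comb_of_scale.
move=> z hz; rewrite HP // /Eval big_map mulr_sumr; apply: eq_bigr => p _.
by rewrite /= rmorphM mulrA.
Qed.

(** The product formula holds at every level with the same combination, so it passes to the
    limit. *)
Lemma ZcM w v f g : Zc w f -> Zc v g -> Zc (w + v) (fun z => f z * g z).
Proof.
move=> [P [wP HP]] [Q [wQ HQ]].
have cP : MScomb w (MSval P) by exists P.
have cQ : MScomb v (MSval Q) by exists Q.
apply: (Zc_MScomb (MScombM cP cQ)) => z hz; rewrite HP ?HQ //.
by apply: vcvgM; apply: MSval_vcvg; eassumption.
Qed.

Lemma Zc_Eis s : is_index s -> Zc (sumn s) (Eis s).
Proof.
move=> ps; exists [:: (1, s)]; split; first by rewrite /comb_of /= eqxx andbT [pos_index s]ps.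
by move=> z _; rewrite /Eval big_seq1 rmorph1 mul1r.
Qed.

Lemma ZL_ext w phi psi : (forall z d, Omega z -> phi z d = psi z d) -> ZL w phi -> ZL w psi.
Proof.
move=> E [f [Zf cf]]; exists f; split=> // z hz.
by apply: vcvg_eq (cf z hz) => d; apply: E.
Qed.

Lemma ZLD w phi psi : ZL w phi -> ZL w psi -> ZL w (fun z d => phi z d + psi z d).
Proof.
move=> [f [Zf cf]] [g [Zg cg]]; exists (fun z => f z + g z); split; first exact: ZcD.
by move=> z hz; apply: vcvgD; [apply: cf|apply: cg].
Qed.

Lemma ZLZ w a phi : ZL w phi -> ZL w (fun z d => iota a * phi z d).
Proof.
move=> [f [Zf cf]]; exists (fun z => iota a * f z); split; first exact: ZcZ.
by move=> z hz; apply: vcvgZ; apply: cf.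
Qed.

Lemma ZLM w v phi psi : ZL w phi -> ZL v psi -> ZL (w + v) (fun z d => phi z d * psi z d).
Proof.
move=> [f [Zf cf]] [g [Zg cg]]; exists (fun z => f z * g z); split; first exact: ZcM.
by move=> z hz; apply: vcvgM; [apply: cf|apply: cg].
Qed.

Lemma ZLX w phi k : ZL w phi -> ZL (w * k) (fun z d => phi z d ^+ k).
Proof.
move=> H; elim: k => [|k IH]; first by rewrite muln0; apply: (Zc_ZL Zc1).
by rewrite mulnS; apply: ZL_ext (ZLM H IH) => z d _; rewrite exprS.
Qed.

Lemma ZL_sum w n (phi : nat -> 'rV[C]_r -> nat -> C) :
  (forall i, (i < n)%N -> ZL w (phi i)) -> ZL w (fun z d => \sum_(i < n) phi i z d).
Proof.
elim: n => [|n IH] H; first by apply: ZL_ext (Zc_ZL (Zc0 w)) => z d _; rewrite big_ord0.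
apply: (@ZL_ext _ (fun z d => (\sum_(i < n) phi i z d) + phi n z d)).
  by move=> z d _; rewrite big_ord_recr.
by apply: ZLD; [apply: IH => i lt; apply: H; apply: ltnW|apply: H].
Qed.

Lemma ZL_shift w phi : ZL w phi -> ZL w (fun z d => phi z d.+1).
Proof.
by move=> [f [Zf cf]]; exists f; split=> // z hz; apply: vcvg_shift; apply: cf.
Qed.

Lemma ZL_coef n : ZL n (fun z d => (epol (lat z d))`_n.+1).
Proof. exact: (MScomb_ZL (MScomb_coef_epol _ _ n)). Qed.

Lemma ZL_ecoef n : ZL (q ^ n - 1) (fun z d => ecoef (lat z d) n).
Proof. exact: (MScomb_ZL (MScomb_ecoef _ _ n)). Qed.

Lemma iota_thetaX n : theta ^+ n = iota (tofrac 'X ^+ n).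
Proof. by rewrite rmorphXn. Qed.

(* The limits of these coefficients are g_n for 0 < n < r and Delta for n = r. *)
Lemma ZL_tors n : (n <= r)%N ->
  ZL (q ^ n - 1) (fun z d => ecoef (tors z d) n * theta ^+ (q ^ n)).
Proof.
elim/ltn_ind: n => n IH nr.
apply: (@ZL_ext _ (fun z d => iota (tofrac 'X ^+ (q ^ n)) * ecoef (lat z d.+1) n +
   iota (- 1) * \sum_(i < n) ecoef (tors z d) i * theta ^+ (q ^ i) *
      ecoef (lat z d) (n - i) ^+ (q ^ i))).
  move=> z d hz; rewrite rmorphN1 mulN1r -iota_thetaX; apply/esym.
  apply: (@epol_functional_coef _ _ _ (jK F) iota); first exact: theta_neq0 hC.
    by rewrite size_tors.
  refine (lat_functional hC hz d).
apply: ZLD; apply: ZLZ; first exact: (ZL_shift (ZL_ecoef n)).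
apply: (@ZL_sum _ _ (fun i z d => ecoef (tors z d) i * theta ^+ (q ^ i) *
      ecoef (lat z d) (n - i) ^+ (q ^ i))) => i ni.
have -> : (q ^ n - 1 = (q ^ i - 1) + (q ^ (n - i) - 1) * q ^ i)%N.
  rewrite mulnBl mul1n -expnD subnK ?(ltnW ni) //.
  have le : (q ^ i <= q ^ n)%N by rewrite leq_exp2l ?card_field_gt1 ?(ltnW ni).
  have lt : (0 < q ^ i)%N by rewrite expn_gt0 q_gt0.
  by move: le lt; set u := (q ^ i)%N; set v := (q ^ n)%N; lia.
apply: ZLM; first by apply: IH => //; apply: ltnW (leq_trans ni nr).
exact/ZLX/ZL_ecoef.
Qed.

Lemma vcvg_neq0 (u : nat -> C) l b : vcvg u l -> 0 < b -> (forall n, b <= vabs (u n)) -> l != 0.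
Proof.
move=> ul b0 Hb; apply/eqP => l0; have [N HN] := ul _ b0.
by have := HN N (leqnn N); rewrite l0 subr0 ltNge Hb.
Qed.

(** Source of [Delta != 0]: the leading coefficient is a finite product of inverses of values of
    exponential polynomials, and each value stays bounded in [d] because it converges. *)
Lemma tors_lead_bound z : Omega z ->
  exists2 b : R, 0 < b & forall d, b <= vabs (ecoef (tors z d) r).
Proof.
move=> hz.
(* By homogeneity the value at [w] for [theta] times the lattice is [theta e(w / theta)], which
   converges. Taking [B >= 1] lets vanishing factors be skipped. *)
have wB w : exists2 B : R, 1 <= B & forall d, vabs (epol [seq theta * b | b <- lat z d]).[w] <= B.
  have [B B0 HB] := vcvg_bounded_all (expL_vcvg hC hz (w / theta)).
  have tB : 0 < q%:R * B by rewrite mulr_gt0 ?qR_gt0.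
  exists (Num.max 1 (q%:R * B)); first by rewrite le_max lexx.
  move=> d; rewrite le_max; apply/orP; right.
  have := congr1 (fun p : {poly C} => p.[w / theta]) (epol_scale F (lat z d) (theta_neq0 hC)).
  rewrite horner_comp !hornerZ hornerX mulrC divfK ?(theta_neq0 hC) // => ->.
  by rewrite vabsM (vabs_theta hC) ler_pM2l ?qR_gt0.
have {wB}[b b0 Hb] : exists2 b : R, 0 < b & forall d,
    b <= \prod_(x <- fspan (zseq z) | (epol [seq theta * b | b <- lat z d]).[x] != 0)
           vabs (epol [seq theta * b | b <- lat z d]).[x]^-1.
  elim: (fspan (zseq z)) => [|w s [b b0 Hb]]; first by exists 1 => // d; rewrite big_nil.
  have [B B1 HB] := wB w; have B0 : 0 < B by apply: lt_le_trans B1.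
  exists (B^-1 * b); first by rewrite mulr_gt0 // invr_gt0.
  move=> d; rewrite big_cons; case: ifP => [w0|_].
    apply: ler_pM; rewrite ?invr_ge0 ?(ltW B0) ?(ltW b0) ?Hb //.
    by rewrite vabsV lef_pV2 ?posrE ?vabs_gt0.
  apply: le_trans (Hb d); rewrite -[leRHS]mul1r ler_pM2r //.
  by rewrite invf_le1.
exists b => // d; apply: le_trans (Hb d) _.
have -> : ecoef (tors z d) r = ecoef (tors z d) (size (tors z d)) by rewrite size_tors.
rewrite (@ecoef_lead _ _ _ (jK F) iota); last exact: tors_uniq.
by rewrite /nzprod fspan_map_epol big_map vabs_prod.
Qed.

Definition functional_at z (g : nat -> C) (D : C) := forall X : C,
  let Y := expL (Lambda iota z) X in
  expL (Lambda iota z) (theta * X) =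
    theta * Y + \sum_(1 <= i < r) g i * Y ^+ (q ^ i)%N + D * Y ^+ (q ^ r)%N.

(** Limit of [lat_functional]: [g i] is the limit of the coefficients of [tors], with [g 0 = theta],
    and [g r] is the candidate for [Delta]. *)
Lemma functional_equation : exists g : nat -> 'rV[C]_r -> C,
  (forall i, (i <= r)%N -> Zc (q ^ i - 1) (g i)) /\
  forall z, Omega z -> g r z != 0 /\ functional_at z (g^~ z) (g r z).
Proof.
have /choice[g Hg] : forall i, exists g : 'rV[C]_r -> C, (i <= r)%N -> Zc (q ^ i - 1) g /\
    forall z, Omega z -> vcvg (fun d => ecoef (tors z d) i * theta ^+ (q ^ i)) (g z).
  move=> i; have [ir|_] := leqP i r; last by exists (fun _ => 0).
  by have [g H] := ZL_tors ir; exists g.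
exists g; split=> [i /Hg[]//|z hz]; split.
  have [b b0 Hb] := tors_lead_bound hz; have [_ /(_ _ hz) cv] := Hg r (leqnn r).
  have tq : 0 < vabs (theta ^+ (q ^ r)) by rewrite vabs_gt0 expf_neq0 // (theta_neq0 hC).
  apply: (vcvg_neq0 cv (mulr_gt0 b0 tq)) => d.
  by rewrite vabsM ler_pM2r.
move=> X /=; set Y := expL (Lambda iota z) X.
have cX := expL_vcvg hC hz X; have cT := vcvg_shift (expL_vcvg hC hz (theta * X)).
have E d : (epol (lat z d.+1)).[theta * X] =
  \sum_(i < r.+1) (ecoef (tors z d) i * theta ^+ (q ^ i)) * (epol (lat z d)).[X] ^+ (q ^ i).
  have := congr1 (fun p : {poly C} => p.[X]) (lat_functional hC hz d).
  rewrite !horner_comp !hornerE => ->.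
  rewrite (epolE (jK F) iota (tors z d)) hornerq size_tors; apply: eq_bigr => i _.
  by rewrite exprMn mulrA.
have lim : vcvg (fun d => \sum_(i < r.+1) (ecoef (tors z d) i * theta ^+ (q ^ i)) *
    (epol (lat z d)).[X] ^+ (q ^ i)) (\sum_(i < r.+1) g i z * Y ^+ (q ^ i)).
  apply: vcvg_sum_ord => i; apply: vcvgM; last exact: vcvgX.
  by have [_] := Hg i (ltn_ord i); apply.
rewrite (vcvg_unique cT (vcvg_eq (fun d => esym (E d)) lim)).
rewrite -(big_mkord predT (fun i => g i z * Y ^+ (q ^ i))) big_nat_recr //=; congr (_ + _).
rewrite big_ltn //; congr (_ + _); rewrite expr1; congr (_ * _).
have [_ /(_ _ hz) cv] := Hg 0%N isT; apply: vcvg_unique cv _.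
apply: vcvg_eq (vcvg_cst theta) => d.
by rewrite (ecoef0 (jK F) iota) mul1r.
Qed.

Lemma poly_unbounded_roots (p : {poly C}) :
  (forall B : R, exists x, B < vabs x /\ root p x) -> p = 0.
Proof.
move=> H; apply/eqP; apply: contraT => p0.
have [rs [sz U ro]] : exists rs : seq C, [/\ size rs = size p, uniq rs & all (root p) rs].
  elim: (size p) => [|n [rs [sz U ro]]]; first by exists [::].
  have [x [Bx rx]] := H (\sum_(y <- rs) vabs y).
  exists (x :: rs); rewrite /= sz U rx ro; split=> //; rewrite andbT.
  apply: contraL Bx => xs; rewrite -leNgt (big_rem x) //= lerDl.
  by apply: sumr_ge0 => y _; apply: vabs_ge0.
by have := max_poly_roots p0 ro U; rewrite sz ltnn.
Qed.

Lemma iso_unbounded z : forall B : R, exists X, iso iota z X /\ B < vabs X.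
Proof.
move=> B; have [X isoX] := iso_exists hC z.
have X0 : 0 < vabs X by rewrite vabs_gt0 (iso_neq0 isoX).
pose b := Num.max 1 (B / vabs X).
have b0 : 0 < b by rewrite lt_max ltr01.
have b'0 : 0 < b^-1 by rewrite invr_gt0.
have [N HN] := theta_expN_small F b'0; exists (embA 'X^N * X); split.
  by apply: iso_scale => //; rewrite monic_neq0 ?monicXn.
have := HN N (leqnn N); rewrite ltf_pV2 ?posrE ?exprn_gt0 ?qR_gt0 // => lt.
rewrite vabsM embAX vabsX (vabs_theta hC) -ltr_pdivrMr //.
by apply: le_lt_trans lt; rewrite le_max lexx orbT.
Qed.

Lemma expL_unbounded z : Omega z -> forall B : R, exists X, B < vabs (expL (Lambda iota z) X).
Proof.
move=> hz B; have [X [isoX BX]] := iso_unbounded z B; exists X.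
exact: lt_le_trans (vabs_expL_ge hC hz isoX).
Qed.

(** The difference of the two equations is a polynomial vanishing at all values of the exponential.
    These are unbounded, so it is zero, and its coefficient at [X^(q^r)] is [D - D']. *)
Lemma functional_unique z g D g' D' : Omega z ->
  functional_at z g D -> functional_at z g' D' -> D = D'.
Proof.
move=> hz H H'.
pose a i := if (i == 0)%N then 0 else if (i < r)%N then g i - g' i else D - D'.
suff : qpoly F r.+1 a = 0.
  move/(congr1 (fun p : {poly C} => p`_(q ^ r))); rewrite coef_qpoly ltnSn coef0 /a ltnn.
  by rewrite gtn_eqF // => /eqP; rewrite subr_eq0 => /eqP.
apply: poly_unbounded_roots => B; have [X BX] := expL_unbounded hz B.
exists (expL (Lambda iota z) X); split=> //; rewrite /root hornerq.
move: (H X) (H' X) => /= -> /eqP; rewrite -subr_eq0 => /eqP E.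
apply/eqP; rewrite -[RHS]E; set Y := expL _ _.
rewrite -(big_mkord predT (fun i => a i * Y ^+ (q ^ i))) big_nat_recr //= big_ltn //.
have -> : a r = D - D' by rewrite /a gtn_eqF // ltnn.
have -> : a 0%N = 0 by [].
rewrite mul0r add0r.
have -> : \sum_(1 <= i < r) a i * Y ^+ (q ^ i) =
    \sum_(1 <= i < r) g i * Y ^+ (q ^ i) - \sum_(1 <= i < r) g' i * Y ^+ (q ^ i).
  rewrite -sumrB; apply: eq_big_nat => i /andP[i0 ir].
  by rewrite /a gtn_eqF // ir mulrBl.
by ring.
Qed.

Lemma Delta_spec : exists g : nat -> 'rV[C]_r -> C,
  (forall i, (i < r)%N -> Zc (q ^ i - 1) (g i)) /\
  forall z, Omega z -> functional_at z (g^~ z) (Delta iota z).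
Proof.
have [g [Zg Hg]] := functional_equation.
exists g; split=> [i ir|z hz]; first by apply: Zg; apply: ltnW.
have [gz0 gz] := Hg z hz.
rewrite /Delta; case: xgetP => [D _ [g' HD]|]; last by move=> /(_ (g r z)); case; exists (g^~ z).
by rewrite (functional_unique hz HD gz).
Qed.

Lemma Zc_Delta : Zc (q ^ r - 1) (@Delta R F C iota r).
Proof.
have [g [Zg Hg]] := functional_equation; apply: Zc_ext (Zg r (leqnn r)) => z hz.
have [gz0 gz] := Hg z hz.
rewrite /Delta; case: xgetP => [D _ [g' HD]|]; last by move=> /(_ (g r z)); case; exists (g^~ z).
exact: functional_unique hz gz HD.
Qed.

Lemma Delta_neq0 z : Omega z -> Delta iota z != 0.
Proof.
move=> hz; have [g [Zg Hg]] := functional_equation; have [gz0 gz] := Hg z hz.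
rewrite /Delta; case: xgetP => [D _ [g' HD]|]; last by move=> /(_ (g r z)); case; exists (g^~ z).
by rewrite (functional_unique hz HD gz).
Qed.

End GradedLimits.

(** * Expansions in the parameter at infinity *)

Section Expansions.
Variables (R : realType) (F : finFieldType) (C : ultrametricClosedFieldType R).
Variable iota : {rmorphism {fraction {poly F}} -> C}.
Hypothesis hC : is_Cinfty iota.
Variable r : nat.
Hypothesis hr : (0 < r)%N.
Local Notation vabs := (@vabs R C).
Local Notation q := #|F|.
Local Notation Omega := (Omega iota).
Local Notation iso := (iso iota).
Local Notation Delta := (Delta iota).
Local Notation Zc := (@Zc R F C iota r).
Implicit Types z : 'rV[C]_r.

(* [Lc w] is the space L_{K, w} of the statement. *)
Definition Lc (w : int) (f : 'rV[C]_r -> C) : Prop := exists (M k : nat) (G : 'rV[C]_r -> C),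
  [/\ k%:Z = w + (M * (q ^ r - 1))%N%:Z, Zc k G &
      forall z, Omega z -> f z = G z / Delta z ^+ M].

Lemma Lc_calL w f : Lc w f -> calL iota (Kfield iota) w f.
Proof. by move=> [M [k [G [kE /Zc_calZ ZG fE]]]]; exists M, k, G. Qed.

Lemma Lc_ext w f g : (forall z, Omega z -> f z = g z) -> Lc w f -> Lc w g.
Proof. by move=> fg [M [k [G [kE ZG fE]]]]; exists M, k, G; split=> // z hz; rewrite -fg ?fE. Qed.

Lemma Zc_Lc k f : Zc k f -> Lc k%:Z f.
Proof. by move=> Zf; exists 0%N, k, f; split=> // [|z _]; rewrite ?addr0 // expr0 invr1 mulr1. Qed.

Lemma ZcX k f n : Zc k f -> Zc (n * k) (fun z => f z ^+ n).
Proof.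
move=> Zf; elim: n => [|n IH]; first exact: Zc1.
by rewrite mulSn; apply: Zc_ext (ZcM hC Zf IH) => z _; rewrite exprS.
Qed.

Lemma qr_gt1 : (1 < q ^ r)%N.
Proof. by rewrite -(expn0 q) ltn_exp2l // card_field_gt1. Qed.

Lemma Lc0 w : Lc w (fun _ => 0).
Proof.
(* The weight may be negative; since [q^r - 1 >= 1], the power [|w|] of [Delta] makes that of the
   numerator nonnegative. *)
exists (absz w), (absz (w + (absz w * (q ^ r - 1))%N%:Z)), (fun _ => 0); split; first last.
- by move=> z _; rewrite mul0r.
- exact: Zc0.
have := qr_gt1; set Q := (q ^ r)%N => Q1.
have : (absz w <= absz w * (Q - 1))%N by rewrite leq_pmulr // subn_gt0.
by move: (absz w * (Q - 1))%N => m; lia.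
Qed.

Lemma LcD w f g : Lc w f -> Lc w g -> Lc w (fun z => f z + g z).
Proof.
move=> [M [k [G [kE ZG fE]]]] [M' [k' [G' [kE' ZG' fE']]]].
exists (M + M')%N, (k + M' * (q ^ r - 1))%N, (fun z => G z * Delta z ^+ M' + G' z * Delta z ^+ M).
have ZD := Zc_Delta hC hr.
split; first by rewrite PoszD kE mulnDl PoszD addrA.
  apply: ZcD; first by apply: ZcM => //; apply: ZcX.
  have -> : (k + M' * (q ^ r - 1) = k' + M * (q ^ r - 1))%N.
    by apply/eqP; rewrite -eqz_nat !PoszD kE kE' addrAC.
  by apply: ZcM => //; apply: ZcX.
move=> z hz; rewrite fE // fE' // exprD; have D0 := Delta_neq0 hC hr hz.
by field; rewrite !expf_neq0.
Qed.

Lemma LcM w v f g : Lc w f -> Lc v g -> Lc (w + v) (fun z => f z * g z).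
Proof.
move=> [M [k [G [kE ZG fE]]]] [M' [k' [G' [kE' ZG' fE']]]].
exists (M + M')%N, (k + k')%N, (fun z => G z * G' z); split.
- by rewrite PoszD kE kE' mulnDl PoszD addrACA.
- exact: ZcM.
- by move=> z hz; rewrite fE // fE' // exprD invfM mulrACA.
Qed.

Lemma Lc_K a : Lc 0 (fun _ => iota a).
Proof.
by apply: (@Zc_Lc 0%N); apply: Zc_ext (ZcZ a (Zc1 hC r)) => z _; rewrite mulr1.
Qed.

Lemma Lc_Delta_inv : Lc (- (q ^ r - 1)%N%:Z) (fun z => (Delta z)^-1).
Proof.
exists 1%N, 0%N, (fun _ => 1); split; last by move=> z _; rewrite expr1 mul1r.
  by rewrite mul1n addrC subrr.
exact: Zc1.
Qed.

Lemma Lc_sum w n (f : nat -> 'rV[C]_r -> C) : (forall i, (i < n)%N -> Lc w (f i)) ->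
  Lc w (fun z => \sum_(i < n) f i z).
Proof.
elim: n => [|n IH] H; first by apply: Lc_ext (Lc0 w) => z _; rewrite big_ord0.
apply: (@Lc_ext _ (fun z => (\sum_(i < n) f i z) + f n z)).
  by move=> z _; rewrite big_ord_recr.
by apply: LcD; [apply: IH => i lt; apply: H; apply: ltnW|apply: H].
Qed.

Definition tpar z X : C := tL (Lambda iota z) X.

Lemma tpar_neq0 z X : Omega z -> iso z X -> tpar z X != 0.
Proof. by move=> hz isoX; rewrite invr_eq0 (expL_iso_neq0 hC hz). Qed.

Definition near_inf z (P : C -> Prop) : Prop :=
  exists2 e : R, 0 < e & forall X, iso z X -> vabs (tpar z X) < e -> P X.

Lemma near_infT z (P : C -> Prop) : (forall X, iso z X -> P X) -> near_inf z P.
Proof. by move=> H; exists 1 => // X /H. Qed.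

Lemma near_infI z (P Q S : C -> Prop) : near_inf z P -> near_inf z Q ->
  (forall X, iso z X -> P X -> Q X -> S X) -> near_inf z S.
Proof.
move=> [e e0 He] [d d0 Hd] H; exists (Num.min e d); first by rewrite lt_min e0.
by move=> X isoX; rewrite lt_min => /andP[te td]; apply: H => //; [apply: He|apply: Hd].
Qed.

(** Constant and radius may depend on [z]: coefficients are eventually compared point by point. *)
Definition bigO n (Phi : 'rV[C]_r -> C -> C) : Prop := forall z, Omega z ->
  exists2 B : R, 0 <= B & near_inf z (fun X => vabs (Phi z X) <= B * vabs (tpar z X) ^+ n).

Lemma bigO_ext n Phi Psi :
  (forall z, Omega z -> near_inf z (fun X => Phi z X = Psi z X)) -> bigO n Phi -> bigO n Psi.
Proof.
move=> E H z hz; have [B B0 HB] := H z hz; exists B => //.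
by apply: near_infI (E z hz) HB _ => X _ ->.
Qed.

Lemma bigO_le n m Phi : (n <= m)%N -> bigO m Phi -> bigO n Phi.
Proof.
move=> nm H z hz; have [B B0 HB] := H z hz; exists B => //.
have t1 : near_inf z (fun X => vabs (tpar z X) <= 1).
  by exists 1 => // X _ /ltW.
apply: near_infI t1 HB _ => X _ tX; move/le_trans; apply.
by rewrite ler_wpM2l // ler_wiXn2l // vabs_ge0.
Qed.

Lemma bigO_add n Phi Psi : bigO n Phi -> bigO n Psi -> bigO n (fun z X => Phi z X + Psi z X).
Proof.
move=> H1 H2 z hz; have [B B0 HB] := H1 z hz; have [D D0 HD] := H2 z hz.
exists (Num.max B D); first by rewrite le_max B0.
have tn X : 0 <= vabs (tpar z X) ^+ n by rewrite exprn_ge0 // vabs_ge0.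
apply: near_infI HB HD _ => X _ h1 h2; apply: vabsD_le.
  by apply: le_trans h1 _; rewrite ler_wpM2r // le_max lexx.
by apply: le_trans h2 _; rewrite ler_wpM2r // le_max lexx orbT.
Qed.

Lemma bigO_mul n m Phi Psi : bigO n Phi -> bigO m Psi ->
  bigO (n + m) (fun z X => Phi z X * Psi z X).
Proof.
move=> H1 H2 z hz; have [B B0 HB] := H1 z hz; have [D D0 HD] := H2 z hz.
exists (B * D); first by rewrite mulr_ge0.
apply: near_infI HB HD _ => X _ h1 h2.
by rewrite vabsM exprD mulrACA ler_pM ?vabs_ge0.
Qed.

Lemma bigO_cst (f : 'rV[C]_r -> C) : bigO 0 (fun z _ => f z).
Proof.
move=> z hz; exists (vabs (f z)); first exact: vabs_ge0.
by apply: near_infT => X _; rewrite expr0 mulr1.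
Qed.

Lemma bigO_tparX n : bigO n (fun z X => tpar z X ^+ n).
Proof. by move=> z hz; exists 1 => //; apply: near_infT => X _; rewrite vabsX mul1r. Qed.

Lemma bigO_pow n k Phi : bigO n Phi -> bigO (k * n) (fun z X => Phi z X ^+ k).
Proof.
move=> H; elim: k => [|k IH]; first exact: (bigO_cst (fun _ => 1)).
rewrite mulSn; apply: bigO_ext (bigO_mul H IH) => z hz; apply: near_infT => X _.
by rewrite exprS.
Qed.

Lemma bigO0 n : bigO n (fun _ _ => 0).
Proof.
move=> z hz; exists 0 => //; apply: near_infT => X _; by rewrite vabs0 mul0r.
Qed.

Lemma bigO_sum n m (Phi : nat -> 'rV[C]_r -> C -> C) :
  (forall i, (i < m)%N -> bigO n (Phi i)) -> bigO n (fun z X => \sum_(i < m) Phi i z X).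
Proof.
elim: m => [|m IH] H.
  by apply: bigO_ext (bigO0 n) => z hz; apply: near_infT => X _; rewrite big_ord0.
apply: (@bigO_ext _ (fun z X => (\sum_(i < m) Phi i z X) + Phi m z X)).
  by move=> z hz; apply: near_infT => X _; rewrite big_ord_recr.
by apply: bigO_add; [apply: IH => i lt; apply: H; apply: ltnW|apply: H].
Qed.

Variable N : nat.

(* The expansion is only required up to order [N], so that it need not be unique and
   closure under geometric series is immediate. *)
Definition HasExp (w : int) (Phi : 'rV[C]_r -> C -> C) : Prop :=
  exists beta : nat -> 'rV[C]_r -> C, (forall i, Lc (w - i%:Z) (beta i)) /\
    bigO N (fun z X => Phi z X - \sum_(i < N) beta i z * tpar z X ^+ i).

Lemma HasExp_ext w Phi Psi :
  (forall z, Omega z -> near_inf z (fun X => Phi z X = Psi z X)) ->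
  HasExp w Phi -> HasExp w Psi.
Proof.
move=> E [b [Lb Ob]]; exists b; split=> //; apply: bigO_ext Ob => z hz.
by apply: near_infI (E z hz) (E z hz) _ => X _ ->.
Qed.

Lemma HasExp_extT w Phi Psi : (forall z X, Omega z -> iso z X -> Phi z X = Psi z X) ->
  HasExp w Phi -> HasExp w Psi.
Proof. by move=> E; apply: HasExp_ext => z hz; apply: near_infT => X; apply: E. Qed.

Lemma HasExp_bigO0 w Phi : HasExp w Phi -> bigO 0 Phi.
Proof.
move=> [b [Lb Ob]].
have Os : bigO 0 (fun z X => \sum_(i < N) b i z * tpar z X ^+ i).
  apply: (@bigO_sum 0%N N (fun i z X => b i z * tpar z X ^+ i)) => i _.
  by apply: bigO_le (bigO_mul (bigO_cst (b i)) (bigO_tparX i)).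
apply: bigO_ext (bigO_add (bigO_le (leq0n N) Ob) Os) => z hz.
by apply: near_infT => X _; rewrite subrK.
Qed.

Lemma HasExp_add w Phi Psi : HasExp w Phi -> HasExp w Psi ->
  HasExp w (fun z X => Phi z X + Psi z X).
Proof.
move=> [b [Lb Ob]] [c [Lc_c Oc]]; exists (fun i z => b i z + c i z).
split; first by move=> i; apply: LcD.
apply: bigO_ext (bigO_add Ob Oc) => z hz; apply: near_infT => X _.
under [in RHS]eq_bigr do rewrite mulrDl.
by rewrite big_split opprD addrACA.
Qed.

Lemma HasExp_addO w Phi Psi : HasExp w Phi -> bigO N Psi ->
  HasExp w (fun z X => Phi z X + Psi z X).
Proof.
move=> [b [Lb Ob]] OP; exists b; split=> //.
apply: bigO_ext (bigO_add Ob OP) => z hz; apply: near_infT => X _.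
by rewrite addrAC.
Qed.

Lemma HasExp_term w f m : Lc w f -> HasExp (w + m%:Z) (fun z X => f z * tpar z X ^+ m).
Proof.
move=> Lf; exists (fun i z => if i == m then f z else 0); split.
  move=> i; case: eqP => [->|_]; last exact: Lc0.
  by rewrite addrK.
have [lt|ge] := ltnP m N.
  apply: bigO_ext (bigO0 N) => z hz; apply: near_infT => X _.
  rewrite (bigD1 (Ordinal lt)) //= eqxx big1 ?addr0 ?subrr // => i /negPf.
  by rewrite -val_eqE /= => ->; rewrite mul0r.
apply: (@bigO_ext _ (fun z X => f z * tpar z X ^+ m)).
  move=> z hz; apply: near_infT => X _; rewrite big1 ?subr0 // => i _.
  by rewrite ltn_eqF ?mul0r // (leq_trans (ltn_ord i)).
by apply: bigO_le (bigO_mul (bigO_cst f) (bigO_tparX m)).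
Qed.

Lemma HasExp_cst w f : Lc w f -> HasExp w (fun z _ => f z).
Proof.
move=> Lf; have := HasExp_term 0 Lf; rewrite addr0.
by apply: HasExp_extT => z X _ _; rewrite expr0 mulr1.
Qed.

Lemma HasExp_tpar : HasExp 1 tpar.
Proof.
have := HasExp_term 1 (Lc_K 1); rewrite add0r.
by apply: HasExp_extT => z X _ _; rewrite expr1 rmorph1 mul1r.
Qed.

Lemma HasExp_mul w v Phi Psi : HasExp w Phi -> HasExp v Psi ->
  HasExp (w + v) (fun z X => Phi z X * Psi z X).
Proof.
move=> H1 H2; have O1 := HasExp_bigO0 H1; have O2 := HasExp_bigO0 H2.
case: H1 H2 => [b [Lb Ob]] [c [Lc_c Oc]].
exists (fun k z => \sum_(i < k.+1) b i z * c (k - i)%N z); split.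
  move=> k; apply: (@Lc_sum _ _ (fun i z => b i z * c (k - i)%N z)) => i ik.
  have -> : w + v - k%:Z = (w - i%:Z) + (v - (k - i)%N%:Z) by lia.
  exact: LcM.
pose p z : {poly C} := \poly_(i < N) b i z; pose s z : {poly C} := \poly_(i < N) c i z.
have pE z X : (p z).[tpar z X] = \sum_(i < N) b i z * tpar z X ^+ i by rewrite horner_poly.
have sE z X : (s z).[tpar z X] = \sum_(i < N) c i z * tpar z X ^+ i by rewrite horner_poly.
have Os : bigO 0 (fun z X => (s z).[tpar z X]).
  apply: (@bigO_ext _ (fun z X => \sum_(i < N) c i z * tpar z X ^+ i)).
    by move=> z hz; apply: near_infT => X _; rewrite sE.
  apply: (@bigO_sum 0%N N (fun i z X => c i z * tpar z X ^+ i)) => i _.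
  by apply: bigO_le (bigO_mul (bigO_cst (c i)) (bigO_tparX i)).
have Otail : bigO N (fun z X => \sum_(i < N) (p z * s z)`_(N + i) * tpar z X ^+ (N + i)).
  apply: (@bigO_sum N N (fun i z X => (p z * s z)`_(N + i) * tpar z X ^+ (N + i))) => i _.
  have := bigO_mul (bigO_cst (fun z => (p z * s z)`_(N + i))) (bigO_tparX (N + i)).
  by apply: bigO_le; rewrite leq_addr.
(* The error is [Phi (Psi - s) + (Phi - p) s] plus the terms of [p s] of degree at least [N], which
   form [Otail]. *)
have Oa := bigO_mul O1 Oc; rewrite add0n in Oa.
have Od := bigO_mul Ob Os; rewrite addn0 in Od.
have := bigO_add (bigO_add Oa Od) Otail; apply: bigO_ext => z hz; apply: near_infT => X _.
rewrite -pE -sE; set t := tpar z X.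
have -> : \sum_(k < N) (\sum_(i < k.+1) b i z * c (k - i)%N z) * t ^+ k =
    \sum_(k < N) (p z * s z)`_k * t ^+ k.
  apply: eq_bigr => k _; congr (_ * _); rewrite coefM; apply: eq_bigr => i _.
  rewrite !coef_poly (leq_ltn_trans (leq_subr _ _) (ltn_ord k)).
  by rewrite (leq_ltn_trans _ (ltn_ord k)) // -ltnS.
have E : (p z).[t] * (s z).[t] = \sum_(k < N) (p z * s z)`_k * t ^+ k +
    \sum_(i < N) (p z * s z)`_(N + i) * t ^+ (N + i).
  rewrite -hornerM (@horner_coef_wide _ (N + N)) ?big_split_ord //.
  apply: leq_trans (size_polyMleq _ _) _; apply: leq_trans (leq_pred _) _.
  by rewrite leq_add ?size_poly.
set S1 := \sum_(k < N) _ in E *; set S2 := \sum_(i < N) _ in E *.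
have -> : S1 = (p z).[t] * (s z).[t] - S2 by rewrite E addrK.
by ring.
Qed.

Lemma HasExp_pow w Phi k : HasExp w Phi -> HasExp (w * k%:Z) (fun z X => Phi z X ^+ k).
Proof.
move=> H; elim: k => [|k IH].
  rewrite mulr0; have := HasExp_cst (Lc_K 1); apply: HasExp_extT => z X _ _.
  by rewrite rmorph1.
have -> : w * k.+1%:Z = w + w * k%:Z by lia.
by apply: HasExp_extT (HasExp_mul H IH) => z X _ _; rewrite exprS.
Qed.

Lemma HasExp0 w : HasExp w (fun _ _ => 0).
Proof. exact: HasExp_cst (Lc0 w). Qed.

Lemma HasExp_sum w (I : eqType) (s : seq I) (Phi : I -> 'rV[C]_r -> C -> C) :
  (forall i, i \in s -> HasExp w (Phi i)) -> HasExp w (fun z X => \sum_(i <- s) Phi i z X).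
Proof.
elim: s => [|i s IH] H.
  by apply: HasExp_extT (HasExp0 w) => z X _ _; rewrite big_nil.
apply: (@HasExp_extT _ (fun z X => Phi i z X + \sum_(j <- s) Phi j z X)).
  by move=> z X _ _; rewrite big_cons.
apply: HasExp_add; first by apply: H; rewrite mem_head.
by apply: IH => j js; apply: H; rewrite inE js orbT.
Qed.

Lemma bigO1_lt1 u : bigO 1 u -> forall z, Omega z -> near_inf z (fun X => vabs (u z X) < 1).
Proof.
move=> H z hz; have [B B0 HB] := H z hz.
have B1 : 0 < B + 1 by apply: lt_le_trans ltr01 _; rewrite lerDr.
have t1 : near_inf z (fun X => vabs (tpar z X) < (B + 1)^-1).
  by exists (B + 1)^-1 => //; rewrite invr_gt0.
apply: near_infI t1 HB _ => X _ h1; move/le_lt_trans; apply; rewrite expr1.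
apply: (@le_lt_trans _ _ ((B + 1) * vabs (tpar z X))).
  by rewrite ler_wpM2r ?vabs_ge0 // lerDl.
by rewrite mulrC -ltr_pdivlMr // div1r.
Qed.

Lemma bigO_geom u : bigO 1 u -> bigO 0 (fun z X => (1 - u z X)^-1).
Proof.
move=> Ou z hz; exists 1 => //; have h := bigO1_lt1 Ou hz.
apply: (near_infI h h) => X _ lt _; rewrite expr0 mulr1 vabsV addrC vabsD_eq ?vabsN ?vabs1 //.
by rewrite invr1.
Qed.

(** The powers of [u] below [N] sum to the inverse up to [u^N / (1 - u)], which is of order [N]. *)
Lemma HasExp_geom u : HasExp 0 u -> bigO 1 u -> HasExp 0 (fun z X => (1 - u z X)^-1).
Proof.
move=> Hu Ou.
have Hs : HasExp 0 (fun z X => \sum_(k <- seq.iota 0 N) u z X ^+ k).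
  by apply: (@HasExp_sum _ _ _ (fun k z X => u z X ^+ k)) => k _; have := HasExp_pow k Hu;
    rewrite mul0r.
have := bigO_mul (bigO_pow N Ou) (bigO_geom Ou); rewrite muln1 addn0 => Ot.
apply: HasExp_ext (HasExp_addO Hs Ot) => z hz; have h := bigO1_lt1 Ou hz.
apply: (near_infI h h) => X _ lt _; set x := u z X in lt *.
have x1 : 1 - x != 0.
  by rewrite -vabs_gt0 addrC vabsD_eq ?vabsN ?vabs1.
have E : (1 - x) * \sum_(k <- seq.iota 0 N) x ^+ k = 1 - x ^+ N.
  elim: (N) => [|m IH]; first by rewrite big_nil mulr0 expr0 subrr.
  by rewrite -addn1 iotaD big_cat big_seq1 mulrDr IH add0n addn1 exprS; ring.
by apply: (mulfI x1); rewrite mulrDr E mulrCA mulfV // mulr1 subrK.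
Qed.

End Expansions.

(** * Expansion of t(aX) in powers of t(X) *)

Section ScaledParameter.
Variables (R : realType) (F : finFieldType) (C : ultrametricClosedFieldType R).
Variable iota : {rmorphism {fraction {poly F}} -> C}.
Hypothesis hC : is_Cinfty iota.
Variable r : nat.
Hypothesis hr : (0 < r)%N.
Local Notation A := {poly F}.
Local Notation q := #|F|.
Local Notation embA := (embA iota).
Local Notation theta := (theta iota).
Local Notation Omega := (Omega iota).
Local Notation iso := (iso iota).
Local Notation Delta := (Delta iota).
Local Notation tpar := (@tpar R F C iota r).
Local Notation bigO := (@bigO R F C iota r).
Local Notation expz z := (expL (Lambda iota z)).
Local Notation lat := (lat iota).
Implicit Types z : 'rV[C]_r.

Lemma expzD z x y : Omega z -> expz z (x + y) = expz z x + expz z y.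
Proof.
move=> hz; apply: vcvg_unique (expL_vcvg hC hz (x + y)) _.
apply: vcvg_eq (vcvgD (expL_vcvg hC hz x) (expL_vcvg hC hz y)) => d.
by rewrite (epolD (jK F) iota).
Qed.

Lemma expzZ z c x : Omega z -> expz z (iF iota c * x) = iF iota c * expz z x.
Proof.
move=> hz; apply: vcvg_unique (expL_vcvg hC hz _) _.
apply: vcvg_eq (vcvgZ (iF iota c) (expL_vcvg hC hz x)) => d.
exact: (esym (epolZ (jK F) iota (lat z d) c x)).
Qed.

Section Order.
Variable N : nat.
Local Notation HasExp := (@HasExp R F C iota r N).

(* If T = t(pX), then 1 / t((p theta + c) X) = T^(-q^r) Delta (1 - u) with u of positive
   order in t. *)
Lemma tpar_scale (a : A) : a != 0 -> exists Psi,
  [/\ HasExp 0 Psi, bigO (size a).-1 Psi &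
      forall z X, Omega z -> iso z X -> tpar z (embA a * X) = tpar z X * Psi z X].
Proof.
elim/poly_ind: a => [|p c IH]; first by rewrite eqxx.
have [->|p0 _] := eqVneq p 0.
  rewrite mul0r add0r polyC_eq0 => c0; exists (fun _ _ => iota (tofrac c%:P)^-1); split.
  - exact/HasExp_cst/Lc_K.
  - by rewrite size_polyC c0; apply: (@bigO_cst R F C iota r (fun _ => iota (tofrac c%:P)^-1)).
  - by move=> z X hz isoX; rewrite /(tpar _ _) /tL (expzZ _ _ hz) invfM mulrC fmorphV.
have [Psi [HPsi OPsi EPsi]] := IH p0.
have [g [Zg Hg]] := Delta_spec hC hr.
pose Q := (q ^ r)%N; have Q1 : (1 < Q)%N by apply: qr_gt1.
pose T z X := tpar z X * Psi z X.
have HT : HasExp 1 T by have := HasExp_mul hC hr (HasExp_tpar hC hr N) HPsi; rewrite addr0.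
have OT : bigO 1 T.
  have := bigO_mul (@bigO_tparX R F C iota r 1) (HasExp_bigO0 HPsi); rewrite addn0.
  by apply: bigO_ext => z hz; apply: near_infT => X _; rewrite expr1.
have OTk k : (0 < k)%N -> bigO 1 (fun z X => T z X ^+ k).
  by move=> k0; apply: bigO_le (bigO_pow k OT); rewrite muln1.
have HTk k : HasExp k%:Z (fun z X => T z X ^+ k).
  by have := HasExp_pow hC hr k HT; rewrite mul1r.
(* [Delta + W] is [exp((p theta + c) X) T^Q], where [exp(pX) = 1 / T]. The last term is [c T^Q / t],
   written through [T = t Psi] to avoid the division. *)
pose W z X := theta * T z X ^+ Q.-1 + \sum_(i <- index_iota 1 r) g i z * T z X ^+ (Q - q ^ i) +
  iF iota c * (tpar z X ^+ Q.-1 * Psi z X ^+ Q).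
have HW : HasExp (Q - 1)%N%:Z W.
  apply: HasExp_add => //; first apply: HasExp_add => //.
  - have := HasExp_mul hC hr (HasExp_cst hr N (Lc_K hC r (tofrac 'X))) (HTk Q.-1).
    by rewrite add0r subn1.
  - apply: (HasExp_sum hC hr (Phi := fun i z X => g i z * T z X ^+ (Q - q ^ i))) => i.
    rewrite mem_index_iota => /andP[i1 ir].
    have le : (q ^ i <= Q)%N by rewrite leq_exp2l ?card_field_gt1 // ltnW.
    have lt : (0 < q ^ i)%N by rewrite expn_gt0 q_gt0.
    have -> : (Q - 1)%N%:Z = (q ^ i - 1)%N%:Z + (Q - q ^ i)%N%:Z.
      by move: le lt; set u := (q ^ i)%N; lia.
    by apply: HasExp_mul => //; apply: HasExp_cst => //; apply: Zc_Lc; apply: Zg.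
  - have := HasExp_mul hC hr (HasExp_cst hr N (Lc_K hC r (tofrac c%:P)))
      (HasExp_mul hC hr (HasExp_pow hC hr Q.-1 (HasExp_tpar hC hr N)) (HasExp_pow hC hr Q HPsi)).
    by rewrite mul0r addr0 add0r mul1r subn1.
have OW : bigO 1 W.
  apply: bigO_add; first apply: bigO_add.
  - have := bigO_mul (@bigO_cst R F C iota r (fun _ : 'rV[C]_r => theta)) (OTk Q.-1 _);
      rewrite add0n; apply.
    by rewrite -ltnS prednK // ltnW.
  - have OS : bigO 1 (fun z X => \sum_(i < r) (fun i z X => if (0 < i)%N then g i z * T z X ^+ (Q - q ^ i) else 0) i z X).
      apply: (@bigO_sum R F C iota r 1%N r (fun i z X => if (0 < i)%N then g i z * T z X ^+ (Q - q ^ i) else 0)).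
      move=> [|i] ir; first exact: bigO0.
      have := bigO_mul (@bigO_cst R F C iota r (g i.+1)) (OTk (Q - q ^ i.+1)%N _); rewrite add0n;
        apply.
      by rewrite subn_gt0 ltn_exp2l // card_field_gt1.
    apply: bigO_ext OS => z hz; apply: near_infT => X _ /=.
    rewrite -(big_mkord predT (fun i => if (0 < i)%N then g i z * T z X ^+ (Q - q ^ i) else 0)).
    rewrite [LHS]big_ltn //= add0r; apply: eq_big_nat => i /andP[i0 _]; by rewrite i0.
  - have := bigO_mul (@bigO_cst R F C iota r (fun _ : 'rV[C]_r => iF iota c))
      (bigO_mul (@bigO_tparX R F C iota r Q.-1) (bigO_pow Q (HasExp_bigO0 HPsi))).
    rewrite muln0 addn0 add0n; apply: bigO_le; by rewrite -ltnS prednK // ltnW.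
pose u z X := - ((Delta z)^-1 * W z X).
have Hu : HasExp 0 u.
  have H := HasExp_mul hC hr (HasExp_cst hr N (Lc_Delta_inv hC r)) HW.
  have := HasExp_mul hC hr (HasExp_cst hr N (Lc_K hC r (-1))) H.
  rewrite add0r addNr; apply: HasExp_extT => z X _ _.
  by rewrite rmorphN1 mulN1r.
have Ou : bigO 1 u.
  have H := bigO_mul (@bigO_cst R F C iota r (fun z => - (Delta z)^-1)) OW; rewrite add0n in H.
  by apply: bigO_ext H => z hz; apply: near_infT => X _; rewrite mulNr.
have HG := HasExp_geom hC hr Hu Ou.
(* This is [T^Q / (t Delta (1 - u))], again with [t] cancelled. *)
pose Psi' z X := tpar z X ^+ Q.-1 * Psi z X ^+ Q * ((Delta z)^-1 * (1 - u z X)^-1).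
exists Psi'; split.
- have := HasExp_mul hC hr
    (HasExp_mul hC hr (HasExp_pow hC hr Q.-1 (HasExp_tpar hC hr N)) (HasExp_pow hC hr Q HPsi))
    (HasExp_mul hC hr (HasExp_cst hr N (Lc_Delta_inv hC r)) HG).
  by rewrite mul0r !addr0 mul1r subn1 subrr.
- have := bigO_mul (bigO_mul (@bigO_tparX R F C iota r Q.-1) (bigO_pow Q OPsi))
    (bigO_mul (@bigO_cst R F C iota r (fun z => (Delta z)^-1)) (bigO_geom Ou)).
  (* The order [(Q - 1) + Q deg p] is at least [1 + deg p] because [Q >= 2]. *)
  apply: bigO_le; rewrite size_MXaddC (negPf p0) /= !addn0.
  have sp : (0 < size p)%N by rewrite lt0n size_poly_eq0.
  rewrite -{1}(prednK sp) -addn1 addnC leq_add //; first by rewrite -ltnS prednK // ltnW.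
  by rewrite leq_pmull // ltnW.
- move=> z X hz isoX.
  have isoP := iso_scale p0 isoX.
  have t0 : tpar z X != 0 by apply: tpar_neq0.
  have TE : tpar z (embA p * X) = T z X by apply: EPsi.
  have T0 : T z X != 0 by rewrite -TE; apply: tpar_neq0.
  have D0 := Delta_neq0 hC hr hz.
  have Y'E : expz z (embA p * X) = (T z X)^-1 by rewrite -TE /(tpar _ _) /tL invrK.
  have YE : expz z X = (tpar z X)^-1 by rewrite /(tpar _ _) /tL invrK.
  have PE : Psi z X = T z X / tpar z X by rewrite /T mulrAC mulfV // mul1r.
  have E : expz z (embA (p * 'X + c%:P) * X) * T z X ^+ Q = Delta z * (1 - u z X).
    rewrite embAD mulrDl (expzD _ _ hz) -/(iF iota c) (expzZ _ _ hz) embAM.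
    rewrite -[embA 'X]/theta [_ * theta]mulrC -mulrA (Hg z hz) Y'E YE.
    rewrite /u mulrBr mulr1 mulrN mulrA mulfV // mul1r opprK /W !mulrDl.
    have invT k : (k <= Q)%N -> (T z X)^-1 ^+ k * T z X ^+ Q = T z X ^+ (Q - k).
      by move=> kQ; rewrite -{1}(subnK kQ) exprD mulrCA -exprMn mulVf // expr1n mulr1.
    have -> : Delta z * (T z X)^-1 ^+ (q ^ r) * T z X ^+ Q = Delta z.
      by rewrite -mulrA (invT _ (leqnn Q)) subnn expr0 mulr1.
    have -> : theta / T z X * T z X ^+ Q = theta * T z X ^+ Q.-1.
      by rewrite -mulrA -[(T z X)^-1]expr1 invT ?subn1 // ltnW.
    have -> : iF iota c / tpar z X * T z X ^+ Q = iF iota c * (tpar z X ^+ Q.-1 * Psi z X ^+ Q).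
      rewrite -mulrA; congr (_ * _); rewrite /T exprMn mulrA; congr (_ * _).
      by rewrite -{1}(prednK (ltnW Q1)) exprS mulKf.
    have -> : (\sum_(1 <= i < r) g i z * (T z X)^-1 ^+ (q ^ i)) * T z X ^+ Q =
        \sum_(1 <= i < r) g i z * T z X ^+ (Q - q ^ i).
      rewrite mulr_suml; apply: eq_big_nat => i /andP[_ ir].
      by rewrite -mulrA invT // leq_exp2l ?card_field_gt1 // ltnW.
    by ring.
  have ex0 : expz z (embA (p * 'X + c%:P) * X) != 0.
    have a0 : p * 'X + c%:P != 0 by rewrite -size_poly_eq0 size_MXaddC (negPf p0).
    apply: (expL_iso_neq0 hC hz); exact: iso_scale a0 isoX.
  have U0 : 1 - u z X != 0.
    have : Delta z * (1 - u z X) != 0 by rewrite -E mulf_neq0 // expf_neq0.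
    by apply: contraNneq => ->; rewrite mulr0.
  have -> : tpar z (embA (p * 'X + c%:P) * X) = T z X ^+ Q / (Delta z * (1 - u z X)).
    by rewrite -E invfM mulrCA mulfV ?expf_neq0 // mulr1.
  rewrite invfM /Psi' mulrA; congr (_ * _); rewrite /T exprMn mulrA; congr (_ * _).
  by rewrite -exprS prednK // ltnW.
Qed.

End Order.
End ScaledParameter.

(** * Expansion of the multiple sums and tail estimates *)

Section ChainSumExpansion.
Variables (R : realType) (F : finFieldType) (C : ultrametricClosedFieldType R).
Variable iota : {rmorphism {fraction {poly F}} -> C}.
Hypothesis hC : is_Cinfty iota.
Variable r : nat.
Hypothesis hr : (0 < r)%N.
Local Notation vabs := (@vabs R C).
Local Notation A := {poly F}.
Local Notation embA := (embA iota).
Local Notation Omega := (Omega iota).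
Local Notation iso := (iso iota).
Local Notation tpar := (@tpar R F C iota r).
Local Notation epol := (@epol F C).
Local Notation lat := (lat iota).
Local Notation shiftsum := (shiftsum (jK F) iota).
Local Notation fspan := (span (fscale (jK F) iota)).
Local Notation MS := (MS (jK F) iota).
Local Notation psum := (psum (jK F) iota).
Implicit Types z : 'rV[C]_r.

Definition ucoefs k (X : C) : seq C := [seq embA p * X | p <- xbasis F k].

Definition pspan k : seq A := span (fun (c : F) (p : A) => c%:P * p) (xbasis F k).

Lemma size_pspan k p : p \in pspan k -> (size p <= k)%N.
Proof.
elim: k p => [|k IH] p; first by rewrite mem_seq1 => /eqP ->; rewrite size_poly0.
case/span_consP=> c [w [ws ->]]; apply: size_addX; exact: IH ws.
Qed.

Lemma size_monic_pspan k p : p \in pspan k -> size ('X^k + p) = k.+1.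
Proof. by move=> /size_pspan sp; rewrite size_polyDl size_polyXn. Qed.

Lemma monic_pspan_neq0 k p : p \in pspan k -> 'X^k + p != 0.
Proof. by move=> /size_monic_pspan sp; rewrite -size_poly_eq0 sp. Qed.

Lemma fspan_cat_sum us vs (f : C -> C) :
  \sum_(w <- fspan (us ++ vs)) f w = \sum_(u <- fspan us) \sum_(v <- fspan vs) f (u + v).
Proof.
elim: us f => [|b us IH] f /=.
  by rewrite big_seq1; apply: eq_bigr => v _; rewrite add0r.
rewrite !big_allpairs_dep; apply: eq_bigr => c _; rewrite IH.
by apply: eq_bigr => u _; apply: eq_bigr => v _; rewrite addrA.
Qed.

(** For [p] in [pspan k], the [X^k + p] are the monic polynomials of degree [k]; grouping the level
    by its [X]-coordinate produces the terms [S_s(aX)]. *)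
Lemma psum_ucoefs k d X s z :
  psum (embA 'X^k * X) (ucoefs k X ++ lat z d) s =
  \sum_(p <- pspan k) shiftsum (lat z d) s (embA ('X^k + p) * X).
Proof.
rewrite /(psum _ _ _) fspan_cat_sum.
have -> : fspan (ucoefs k X) = [seq embA p * X | p <- pspan k].
  apply: span_map.
  - by rewrite embA0 mul0r.
  - by move=> u v; rewrite embAD mulrDl.
  - by move=> c v; rewrite embAM -mulrA.
rewrite big_map; apply: eq_bigr => p _; apply: eq_bigr => v _.
by rewrite embAD mulrDl addrA.
Qed.

(** From here on the two occurrences of [d] are treated as independent levels, [k] for [X] and [d]
    for [z]. *)
Lemma lat_consz z X d : lat (consz X z) d = ucoefs d X ++ lat z d.
Proof.
rewrite /(lat _ _) /= map_cat -!map_comp; congr (_ ++ _); apply: eq_map => p /=.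
  by rewrite pairing_hcons pairing0 addr0.
by rewrite pairing_hcons embA0 mul0r add0r.
Qed.

Section Order.
Variable N : nat.
Local Notation HasExp := (@HasExp R F C iota r N).

(* Goss polynomials, through their recursion. *)
Lemma shiftsum_expansion s : exists Phi : 'rV[C]_r -> C -> C,
  (forall z X, Omega z -> iso z X -> vcvg (fun d => shiftsum (lat z d) s.+1 X) (Phi z X)) /\
  forall a : A, a != 0 -> HasExp s.+1%:Z (fun z X => Phi z (embA a * X)).
Proof.
have et z X : Omega z -> iso z X -> vcvg (fun d => (epol (lat z d)).[X]^-1) (tpar z X).
  move=> hz isoX; apply: vcvgV; first exact: expL_vcvg.
  by apply: (expL_iso_neq0 hC hz).
have Ht a : a != 0 -> HasExp 1 (fun z X => tpar z (embA a * X)).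
  move=> a0; have [Psi [HP _ EP]] := tpar_scale hC hr N a0.
  have := HasExp_mul hC hr (HasExp_tpar hC hr N) HP; rewrite addr0.
  by apply: HasExp_extT => z X hz isoX; rewrite EP.
elim/ltn_ind: s => -[|n] IH.
  exists tpar; split=> // z X hz isoX; apply: vcvg_eq (et z X hz isoX) => d.
  by rewrite shiftsum1 ?fspan_lat_uniq // iso_notin.
have /choice[Phi HPhi] : forall k, exists Phi : 'rV[C]_r -> C -> C, (k < n.+1)%N ->
  (forall z X, Omega z -> iso z X -> vcvg (fun d => shiftsum (lat z d) k.+1 X) (Phi z X)) /\
  forall a : A, a != 0 -> HasExp k.+1%:Z (fun z X => Phi z (embA a * X)).
  move=> k; have [/IH[Phi H]|_] := ltnP k n.+1; first by exists Phi.
  by exists (fun _ _ => 0).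
have /choice[eps Heps] := ZL_coef hC r.
exists (fun z X => tpar z X * \sum_(k < n.+1) (-1) ^+ (n + k) * Phi k z X * eps (n - k)%N z).
split=> [z X hz isoX|a a0].
  apply: (@vcvg_eq _ _ (fun d => (epol (lat z d)).[X]^-1 *
    \sum_(k < n.+1) (-1) ^+ (n + k) * shiftsum (lat z d) k.+1 X * (epol (lat z d))`_(n - k).+1)).
    move=> d; rewrite shiftsum_rec ?fspan_lat_uniq ?iso_notin //; congr (_ * _).
    by apply: eq_bigr => k _; rewrite subSn // -ltnS.
  apply: vcvgM; first exact: et.
  apply: vcvg_sum_ord => k; apply: vcvgM.
    by apply: vcvgZ; have [H _] := HPhi k (ltn_ord k); apply: H.
  by have [_ H] := Heps (n - k)%N; apply: H.
have -> : n.+2%:Z = 1 + n.+1%:Z by [].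
apply: HasExp_mul => //; first exact: Ht.
apply: (HasExp_extT (Phi := fun z X => \sum_(k <- enum 'I_n.+1)
    (-1) ^+ (n + k) * Phi k z (embA a * X) * eps (n - k)%N z)).
  by move=> z X _ _; rewrite big_enum.
apply: (HasExp_sum hC hr (Phi := fun (k : 'I_n.+1) z X =>
    (-1) ^+ (n + k) * Phi k z (embA a * X) * eps (n - k)%N z)) => k _.
have kn : (k <= n)%N by rewrite -ltnS.
have -> : n.+1%:Z = 0 + k.+1%:Z + (n - k)%N%:Z by lia.
apply: HasExp_mul => //; last first.
  by apply: HasExp_cst => //; apply: Zc_Lc; have [H _] := Heps (n - k)%N.
apply: HasExp_mul => //; last by have [_ H] := HPhi k (ltn_ord k); apply: H.
have := HasExp_cst hr N (Lc_K hC r ((-1) ^+ (n + k))).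
by apply: HasExp_extT => z X _ _; rewrite rmorphXn rmorphN1.
Qed.

(** With [k] fixed only the finitely many monic [a] of degree below [k] occur, so the limit in [d]
    is a finite combination of products of [S_s(aX)] and Eisenstein series of [z]. *)
Lemma MS_expansion k ss : is_index ss -> exists Phi : 'rV[C]_r -> C -> C,
  (forall z X, Omega z -> iso z X -> vcvg (fun d => MS (ucoefs k X ++ lat z d) ss) (Phi z X)) /\
  HasExp (wt ss)%:Z Phi.
Proof.
elim: k ss => [|k IH] ss ps.
  exists (fun z _ => Eis iota ss z); split; first by move=> z X hz _; apply: Eis_vcvg.
  by apply: HasExp_cst => //; apply: Zc_Lc; apply: Zc_Eis.
case: ss ps => [|s ss] ps.
  exists (fun _ _ => 1); split.
    by move=> z X _ _; apply: vcvg_eq (vcvg_cst 1) => d; rewrite MS_nil.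
  have := HasExp_cst hr N (Lc_K hC r 1).
  by apply: HasExp_extT => z X _ _; rewrite rmorph1.
have /= /andP[s0 pss] := ps.
have [P1 [c1 H1]] := IH (s :: ss) ps; have [P2 [c2 H2]] := IH ss pss.
have [S [cS HS]] := shiftsum_expansion s.-1; rewrite prednK // in cS HS.
exists (fun z X => P1 z X + (\sum_(p <- pspan k) S z (embA ('X^k + p) * X)) * P2 z X); split.
  move=> z X hz isoX; rewrite /= ; apply: vcvgD; first exact: c1.
  apply: vcvgM; last exact: c2.
  apply: (@vcvg_eq _ _ (fun d => \sum_(p <- pspan k) shiftsum (lat z d) s (embA ('X^k + p) * X))).
    by move=> d; rewrite -psum_ucoefs.
  apply: vcvg_sum => p pk; apply: cS => //.
  exact: iso_scale (monic_pspan_neq0 pk) isoX.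
apply: HasExp_add => //.
have -> : (wt (s :: ss))%:Z = s%:Z + (wt ss)%:Z by rewrite /wt /= PoszD.
apply: HasExp_mul => //.
apply: (HasExp_sum hC hr (Phi := fun p z X => S z (embA ('X^k + p) * X))) => p pk.
by apply: HS; apply: monic_pspan_neq0.
Qed.

End Order.

Lemma vabs_iso_scale (a : A) X : a != 0 -> vabs X <= vabs (embA a * X).
Proof.
by move=> a0; rewrite vabsM -[leLHS]mul1r ler_wpM2r ?vabs_ge0 // vabs_embA_ge1.
Qed.

Lemma vabs_shiftsum_le1 z X d s : Omega z -> iso z X -> 1 <= vabs X ->
  vabs (shiftsum (lat z d) s X) <= 1.
Proof.
move=> hz isoX X1; apply: le_trans (vabs_shiftsum_iso d s isoX) _.
by rewrite invf_le1 ?exprn_gt0 ?(lt_le_trans ltr01 X1) // exprn_ege1.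
Qed.

(** The Goss recursion exhibits one factor [1 / e(X)]. The rest is bounded uniformly in [d], since
    the coefficients of [e] converge and lower sums are at most 1 for [|X| >= 1]. *)
Lemma shiftsum_bound z s : Omega z -> exists2 B : R, 0 < B & forall X d,
  iso z X -> 1 <= vabs X -> vabs (shiftsum (lat z d) s.+1 X) <= B / vabs (epol (lat z d)).[X].
Proof.
move=> hz; case: s => [|n].
  exists 1 => // X d isoX X1.
  by rewrite shiftsum1 ?fspan_lat_uniq ?iso_notin // vabsV mul1r.
have [B B0 HB] : exists2 B : R, 0 < B &
    forall d k, (k < n.+1)%N -> vabs ((epol (lat z d))`_(n.+1 - k)) <= B.
  elim: (n.+1) {2}(n.+1) => [|m IH] n1; first by exists 1.
  have [B B0 HB] := IH n1.
  have [B' B'0 HB'] : exists2 B' : R, 0 < B' & forall d, vabs ((epol (lat z d))`_(n1 - m)) <= B'.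
    case: (n1 - m)%N => [|j].
      by exists 1 => // d; rewrite (coef0_epol (fspan_lat_uniq hC hz d)) vabs0 ler01.
    have [f [_ cf]] := ZL_coef hC r j; exact: vcvg_bounded_all (cf z hz).
  exists (Num.max B B'); first by rewrite lt_max B0.
  move=> d k; rewrite ltnS leq_eqVlt le_max => /orP[/eqP ->|/HB ->//].
  by rewrite HB' orbT.
exists B => // X d isoX X1.
rewrite shiftsum_rec ?fspan_lat_uniq ?iso_notin // vabsM vabsV mulrC.
rewrite ler_wpM2r ?invr_ge0 ?vabs_ge0 //; apply: vabs_sum_le; first exact: ltW.
move=> k _ _; rewrite !vabsM vabsX vabsN1 expr1n mul1r -[B]mul1r.
by rewrite ler_pM ?vabs_ge0 ?HB // vabs_shiftsum_le1.
Qed.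

Lemma vabs_psum_ucoefs z X k d s (B : R) : 0 <= B ->
  (forall a : A, size a = k.+1 -> vabs (shiftsum (lat z d) s (embA a * X)) <= B) ->
  vabs (psum (embA 'X^k * X) (ucoefs k X ++ lat z d) s) <= B.
Proof.
move=> B0 H; rewrite psum_ucoefs; apply: vabs_sum_le => // p pk _.
by apply: H; apply: size_monic_pspan.
Qed.

Lemma MS_bound z ss : Omega z -> is_index ss -> exists2 B : R, 0 < B & forall k d X,
  iso z X -> 1 <= vabs X -> vabs (MS (ucoefs k X ++ lat z d) ss) <= B.
Proof.
move=> hz; elim: ss => [|s ss IH] ps.
  by exists 1 => // k d X _ _; rewrite MS_nil vabs1.
have /= /andP[s0 pss] := ps; have [B B0 HB] := IH pss.
have [B' B'0 HB'] := vcvg_bounded_all (Eis_vcvg hC hz ps).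
exists (Num.max B B'); first by rewrite lt_max B0.
move=> k d X isoX X1; elim: k => [|k IHk]; first by rewrite le_max HB' orbT.
rewrite /=; apply: vabsD_le; first exact: IHk.
rewrite vabsM le_max; apply/orP; left; rewrite -[B]mul1r ler_pM ?vabs_ge0 ?HB //.
apply: vabs_psum_ucoefs => // a sa; have a0 : a != 0 by rewrite -size_poly_eq0 sa.
apply: vabs_shiftsum_le1 => //; first exact: iso_scale.
exact: le_trans (vabs_iso_scale _ a0).
Qed.

(** Each level from [D] on adds sums over [aX] with [deg a >= D], bounded through [1 / |e(aX)|] and
    hence [1 / |e(theta^D X)|] by monotonicity. The ultrametric inequality keeps the bound
    independent of [k], so [k = d] may tend to infinity. *)
Lemma MS_tail z ss : Omega z -> is_index ss -> exists2 B : R, 0 < B & forall D k d X,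
  (D <= k)%N -> iso z X -> 1 <= vabs X ->
  vabs (MS (ucoefs k X ++ lat z d) ss - MS (ucoefs D X ++ lat z d) ss) <=
    B / vabs (epol (lat z d)).[embA 'X^D * X].
Proof.
move=> hz; case: ss => [|s ss] ps.
  by exists 1 => // D k d X _ _ _; rewrite !MS_nil subrr vabs0 mulr_ge0 // invr_ge0 vabs_ge0.
have /= /andP[s0 pss] := ps; have [B B0 HB] := MS_bound hz pss.
have [B' B'0 HB'] := shiftsum_bound s.-1 hz; rewrite prednK // in HB'.
exists (B' * B); first by rewrite mulr_gt0.
move=> D k d X Dk isoX X1.
have XD0 : 'X^D != 0 :> A by rewrite monic_neq0 // monicXn.
have eD : 0 < vabs (epol (lat z d)).[embA 'X^D * X].
  apply: lt_le_trans (vabs_epol_ge hC hz d (iso_scale XD0 isoX)).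
  by rewrite vabs_gt0; apply: iso_neq0 (iso_scale XD0 isoX).
elim: k Dk => [|k IHk].
  rewrite leqn0 => /eqP ->; rewrite subrr vabs0 !mulr_ge0 ?invr_ge0 ?vabs_ge0 //; exact: ltW.
rewrite leq_eqVlt => /orP[/eqP <-|Dk].
  by rewrite subrr vabs0 !mulr_ge0 ?invr_ge0 ?vabs_ge0 //; exact: ltW.
rewrite [MS (ucoefs k.+1 X ++ _) _]/= addrAC; apply: vabsD_le; first exact: IHk.
rewrite vabsM mulrAC ler_pM ?vabs_ge0 ?HB //.
apply: vabs_psum_ucoefs; first by rewrite mulr_ge0 ?invr_ge0 ?vabs_ge0 // ltW.
move=> a sa; have a0 : a != 0 by rewrite -size_poly_eq0 sa.
have isoA := iso_scale a0 isoX.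
apply: le_trans (HB' _ d isoA (le_trans X1 (vabs_iso_scale _ a0))) _.
rewrite ler_pM2l // lef_pV2 ?posrE //; last first.
  apply: lt_le_trans (vabs_epol_ge hC hz d isoA).
  by rewrite vabs_gt0; apply: iso_neq0 isoA.
apply: vabs_epol_mono => //; first exact: iso_scale.
rewrite !vabsM ler_wpM2r ?vabs_ge0 // !(vabs_embA hC) // sa size_polyXn /=.
by rewrite ler_weXn2l ?(ltW (qR_gt1 _ _)) // -ltnS.
Qed.

End ChainSumExpansion.

(** * Identification of the coefficients *)

Section CoefficientExtraction.
Variables (R : realType) (F : finFieldType) (C : ultrametricClosedFieldType R).
Variable iota : {rmorphism {fraction {poly F}} -> C}.
Hypothesis hC : is_Cinfty iota.
Variable r : nat.
Hypothesis hr : (0 < r)%N.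
Local Notation vabs := (@vabs R C).
Local Notation A := {poly F}.
Local Notation embA := (embA iota).
Local Notation Omega := (Omega iota).
Local Notation iso := (iso iota).
Local Notation Lc := (@Lc R F C iota r).
Local Notation tpar := (@tpar R F C iota r).
Local Notation lat := (lat iota).
Local Notation MS := (MS (jK F) iota).
Implicit Types z : 'rV[C]_r.

Lemma tpar_small z : Omega z -> forall e : R, 0 < e ->
  exists X, [/\ iso z X, 1 <= vabs X & vabs (tpar z X) < e].
Proof.
move=> hz e e0; have [X [isoX]] := iso_unbounded hC z (Num.max 1 e^-1).
rewrite gt_max => /andP[X1 eX]; exists X; split=> //; first exact: ltW.
have X0 : 0 < vabs X by apply: lt_trans X1.
have le := vabs_expL_ge hC hz isoX.
rewrite vabsV invf_plt ?posrE ?(lt_le_trans X0 le) //; exact: lt_le_trans le.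
Qed.

(** The order condition at one [z], on the range [|X| >= 1] of the tail estimates; [tpar_small]
    supplies points of this range with [t] arbitrarily small. *)
Definition small_at z n (Phi : C -> C) := exists2 B : R, 0 <= B & near_inf iota z
  (fun X => 1 <= vabs X -> vabs (Phi X) <= B * vabs (tpar z X) ^+ n).

Lemma small_at_add z n Phi Psi : small_at z n Phi -> small_at z n Psi ->
  small_at z n (fun X => Phi X + Psi X).
Proof.
move=> [B B0 HB] [D D0 HD]; exists (Num.max B D); first by rewrite le_max B0.
have tn X : 0 <= vabs (tpar z X) ^+ n by rewrite exprn_ge0 // vabs_ge0.
apply: near_infI HB HD _ => X _ h1 h2 X1; apply: vabsD_le.
  by apply: le_trans (h1 X1) _; rewrite ler_wpM2r // le_max lexx.
by apply: le_trans (h2 X1) _; rewrite ler_wpM2r // le_max lexx orbT.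
Qed.

Lemma small_at_opp z n Phi : small_at z n Phi -> small_at z n (fun X => - Phi X).
Proof.
by move=> [B B0 HB]; exists B => //; apply: (near_infI HB HB) => X _ h _ /h; rewrite vabsN.
Qed.

(** The constant term is at most [|t| (B + D)] for arbitrarily small [|t|], so it vanishes; division
    by the nonzero [t] lowers [n]. *)
Lemma expansion_unique z n (c : nat -> C) : Omega z ->
  small_at z n (fun X => \sum_(i < n) c i * tpar z X ^+ i) -> forall i, (i < n)%N -> c i = 0.
Proof.
move=> hz; elim: n c => // n IH c [B B0 [e e0 He]].
pose S X := \sum_(i < n) c i.+1 * tpar z X ^+ i.
have SE X : \sum_(i < n.+1) c i * tpar z X ^+ i = c 0%N + tpar z X * S X.
  rewrite big_ord_recl expr0 mulr1 /S mulr_sumr; congr (_ + _).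
  by apply: eq_bigr => i _; rewrite exprS mulrCA.
have [D D0 HD] : exists2 D : R, 0 < D & forall i, (i < n)%N -> vabs (c i.+1) <= D.
  elim: (n) => [|m [D D0 HD]]; first by exists 1.
  exists (Num.max D (vabs (c m.+1))); first by rewrite lt_max D0.
  by move=> i; rewrite ltnS leq_eqVlt le_max => /orP[/eqP ->|/HD ->//]; rewrite lexx orbT.
have SD X : vabs (tpar z X) < 1 -> vabs (S X) <= D.
  move=> t1; apply: vabs_sum_le; first exact: ltW.
  move=> i _ _; rewrite vabsM vabsX -[D]mulr1 ler_pM ?vabs_ge0 ?exprn_ge0 ?vabs_ge0 ?HD //.
  by rewrite exprn_ile1 ?vabs_ge0 // ltW.
have c0 : c 0%N = 0.
  apply/eqP; apply: contraT => c0; have c0' : 0 < vabs (c 0%N) by rewrite vabs_gt0.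
  have BD : 0 < B + D by rewrite ltr_wpDl.
  have d0 : 0 < Num.min (Num.min e 1) (vabs (c 0%N) / (B + D)).
    by rewrite !lt_min e0 ltr01 divr_gt0.
  have [X [isoX X1]] := tpar_small hz d0; rewrite !lt_min => /andP[/andP[te t1]].
  rewrite ltr_pdivlMr // => tc; have := He X isoX te X1; rewrite SE => h.
  have t0 := vabs_ge0 (tpar z X).
  suff : vabs (c 0%N) <= vabs (tpar z X) * (B + D) by rewrite leNgt tc.
  rewrite -[c 0%N](addrK (tpar z X * S X)); apply: vabsD_le.
    apply: le_trans h _; rewrite mulrDr mulrC exprS -[leLHS]addr0 lerD ?mulr_ge0 ?(ltW D0) //.
    by rewrite mulrAC -[leRHS]mulr1 ler_wpM2l ?mulr_ge0 // exprn_ile1 // ltW.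
  rewrite vabsN vabsM mulrDr -[leLHS]add0r lerD ?mulr_ge0 //.
  by rewrite ler_wpM2l // SD.
case=> // i; rewrite ltnS => lt; apply: (IH (fun i => c i.+1)) => //.
exists B => //; exists e => // X isoX te X1.
have t0 : 0 < vabs (tpar z X) by rewrite vabs_gt0 tpar_neq0.
have := He X isoX te X1; rewrite SE c0 add0r vabsM exprS mulrCA.
by rewrite ler_pM2l.
Qed.

(** Convergence at a single [X0] bounds the terms there; for smaller [|t|] comparison with a
    geometric sequence bounds the tail. *)
Lemma series_small_at z n (b : nat -> C) (G : C -> C) : Omega z ->
  near_inf iota z (fun X => series (fun k => b k * tpar z X ^+ k) @ \oo --> G X) ->
  small_at z n (fun X => G X - \sum_(i < n) b i * tpar z X ^+ i).
Proof.
move=> hz [e e0 He]; have [X0 [iso0 X01 t0e]] := tpar_small hz e0.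
have t0 : 0 < vabs (tpar z X0) by rewrite vabs_gt0 tpar_neq0.
have /vcvgP cv0 := He X0 iso0 t0e; have [B B0 HB] := vcvg_bounded_all cv0.
have bB k : vabs (b k * tpar z X0 ^+ k) <= B.
  have -> : b k * tpar z X0 ^+ k = series (fun k => b k * tpar z X0 ^+ k) k.+1 -
      series (fun k => b k * tpar z X0 ^+ k) k.
    by rewrite /series /= big_nat_recr //= addrAC subrr add0r.
  by apply: vabsD_le; rewrite ?vabsN HB.
exists (B / vabs (tpar z X0) ^+ n); first by rewrite divr_ge0 ?exprn_ge0 ?vabs_ge0 // ltW.
exists (vabs (tpar z X0)) => // X isoX tt0 _.
have /vcvgP cv := He X isoX (lt_trans tt0 t0e).
apply: (vcvg_le (vcvgB cv (vcvg_cst _))); exists n => m nm.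
rewrite /series /= -(big_mkord predT (fun i => b i * tpar z X ^+ i)).
rewrite (big_cat_nat (leq0n n) nm) /= addrAC subrr add0r.
apply: vabs_sum_le; first by rewrite mulr_ge0 ?divr_ge0 ?exprn_ge0 ?vabs_ge0 // ltW.
move=> k; rewrite mem_index_iota => /andP[nk _] _.
have := bB k; rewrite !vabsM !vabsX => bk.
have -> : vabs (b k) * vabs (tpar z X) ^+ k =
    vabs (b k) * vabs (tpar z X0) ^+ k * (vabs (tpar z X) / vabs (tpar z X0)) ^+ k.
  by rewrite -mulrA -exprMn mulrCA mulfV ?mulr1 // gt_eqF.
rewrite -[leRHS]mulrA ler_pM ?mulr_ge0 ?exprn_ge0 ?divr_ge0 ?vabs_ge0 //.
rewrite [leRHS]mulrC -expr_div_n; apply: ler_wiXn2l => //.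
  by rewrite divr_ge0 ?vabs_ge0.
by rewrite ler_pdivrMr // mul1r ltW.
Qed.

Lemma tpar_thetaX_small z D : Omega z ->
  small_at z D (fun X => tpar z (embA 'X^D * X)).
Proof.
move=> hz; have XD0 : 'X^D != 0 :> A by rewrite monic_neq0 // monicXn.
have [Psi [_ OPsi EPsi]] := tpar_scale hC hr 0 XD0; rewrite size_polyXn in OPsi.
have [B B0 HB] := OPsi z hz; exists B => //.
have t1 : near_inf iota z (fun X => vabs (tpar z X) < 1) by exists 1.
apply: near_infI t1 HB _ => X isoX tX h _; rewrite EPsi // vabsM -[leRHS]mul1r.
by rewrite ler_pM ?vabs_ge0 // ltW.
Qed.

(** Limit of [MS_tail] with [k = d]: the error is at most a constant times [|t(theta^D X)|], which
    has order [D] in [t]. *)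
Lemma Eis_consz_small z D ss (Phi : C -> C) : Omega z -> is_index ss ->
  (forall X, iso z X -> vcvg (fun d => MS (ucoefs iota D X ++ lat z d) ss) (Phi X)) ->
  small_at z D (fun X => Eis iota ss (consz X z) - Phi X).
Proof.
move=> hz ps cPhi; have [B B0 HB] := MS_tail hC hz ps.
have [B' B'0 HB'] := tpar_thetaX_small D hz.
exists (B * B'); first by rewrite mulr_ge0 // ltW.
apply: (near_infI HB' HB') => X isoX h _ X1.
apply: le_trans (_ : B * vabs (tpar z (embA 'X^D * X)) <= _); last first.
  by rewrite -mulrA ler_pM2l // h.
have hc := Omega_consz hr hz isoX.
have XD0 : 'X^D != 0 :> A by rewrite monic_neq0 // monicXn.
have isoD := iso_scale XD0 isoX.
have [N1 HN1] := vcvg_vabs (expL_vcvg hC hz _) (expL_iso_neq0 hC hz isoD).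
apply: (vcvg_le (vcvgB (Eis_vcvg hC hc ps) (cPhi X isoX))).
exists (maxn D N1) => d; rewrite geq_max => /andP[Dd N1d].
rewrite lat_consz vabsV -(HN1 d N1d).
exact: HB.
Qed.

Lemma expansion_coefficient ss (beta : nat -> 'rV[C]_r -> C) N : is_index ss ->
  t_expansion iota (Eis iota ss) beta -> Lc ((wt ss)%:Z - N%:Z) (beta N).
Proof.
move=> ps [_ hbeta].
(* Both the order of the expansion and the number of levels in [X] are [N + 1], so all errors have
   order [N + 1] and the coefficient of [t^N] is determined. *)
have [Phi [cPhi [b [Lb Ob]]]] := MS_expansion hC hr N.+1 N.+1 ps.
apply: Lc_ext (Lb N) => z hz; apply/eqP; rewrite eq_sym -subr_eq0; apply/eqP.
apply: (@expansion_unique z N.+1 (fun i => beta i z - b i z)) => //.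
have [e e0 He] := hbeta z hz.
have s1 : small_at z N.+1 (fun X => Eis iota ss (consz X z) -
    \sum_(i < N.+1) beta i z * tpar z X ^+ i).
  apply: (@series_small_at z N.+1 (beta^~ z) (fun X => Eis iota ss (consz X z))) => //;
    exists e => // X isoX te.
  exact: (He X (Omega_consz hr hz isoX) te).
have s2 := Eis_consz_small hz ps (fun X isoX => cPhi z X hz isoX).
have s3 : small_at z N.+1 (fun X => Phi z X - \sum_(i < N.+1) b i z * tpar z X ^+ i).
  have [B B0 HB] := Ob z hz; exists B => //.
  by apply: (near_infI HB HB) => X _ h.
have [B B0 HB] := small_at_add (small_at_add s2 s3) (small_at_opp s1).
exists B => //; apply: (near_infI HB HB) => X _ h _ /h; congr (vabs _ <= _).
under [in RHS]eq_bigr do rewrite mulrBl.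
rewrite sumrB; ring.
Qed.

End CoefficientExtraction.

Theorem theorem3p6 (R : realType) (F : finFieldType)
    (C : ultrametricClosedFieldType R)
    (iota : {rmorphism {fraction {poly F}} -> C})
    (hC : is_Cinfty iota)
    (r : nat) (hr : (1 <= r)%N)
    (s : seq nat) (hs : is_index s)
    (beta : nat -> 'rV[C]_r -> C)
    (hbeta : t_expansion iota (Eis iota s) beta)
    (N : nat) :
  calL iota (Kfield iota) ((wt s)%:Z - N%:Z) (beta N).
Proof. exact: Lc_calL (expansion_coefficient hC hr N hs hbeta). Qed.
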